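(* Let $N\ge1$. The odd-indexed normalized one-row Capelli elements $D_1,D_3,D_5,\dots$ generate the center of $\mathrm U(\mathfrak q_N)$ as a $\mathbb C$-algebra: $$Z(\mathrm U(\mathfrak q_N))=\mathbb C[D_1,D_3,D_5,\dots].$$
   Context: Ground field $\mathbb C$. Queer Lie superalgebra: fix $N\ge1$, $I_N=\{-N,\dots,-1,1,\dots,N\}$, $\bar i=0$ if $i>0$ and $\bar i=1$ if $i<0$. Let $E_{ij}$ ($i,j\in I_N$) be the matrix units of $\mathfrak{gl}(N|N)$, of parity $\bar i+\bar j$ mod $2$. $\mathfrak q_N\subset\mathfrak{gl}(N|N)$ is the Lie sub-superalgebra spanned by $F_{ij}=E_{ij}+E_{-i,-j}$ (so $F_{-i,-j}=F_{ij}$). $\mathrm U(\mathfrak q_N)$ is its universal enveloping algebra and $Z_N=Z(\mathrm U(\mathfrak q_N))$ its center (in the superalgebra sense; all central elements are even). The notation $\mathbb C[D_1,D_3,\dots]$ denotes the generated subalgebra (no algebraic independence is asserted). Harish-Chandra map: $\mathfrak h_{\bar0}=\bigoplus_{i=1}^N\mathbb C F_{ii}$, $\mathfrak h_{\bar 1}=\bigoplus_{i=1}^N\mathbb C F_{i,-i}$, $\mathfrak n_+$ (resp. $\mathfrak n_-$) is the span of $F_{ij},F_{i,-j}$ with $1\le i<j\le N$ (resp. $1\le j<i\le N$). For $z\in Z_N$, $\mathrm{HC}(z)\in\mathbb C[\lambda_1,\dots,\lambda_N]$ is the polynomial with $z\equiv \mathrm{HC}(z)|_{\lambda_i=F_{ii}}$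 modulo $\mathfrak n_-\mathrm U(\mathfrak q_N)+\mathrm U(\mathfrak q_N)\mathfrak n_+$ (no $\rho$-shift). It is known that $\mathrm{HC}$ is an algebra isomorphism of $Z_N$ onto $\Gamma_N$, the algebra of symmetric polynomials $f\in\mathbb C[\lambda_1,\dots,\lambda_N]$ such that $f(t,-t,\lambda_3,\dots,\lambda_N)$ is independent of $t$ (no condition if $N=1$). Normalized one-row Capelli elements: $(u\downarrow r)=u(u-1)\cdots(u-r+1)$, $(u\downarrow0)=1$. Let $Q^-_{(0)}=1$ and for $r\ge1$ let $Q^-_{(r)}\in\Gamma_N$ be the one-row factorial Schur $Q$-polynomial $Q^-_{(r)}(\lambda)=2\sum_{i=1}^N(\lambda_i\downarrow r)\prod_{j\ne i}\frac{\lambda_i+\lambda_j}{\lambda_i-\lambda_j}$; equivalently $\sum_{r\ge0}Q^-_{(r)}(\lambda)/(u\downarrow r)=\prod_{i=1}^N\frac{u+1+\lambda_i}{u+1-\lambda_i}$ as series in $u^{-1}$. Then $D_0=1$ and $D_r=\frac1{r!}C_{(r)}$ for $r\ge1$, where $C_{(r)}$ is Nazarov's Capelli element of the one-row strict partition $(r)$; $D_r$ is the unique element of $Z_N$ with $\mathrm{HC}(D_r)=Q^-_{(r)}$. *)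

(* Defs.v *)
(* The ground field of complex numbers is R[i] for R : realType. *)
From HB Require Import structures.
From mathcomp Require Import all_boot all_order all_algebra.
From mathcomp Require Import boolp reals complex.
From mathcomp Require Import monalg mpoly.

Set Implicit Arguments.
Unset Strict Implicit.
Unset Printing Implicit Defensive.

Import GRing.Theory.
Local Open Scope ring_scope.
Local Open Scope quotient_scope.

(* monalg and mpoly both declare this notation; multinomials' [mpoly] is meant. *)
Notation "{ 'mpoly' R [ n ] }" := (mpoly.mpoly n R) : type_scope.

(** * The universal enveloping algebra of a Lie superalgebra

    A Lie superalgebra is given by a module [g], the predicates
    [hom false] and [hom true] of even and odd elements, and [br p q x y],
    the superbracket of homogeneous elements [x], [y] of parities [p], [q].
    [uea hom br] is the free algebra on symbols [x], one for each x in g,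
    modulo linearity of x |-> [x] and xy - (-1)^(pq) yx = [x, y]. *)

Section UniversalEnveloping.

Variables (K : fieldType) (g : lmodType K).
Variables (hom : bool -> g -> Prop) (br : bool -> bool -> g -> g -> g).

Definition free_alg : Type := {malg K[{fmonom g}]}.
HB.instance Definition _ := GRing.Lalgebra.on free_alg.

Definition free_gen (x : g) : free_alg := << fmu x >>.

Inductive uea_ideal : free_alg -> Prop :=
| uea_ideal_lin (a : K) (x y : g) :
    uea_ideal (free_gen (a *: x + y) - (a *: free_gen x + free_gen y))
| uea_ideal_br (p q : bool) (x y : g) : hom p x -> hom q y ->
    uea_ideal (free_gen x * free_gen y
               - (-1) ^+ (p && q) * (free_gen y * free_gen x)
               - free_gen (br p q x y))
| uea_ideal0 : uea_ideal 0
| uea_idealD u v : uea_ideal u -> uea_ideal v -> uea_ideal (u + v)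
| uea_idealM u v w : uea_ideal v -> uea_ideal (u * v * w).

Definition uea_idealb (u : free_alg) : bool := `[< uea_ideal u >].

Lemma uea_ideal_zmod_closed : zmod_closed uea_idealb.
Proof.
split=> [|u v /asboolP Iu /asboolP Iv]; apply/asboolP.
  exact: uea_ideal0.
apply: uea_idealD => //; rewrite -mulN1r -[_ * _]mulr1.
exact: uea_idealM.
Qed.

HB.instance Definition _ :=
  GRing.isZmodClosed.Build free_alg uea_idealb uea_ideal_zmod_closed.

Definition uea_idealz : zmodClosed free_alg :=
  GRing.ZmodClosed.clone free_alg uea_idealb _.

Definition uea : Type := Quotient.quot uea_idealz.
HB.instance Definition _ := GRing.Zmodule.on uea.

Definition uea_pi (u : free_alg) : uea := \pi_(Quotient.quot uea_idealz) u.
Definition uea_repr (x : uea) : free_alg := repr (x : Quotient.quot uea_idealz).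

Lemma uea_reprK x : uea_pi (uea_repr x) = x.
Proof. exact: reprK. Qed.

Lemma uea_pi_eq u v : uea_pi u = uea_pi v <-> uea_ideal (u - v).
Proof.
have I_E : (u - v \in uea_idealz) = `[< uea_ideal (u - v) >] by [].
split=> [uv|/asboolP]; last by rewrite -I_E Quotient.idealrBE => /eqP.
by apply/asboolP; rewrite -I_E Quotient.idealrBE; apply/eqP.
Qed.

Lemma uea_reprP u : uea_ideal (uea_repr (uea_pi u) - u).
Proof. by apply/uea_pi_eq; rewrite uea_reprK. Qed.

Lemma uea_piB : zmod_morphism uea_pi.
Proof. by move=> u v; rewrite /uea_pi !piE. Qed.

HB.instance Definition _ := GRing.isZmodMorphism.Build free_alg uea uea_pi uea_piB.

Definition uea_one : uea := uea_pi 1.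
Definition uea_mul (x y : uea) : uea := uea_pi (uea_repr x * uea_repr y).
Definition uea_scale (a : K) (x : uea) : uea := uea_pi (a *: uea_repr x).

Lemma uea_idealMl u v : uea_ideal v -> uea_ideal (u * v).
Proof. by move=> Iv; rewrite -[u * v]mulr1; apply: uea_idealM. Qed.

Lemma uea_idealMr u v : uea_ideal v -> uea_ideal (v * u).
Proof. by move=> Iv; rewrite -[v]mul1r; apply: uea_idealM. Qed.

Lemma uea_piM u v : uea_pi (u * v) = uea_mul (uea_pi u) (uea_pi v).
Proof.
apply/esym/uea_pi_eq; set u' := uea_repr _; set v' := uea_repr _.
rewrite (_ : _ - _ = u' * (v' - v) + (u' - u) * v).
  by apply: uea_idealD; [apply: uea_idealMl|apply: uea_idealMr];
     apply: uea_reprP.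
by rewrite mulrBr mulrBl addrA subrK.
Qed.

Lemma uea_piZ a u : uea_pi (a *: u) = uea_scale a (uea_pi u).
Proof.
apply/esym/uea_pi_eq; rewrite -scalerBr -[_ - _]mul1r scalerAl.
by apply: uea_idealMl; apply: uea_reprP.
Qed.

Lemma uea_mulA : associative uea_mul.
Proof.
move=> x y z; rewrite -[x]uea_reprK -[y]uea_reprK -[z]uea_reprK.
by rewrite -!uea_piM mulrA.
Qed.

Lemma uea_mul1r : left_id uea_one uea_mul.
Proof. by move=> x; rewrite -[x]uea_reprK -uea_piM mul1r. Qed.

Lemma uea_mulr1 : right_id uea_one uea_mul.
Proof. by move=> x; rewrite -[x]uea_reprK -uea_piM mulr1. Qed.

Lemma uea_mulDl : left_distributive uea_mul +%R.
Proof.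
move=> x y z; rewrite -[x]uea_reprK -[y]uea_reprK -[z]uea_reprK.
by rewrite -raddfD -!uea_piM -raddfD mulrDl.
Qed.

Lemma uea_mulDr : right_distributive uea_mul +%R.
Proof.
move=> x y z; rewrite -[x]uea_reprK -[y]uea_reprK -[z]uea_reprK.
by rewrite -raddfD -!uea_piM -raddfD mulrDr.
Qed.

(* The augmentation (constant coefficient) vanishes on the ideal. *)
Lemma uea_ideal_counit (u : free_alg) : uea_ideal u ->
  @monalg.mcoeff {fmonom g} K mone u = 0.
Proof.
have gen0 x : @monalg.mcoeff {fmonom g} K mone (free_gen x) = 0.
  rewrite monalg.mcoeffU1; case: eqP => // /(congr1 (@fdeg _)).
  by rewrite fdegU fdeg1.
elim=> [a x y|p q x y _ _||v w _ Iv _ Iw|v w t _ Iw].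
- by rewrite raddfB raddfD /= monalg.mcoeffZ !gen0 mulr0 addr0 subr0.
- by rewrite !raddfB /= !rmorphM /= !gen0 !mulr0 !subr0.
- exact: raddf0.
- by rewrite raddfD /= Iv Iw addr0.
- by rewrite !rmorphM /= Iw mulr0 mul0r.
Qed.

Lemma uea_one_neq0 : uea_one != 0.
Proof.
apply/eqP; rewrite -(raddf0 uea_pi) => /uea_pi_eq /uea_ideal_counit /eqP.
by rewrite subr0 monalg.mcoeff1 eqxx oner_eq0.
Qed.

HB.instance Definition _ := GRing.Zmodule_isNzRing.Build uea
  uea_mulA uea_mul1r uea_mulr1 uea_mulDl uea_mulDr uea_one_neq0.

Lemma uea_scaleA a b x : uea_scale a (uea_scale b x) = uea_scale (a * b) x.
Proof. by rewrite -[x]uea_reprK -!uea_piZ scalerA. Qed.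

Lemma uea_scale1 : left_id 1 uea_scale.
Proof. by move=> x; rewrite -[x]uea_reprK -uea_piZ scale1r. Qed.

Lemma uea_scaleDr : right_distributive uea_scale +%R.
Proof.
move=> a x y; rewrite -[x]uea_reprK -[y]uea_reprK.
by rewrite -raddfD -!uea_piZ -raddfD scalerDr.
Qed.

Lemma uea_scaleDl x : {morph uea_scale^~ x : a b / a + b}.
Proof.
by move=> a b; rewrite -[x]uea_reprK -!uea_piZ -raddfD scalerDl.
Qed.

HB.instance Definition _ := GRing.Zmodule_isLmodule.Build K uea
  uea_scaleA uea_scale1 uea_scaleDr uea_scaleDl.

Lemma uea_pi_monoid : monoid_morphism uea_pi.
Proof. by split=> // u v; rewrite uea_piM. Qed.

HB.instance Definition _ :=
  GRing.isMonoidMorphism.Build free_alg uea uea_pi uea_pi_monoid.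

Lemma uea_pi_scalable : scalable uea_pi.
Proof. exact: uea_piZ. Qed.

HB.instance Definition _ :=
  GRing.isScalable.Build K free_alg uea *:%R uea_pi uea_pi_scalable.

Lemma uea_scaleAl (a : K) (x y : uea) : a *: (x * y) = a *: x * y.
Proof.
rewrite -[x]uea_reprK -[y]uea_reprK.
by rewrite -rmorphM -!linearZ -rmorphM /= scalerAl.
Qed.

HB.instance Definition _ := GRing.Lmodule_isLalgebra.Build K uea uea_scaleAl.

Lemma free_scaleAr (a : K) (u v : free_alg) : a *: (u * v) = u * (a *: v).
Proof.
have le_av : (finmap.fsubset (monalg.msupp (a *: v)) (monalg.msupp v)).
  apply/finmap.fsubsetP => m; rewrite -!monalg.mcoeff_neq0 monalg.mcoeffZ.
  by apply: contraNneq => ->; rewrite mulr0.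
apply/malgP=> k; rewrite monalg.mcoeffZ monalg.mcoeffMl.
rewrite (monalg.mcoeffMlw _ (finmap.fsubset_refl _) le_av).
rewrite mulr_sumr; apply: eq_bigr => k1 _; rewrite mulr_sumr.
by apply: eq_bigr => k2 _; rewrite monalg.mcoeffZ mulrnAr mulrCA.
Qed.

Lemma uea_scaleAr (a : K) (x y : uea) : a *: (x * y) = x * (a *: y).
Proof.
rewrite -[x]uea_reprK -[y]uea_reprK.
by rewrite -rmorphM -!linearZ -rmorphM /= free_scaleAr.
Qed.

HB.instance Definition _ := GRing.Lalgebra_isAlgebra.Build K uea uea_scaleAr.

Definition uea_gen (x : g) : uea := uea_pi (free_gen x).

Inductive uea_hom : bool -> uea -> Prop :=
| uea_hom_gen p x : hom p x -> uea_hom p (uea_gen x)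
| uea_hom0 p : uea_hom p 0
| uea_hom1 : uea_hom false 1
| uea_homD p u v : uea_hom p u -> uea_hom p v -> uea_hom p (u + v)
| uea_homZ p (a : K) u : uea_hom p u -> uea_hom p (a *: u)
| uea_homM p q u v : uea_hom p u -> uea_hom q v -> uea_hom (p (+) q) (u * v).

Definition supercentral (p : bool) (z : uea) : Prop :=
  uea_hom p z /\
  forall q u, uea_hom q u -> z * u = (-1) ^+ (p && q) * (u * z).

Definition supercenter (z : uea) : Prop :=
  exists z0 z1, [/\ supercentral false z0, supercentral true z1 & z = z0 + z1].

End UniversalEnveloping.

Inductive subalg_gen (K : pzRingType) (A : lalgType K) (S : A -> Prop) :
  A -> Prop :=
| subalg_gen_in x : S x -> subalg_gen S x
| subalg_gen1 : subalg_gen S 1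
| subalg_genD x y : subalg_gen S x -> subalg_gen S y -> subalg_gen S (x + y)
| subalg_genZ (a : K) x : subalg_gen S x -> subalg_gen S (a *: x)
| subalg_genM x y : subalg_gen S x -> subalg_gen S y -> subalg_gen S (x * y).

(** * The queer Lie superalgebra *)

(* I_N = {-N, .., -1, 1, .., N}: [inl i] is the positive index i + 1 and
   [inr i] is -(i + 1); [unsplit] numbers I_N by rows and columns of
   (N + N) x (N + N) matrices, so that gl(N|N) is 'M_(N + N). *)
Definition sidx (N : nat) : Type := ('I_N + 'I_N)%type.
HB.instance Definition _ N := Finite.on (sidx N).

Definition pos (N : nat) (i : 'I_N) : sidx N := inl i.
Definition neg (N : nat) (i : sidx N) : sidx N :=
  match i with inl k => inr k | inr k => inl k end.
Definition sparity (N : nat) (i : sidx N) : bool :=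
  if i is inl _ then false else true.

Section Queer.

Variables (K : fieldType) (N : nat).
Implicit Types (i j : sidx N) (X Y : 'M[K]_(N + N)).

Definition gl_E i j : 'M[K]_(N + N) := delta_mx (unsplit i) (unsplit j).

Definition gl_hom (p : bool) X : Prop :=
  forall i j, sparity i (+) sparity j != p -> X (unsplit i) (unsplit j) = 0.

Definition gl_br (p q : bool) X Y : 'M[K]_(N + N) :=
  X *m Y - (-1) ^+ (p && q) *: (Y *m X).

Definition gl_F i j : 'M[K]_(N + N) := gl_E i j + gl_E (neg i) (neg j).

Definition qspace : {vspace 'M[K]_(N + N)} :=
  (\sum_(i : sidx N) \sum_(j : sidx N) <[gl_F i j]>)%VS.

Local Arguments unsplit : simpl never.

Lemma negK : involutive (@neg N).
Proof. by case. Qed.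

Lemma unsplit_inj : injective (@unsplit N N).
Proof. exact: can_inj (@unsplitK N N). Qed.

Lemma gl_EE i j k l :
  gl_E i j (unsplit k) (unsplit l) = ((k == i) && (l == j))%:R.
Proof. by rewrite mxE !(inj_eq unsplit_inj). Qed.

Lemma gl_FE i j k l : gl_F i j (unsplit k) (unsplit l) =
  ((k == i) && (l == j))%:R + ((k == neg i) && (l == neg j))%:R.
Proof. by rewrite mxE !gl_EE. Qed.

Lemma gl_F_in i j : gl_F i j \in qspace.
Proof. by do 2!apply: sumv_sup => //; apply: memv_line. Qed.

Lemma qspaceP X : reflect
  (forall i j, X (unsplit (neg i)) (unsplit (neg j)) = X (unsplit i) (unsplit j))
  (X \in qspace).
Proof.
apply: (iffP idP) => [|symX].
  move=> /memv_sumP[f fP ->] i j; rewrite !summxE; apply: eq_bigr => a _.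
  have /memv_sumP[h hP ->] := fP a isT; rewrite !summxE.
  apply: eq_bigr => b _; have /vlineP[c ->] := hP b isT.
  rewrite [LHS]mxE [RHS]mxE !gl_FE !(inj_eq (can_inj negK)).
  by rewrite ![neg _ == _](can2_eq negK negK) addrC.
have -> : X = \sum_(a < N) \sum_(j : sidx N)
                X (unsplit (pos a)) (unsplit j) *: gl_F (pos a) j.
  apply/matrixP => k l; rewrite -[k]splitK -[l]splitK.
  move: (split k) (split l) => {}k {}l; rewrite summxE.
  under eq_bigr do rewrite summxE.
  case: k => k.
    rewrite (bigD1 k) //= (bigD1 l) //= !big1 ?addr0.
    - by rewrite mxE gl_FE !eqxx addr0 mulr1.
    - move=> a neq_ak; apply: big1 => j _.
      rewrite mxE gl_FE /= addr0.
      by rewrite [_ == _](negbTE _) ?mulr0 // (inj_eq (@inl_inj _ _)) eq_sym.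
    - move=> j neq_jl; rewrite mxE gl_FE /= addr0.
      by rewrite [l == j]eq_sym (negbTE neq_jl) andbF mulr0.
  rewrite (bigD1 k) //= (bigD1 (neg l)) //= !big1 ?addr0.
  - rewrite mxE gl_FE /= negK !eqxx add0r mulr1.
    by rewrite -(symX _ l).
  - move=> a neq_ak; apply: big1 => j _.
    rewrite mxE gl_FE /= add0r.
    by rewrite [_ == _](negbTE _) ?mulr0 // (inj_eq (@inr_inj _ _)) eq_sym.
  - move=> j neq_jl; rewrite mxE gl_FE /= add0r.
    rewrite [l == _](negbTE _) ?andbF ?mulr0 //.
    by apply: contraNneq neq_jl => ->; rewrite negK.
by apply: rpred_sum => a _; apply: rpred_sum => j _; rewrite rpredZ ?gl_F_in.
Qed.

Definition negord (k : 'I_(N + N)) : 'I_(N + N) := unsplit (neg (split k)).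

Lemma negordK : involutive negord.
Proof. by move=> k; rewrite /negord unsplitK negK splitK. Qed.

Lemma qspaceM X Y : X \in qspace -> Y \in qspace -> X *m Y \in qspace.
Proof.
move=> /qspaceP qX /qspaceP qY; apply/qspaceP => i j; rewrite !mxE.
rewrite (reindex_inj (can_inj negordK)) /=; apply: eq_bigr => k _.
by rewrite /negord qX qY splitK.
Qed.

Lemma gl_br_qspace p q X Y :
  X \in qspace -> Y \in qspace -> gl_br p q X Y \in qspace.
Proof. by move=> qX qY; apply: rpredB; [|apply: rpredZ]; apply: qspaceM. Qed.

Definition qN : Type := subvs_of qspace.
HB.instance Definition _ := Vector.on qN.

Definition q_hom (p : bool) (x : qN) : Prop := gl_hom p (vsval x).
Definition q_br (p q : bool) (x y : qN) : qN :=
  vsproj qspace (gl_br p q (vsval x) (vsval y)).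

Lemma q_brE p q x y : vsval (q_br p q x y) = gl_br p q (vsval x) (vsval y).
Proof. by rewrite vsprojK ?gl_br_qspace ?subvsP. Qed.

Definition U_q : Type := uea q_hom q_br.
HB.instance Definition _ := GRing.Algebra.on U_q.

Definition U_gen (x : qN) : U_q := uea_gen q_hom q_br x.
Definition U_F i j : U_q := U_gen (vsproj qspace (gl_F i j)).

Definition Z_q : U_q -> Prop := @supercenter K qN q_hom q_br.

(** * The Harish-Chandra map *)

Definition n_plus : {vspace 'M[K]_(N + N)} :=
  (\sum_(a < N) \sum_(b < N | (a < b)%N)
     (<[gl_F (pos a) (pos b)]> + <[gl_F (pos a) (neg (pos b))]>))%VS.
Definition n_minus : {vspace 'M[K]_(N + N)} :=
  (\sum_(a < N) \sum_(b < N | (b < a)%N)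
     (<[gl_F (pos a) (pos b)]> + <[gl_F (pos a) (neg (pos b))]>))%VS.

(* n_- U + U n_+, as finite sums of products *)
Definition HC_kernel (u : U_q) : Prop :=
  exists s t : seq (qN * U_q),
    [/\ {in s, forall p, vsval p.1 \in n_minus},
        {in t, forall p, vsval p.1 \in n_plus} &
        u = \sum_(p <- s) U_gen p.1 * p.2 + \sum_(p <- t) p.2 * U_gen p.1].

(* [is_HC z f] says that HC(z) = f. The F_ii commute, so the order of the
   factors in the evaluation [mmap] of f is immaterial. *)
Definition is_HC (z : U_q) (f : {mpoly K[N]}) : Prop :=
  HC_kernel (z - mpoly.mmap (fun c => c%:A) (fun a => U_F (pos a) (pos a)) f).

(** * One-row factorial Schur Q-polynomials *)

(* the falling power u (u - 1) .. (u - r + 1) *)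
Definition falling (A : pzRingType) (u : A) (r : nat) : A :=
  \prod_(k < r) (u - k%:R).

Local Notation "p %:F" := (@FracField.tofrac {mpoly K[N]} p).

Definition Qminus_frac (r : nat) : {fraction {mpoly K[N]}} :=
  2 * \sum_(a < N) (falling 'X_a r)%:F *
        \prod_(b < N | b != a) (('X_a + 'X_b)%:F / ('X_a - 'X_b)%:F).

Definition is_Qminus (r : nat) (f : {mpoly K[N]}) : Prop :=
  f%:F = Qminus_frac r.

(* D_r is defined through its Harish-Chandra image: HC(D_r) = Q^-_(r). *)
Definition is_capelli (D : nat -> U_q) : Prop :=
  D 0%N = 1 /\
  forall r, (0 < r)%N -> Z_q (D r) /\ exists2 Q, is_Qminus r Q & is_HC (D r) Q.

End Queer.

(* Main.v *)
(* Filter U(q_N) by word length. Since q_N is closed under the product of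
   gl(N|N), sending F_g to multiplication by F_g plus the derivation extending
   left multiplication by F_g makes the superpolynomials S(q_N) a
   U(q_N)-module; letting u act on 1 and taking the top component gives the PBW
   symbol of u. The symbol of a central element is ad-invariant, and an
   invariant is determined by its restriction to the span of the F_ii: the
   invariance equations kill successively the components of degree 0, 1, ... in
   the other letters. In particular odd central elements vanish.
   The restriction of an invariant is supersymmetric (differentiate along curves
   of matrices), hence a polynomial in the coefficients q_r of
   prod_i (1 + x_i t) / (1 - x_i t), by induction on N and Lagrange
   interpolation; Q(t) Q(-t) = 1 leaves only the q_r with r odd.
   A central element differs from its Harish-Chandra polynomial by block-sorted
   words with a letter in n_- or n_+, whose symbols restrict to 0; as q_r is the
   top component of Q^-_(r), the symbol of D_r restricts to q_r. So a
   polynomial in D_1, D_3, ... can be subtracted from a central element to lower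
   its filtration degree. *)
Require Import Defs.
From HB Require Import structures.
From mathcomp Require Import all_boot all_order all_algebra all_fingroup.
From mathcomp Require Import boolp reals complex.
From mathcomp Require Import mpoly ring.
From mathcomp Require monalg finmap.

Set Implicit Arguments.
Unset Strict Implicit.
Unset Printing Implicit Defensive.

Import Order.TTheory GRing.Theory Num.Theory.
Local Open Scope ring_scope.

(** * Supersymmetric polynomials *)

(** The element D_r is known only through its Harish-Chandra image, so neither its filtration degree
    nor its symbol is given. Both come from a descent: while the bound on the degree exceeds r, the
    restricted symbol is a component of Q^-_(r) of degree above r, hence zero, so the symbol is zero
    and the bound drops. The words spanning n_- U + U n_+ may be longer than the degree of their
    sum, so they must be straightened inside their own span. An invariant is determined by its
    restriction because the equation of F_ij (resp. F_(i,-j)), read in lowest codegree, is x_i - x_j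
    (resp. x_i + x_j) times the derivative along the opposite letter, and such a linear form is not
    a zero divisor. The weights 2 prod_(j != i) (x_i + x_j) / (x_i - x_j) link the two families: q_r
    is the weighted sum of the x_i^r, and Q^-_(r) that of the falling powers. Interpolation turns a
    supersymmetric polynomial divisible by x_i prod_(j != i) (x_i + x_j) for each i into such a
    weighted sum. *)

Section Density.
Variable K : numFieldType.

(** Testing only at positive integers lets later applications divide by the point. *)
Lemma poly_nat_eq0 (p : {poly K}) : (forall n : nat, p.[n.+1%:R] = 0) -> p = 0.
Proof.
move=> p0; apply/eqP/negPn/negP => pn0.
have /(max_poly_roots pn0): all (root p) [seq n.+1%:R | n <- iota 0 (size p)].
  by apply/allP => _ /mapP[n _ ->]; apply/rootP; rewrite p0.
rewrite map_inj_uniq ?iota_uniq => [/(_ isT)|m n /eqP]; first by rewrite size_map size_iota ltnn.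
by rewrite eqr_nat => /eqP[].
Qed.

Lemma poly_horner_inj (p q : {poly K}) : (forall t, p.[t] = q.[t]) -> p = q.
Proof.
by move=> pq; apply/eqP; rewrite -subr_eq0; apply/eqP/poly_nat_eq0 => n;
   rewrite hornerD hornerN pq subrr.
Qed.

Definition extend N (v : 'I_N -> K) (t : K) (i : 'I_N.+1) : K :=
  if unlift ord_max i is Some j then v j else t.

Lemma extend_lift N (v : 'I_N -> K) t j : extend v t (lift ord_max j) = v j.
Proof. by rewrite /extend liftK. Qed.

Lemma extend_max N (v : 'I_N -> K) t : extend v t ord_max = t.
Proof. by rewrite /extend unlift_none. Qed.

Lemma meval_muni N (p : {mpoly K[N.+1]}) (v : 'I_N -> K) t :
  (map_poly (meval v) (muni p)).[t] = p.@[extend v t].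
Proof.
have lift_widen (j : 'I_N) : lift ord_max j = widen_ord (leqnSn N) j.
  by apply/val_inj; rewrite /= /bump leqNgt ltn_ord.
rewrite muniE rmorph_sum /= horner_sum mevalE; apply: eq_bigr => m _.
rewrite -mul_polyC rmorphM /= map_polyC /= map_polyXn !hornerE /=.
rewrite mevalZ mevalX -mulrA big_ord_recr /= extend_max.
congr (_ * (_ * _)); apply: eq_bigr => j _.
by rewrite mnmE -(lift_widen j) extend_lift.
Qed.

Lemma muni_eq0 N (p : {mpoly K[N.+1]}) : muni p = 0 -> p = 0.
Proof.
move=> p0; apply/mpolyP => m; rewrite mcoeff0.
have := congr1 (fun P : {poly {mpoly K[N]}} => (P`_(m ord_max))@_[multinom m (widen_ord (leqnSn N) i) | i < N]) p0.
rewrite coef0 mcoeff0 muniE coef_sum raddf_sum /=.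
case: (boolP (m \in msupp p)) => [mp|/memN_msupp_eq0 -> //].
rewrite (bigD1_seq m) ?msupp_uniq //= big1 ?addr0 => [|k km].
  by rewrite coefZ coefXn eqxx mulr1 mcoeffZ mcoeffX eqxx mulr1.
rewrite coefZ coefXn; case: eqP => [e|]; last by rewrite mulr0 mcoeff0.
rewrite mulr1 mcoeffZ mcoeffX; case: eqP => [/mnmP e'|]; last by rewrite mulr0.
case/eqP: km; apply/mnmP => i; case: (unliftP ord_max i) => [j ->|->] //.
have -> : lift ord_max j = widen_ord (leqnSn N) j.
  by apply/val_inj; rewrite /= /bump leqNgt ltn_ord.
by have := e' j; rewrite !mnmE.
Qed.

Lemma mpoly_meval_eq0 N (p : {mpoly K[N]}) : (forall v, p.@[v] = 0) -> p = 0.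
Proof.
elim: N p => [|N IH] p p0.
  by have := p0 (fun=> 0); rewrite [p]nvar0_mpolyC mevalC => ->; rewrite mpolyC0.
apply: muni_eq0; apply/polyP => k; rewrite coef0.
apply: IH => v; rewrite -(@coef_map _ _ (meval v)) /=.
rewrite (_ : map_poly _ _ = 0) ?coef0 //; apply: poly_nat_eq0 => n.
by rewrite meval_muni.
Qed.

(** Multiplying by the product of all differences takes care of points with a repeated coordinate,
    and the polynomial ring is a domain. At the remaining points the denominators of [qweight] do
    not vanish. *)
Lemma mpoly_injective_eq0 N (p : {mpoly K[N]}) :
  (forall v : 'I_N -> K, injective v -> p.@[v] = 0) -> p = 0.
Proof.
move=> p0; pose V : {mpoly K[N]} := \prod_(ij : 'I_N * 'I_N | ij.1 != ij.2) ('X_ij.1 - 'X_ij.2).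
have: p * V = 0.
  apply: mpoly_meval_eq0 => v; rewrite mevalM.
  case: (boolP (injectiveb v)) => [/injectiveP/p0 ->|]; first by rewrite mul0r.
  case/injectivePn => i [j ij vij]; rewrite [V.@[v]]rmorph_prod (bigD1 (i, j)) //=.
  by rewrite mevalB !mevalXU vij subrr mul0r mulr0.
move/eqP; rewrite mulf_eq0 => /orP[/eqP //|/prodf_eq0[[i j] /= ij]].
rewrite subr_eq0 => /eqP/(congr1 (mcoeff U_(i))); rewrite !mcoeffXU eqxx eq_sym.
by rewrite (negbTE ij) => /eqP; rewrite oner_eq0.
Qed.

Lemma mpoly_injective_eq N (p q : {mpoly K[N]}) :
  (forall v : 'I_N -> K, injective v -> p.@[v] = q.@[v]) -> p = q.
Proof.
move=> pq; apply/eqP; rewrite -subr_eq0; apply/eqP/mpoly_injective_eq0 => v vI.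
by rewrite mevalB pq ?subrr.
Qed.

End Density.

(** * Truncated power series and the coefficients q_r *)

Section Truncation.
Variable A : comNzRingType.
Implicit Types p q E : {poly A}.

(** Power series in X are represented by polynomials compared below degree n. *)
Definition eqmodX n p q := forall k, (k < n)%N -> p`_k = q`_k.

Lemma eqmodX_sym n p q : eqmodX n p q -> eqmodX n q p.
Proof. by move=> e k kn; rewrite e. Qed.

Lemma eqmodX_trans n p q r : eqmodX n p q -> eqmodX n q r -> eqmodX n p r.
Proof. by move=> e f k kn; rewrite e ?f. Qed.

Lemma eqmodXM n p q p' q' :
  eqmodX n p q -> eqmodX n p' q' -> eqmodX n (p * p') (q * q').
Proof.
move=> e e' k kn; rewrite !coefM; apply: eq_bigr => i _.
by rewrite e ?e' //; apply: leq_ltn_trans kn; [exact: leq_subr|rewrite -ltnS].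
Qed.

Lemma eqmodX_prod n (I : finType) (F G : I -> {poly A}) :
  (forall i, eqmodX n (F i) (G i)) -> eqmodX n (\prod_i F i) (\prod_i G i).
Proof. by move=> e; apply: (big_ind2 (eqmodX n)) => // *; exact: eqmodXM. Qed.

Lemma eqmodX_cancel n E p q : E`_0 = 1 ->
  eqmodX n (E * p) (E * q) -> eqmodX n p q.
Proof.
move=> E0 e; elim/ltn_ind => k IH kn; have := e k kn.
rewrite !coefM !big_ord_recl E0 !mul1r /= subn0.
under eq_bigr => i _ do rewrite IH ?(leq_ltn_trans (leq_subr _ _) kn) ?ltn_subrL ?(leq_ltn_trans _ (ltn_ord i)) //.
exact: addIr.
Qed.

(** Truncation of 1 / (1 - x X). *)
Definition geomX n (x : A) : {poly A} := \sum_(k < n) x ^+ k *: 'X^k.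

Lemma mul_geomX n x : (1 - x *: 'X) * geomX n x = 1 - x ^+ n *: 'X^n.
Proof.
elim: n => [|n IH]; first by rewrite /geomX big_ord0 mulr0 expr0 scale1r subrr.
rewrite /geomX big_ord_recr /= mulrDr IH mulrBl mul1r -scalerAl -scalerAr scalerA.
by rewrite -exprS -exprS addrA subrK.
Qed.

Variable N : nat.
Implicit Types v : 'I_N -> A.

Definition Epoly v : {poly A} := \prod_i (1 - v i *: 'X).
(** Truncation of prod_i (1 + v_i X) / (1 - v_i X). The order r + 1 in [qcoef] is the least that
    gives the coefficient of X^r; [qseries_coef] shows that any larger order gives the same. *)
Definition qseries n v : {poly A} := \prod_i ((1 + v i *: 'X) * geomX n (v i)).
Definition qcoef v (r : nat) : A := (qseries r.+1 v)`_r.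

Lemma Epoly0 v : (Epoly v)`_0 = 1.
Proof.
rewrite /Epoly; elim/big_ind: _ => [|p q p0 q0|i _].
- by rewrite coefC.
- by rewrite coefM big_ord1 p0 q0 mul1r.
- by rewrite coefB coefC coefZ coefX mulr0 subr0.
Qed.

Lemma qseries_spec n v :
  eqmodX n (Epoly v * qseries n v) (Epoly (fun i => - v i)).
Proof.
rewrite /Epoly /qseries -big_split /=; apply: eqmodX_prod => i k kn.
rewrite mulrCA mul_geomX mulrBr mulr1 -scalerAr coefB coefZ coefMXn kn mulr0 subr0.
by rewrite scaleNr opprK.
Qed.

(** With E = [Epoly v], of constant term 1, the equation E(X) P(X) = E(-X) characterises the q_r, so
    the truncated product itself need not be handled again. *)
Lemma qcoef_unique n v (P : {poly A}) : eqmodX n (Epoly v * P) (Epoly (fun i => - v i)) ->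
  forall r, (r < n)%N -> P`_r = qcoef v r.
Proof.
move=> eP r rn; apply: (@eqmodX_cancel r.+1 (Epoly v)) (ltnSn r); first exact: Epoly0.
move=> k kr; rewrite eP ?qseries_spec //; exact: leq_trans kr rn.
Qed.

Lemma qseries_coef n v r : (r < n)%N -> (qseries n v)`_r = qcoef v r.
Proof. exact/qcoef_unique/qseries_spec. Qed.

Lemma qcoef0 v : qcoef v 0 = 1.
Proof.
rewrite -[RHS](coefC 1 0); symmetry; apply: (@qcoef_unique 1) => // k.
by rewrite ltnS leqn0 => /eqP ->; rewrite mulr1 !Epoly0.
Qed.

Lemma qcoef_perm v (s : 'S_N) r : qcoef (v \o s) r = qcoef v r.
Proof. by rewrite /qcoef /qseries [in RHS](reindex_inj (@perm_inj _ s)). Qed.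

Lemma comp_Epoly v : Epoly v \Po (- 'X) = Epoly (fun i => - v i).
Proof.
rewrite /Epoly rmorph_prod /=; apply: eq_bigr => i _.
by rewrite rmorphB rmorph1 /= comp_polyZ comp_polyX scalerN scaleNr.
Qed.

Lemma coef_comp_oppX p k : (p \Po (- 'X))`_k = (-1) ^+ k * p`_k.
Proof.
rewrite comp_polyE coef_sum.
have eX i : (p`_i *: (- 'X) ^+ i)`_k = (-1) ^+ i * p`_i * (k == i)%:R.
  by rewrite -scaleN1r exprZn !coefZ coefXn mulrA [_ * p`_i]mulrC.
case: (ltnP k (size p)) => [kp|pk].
  rewrite (bigD1 (Ordinal kp)) //= eX eqxx mulr1 big1 ?addr0 // => i ik.
  by rewrite eX eq_sym (negbTE (ik : i != k :> nat)) mulr0.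
rewrite (nth_default _ pk) mulr0 big1 // => i _.
by rewrite eX gtn_eqF ?mulr0 // (leq_trans (ltn_ord i)).
Qed.

(* Q(t) Q(-t) = 1 *)
Lemma qcoef_even v r : (0 < r)%N ->
  \sum_(k < r.+1) (-1) ^+ (r - k) * (qcoef v k * qcoef v (r - k)) = 0.
Proof.
move=> r0; set Q := qseries r.+1 v; pose Q' := Q \Po (- 'X).
have eQ : eqmodX r.+1 (Epoly v * Q) (Epoly (fun i => - v i)) by exact: qseries_spec.
have eQ' : eqmodX r.+1 (Epoly (fun i => - v i) * Q') (Epoly v).
  move=> k kr; rewrite -comp_Epoly -rmorphM /= coef_comp_oppX eQ //.
  rewrite -coef_comp_oppX comp_Epoly; congr (nth _ (polyseq _) _).
  by apply: eq_bigr => i _; rewrite opprK.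
have: eqmodX r.+1 (Q * Q') 1.
  apply: (@eqmodX_cancel _ (Epoly v * Epoly (fun i => - v i))).
    by rewrite coefM big_ord1 !Epoly0 mul1r.
  rewrite mulr1 mulrACA [X in eqmodX _ _ X]mulrC; exact: eqmodXM.
move=> /(_ r (ltnSn r)); rewrite coefC (gtn_eqF r0) coefM => e.
rewrite -[RHS]e; apply: eq_bigr => k _.
by rewrite coef_comp_oppX mulrCA !qseries_coef // ltnS leq_subr.
Qed.

(** When v_j = - v_i, the indices i and j contribute the same factor 1 - v_i^2 X^2 to E(X) and to
    E(-X), which cancels in the quotient. This is the supersymmetry of q_r. *)
Lemma qcoef_cancel v (w : 'I_N -> A) (i j : 'I_N) : i != j -> v j = - v i -> w j = - w i ->
  (forall k, k != i -> k != j -> v k = w k) -> forall r, qcoef v r = qcoef w r.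
Proof.
move=> ij vij wij vw r; symmetry; apply: (@qcoef_unique r.+1) => //.
have swap (u : 'I_N -> A) : u j = - u i ->
    Epoly (fun i => - u i) =
    (1 - (u i) ^+ 2 *: 'X^2) * \prod_(k | (k != i) && (k != j)) (1 - (- u k) *: 'X) /\
    Epoly u = (1 - (u i) ^+ 2 *: 'X^2) * \prod_(k | (k != i) && (k != j)) (1 - u k *: 'X).
  move=> uij; rewrite /Epoly; split; rewrite (bigD1 i) //= (bigD1 j) 1?eq_sym //= uij.
    rewrite mulrA; congr (_ * _); rewrite -!mul_polyC !rmorphN rmorphXn /=; ring.
  rewrite mulrA; congr (_ * _); rewrite -!mul_polyC !rmorphN rmorphXn /=; ring.
have [nv pv] := swap v vij; have [nw pw] := swap w wij.
(* The series of w is tested against the equation of v; the factor that w contributes at i and j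
   completes the remaining product to [Epoly w]. *)
apply: (@eqmodX_cancel _ (1 - (w i) ^+ 2 *: 'X^2)).
  by rewrite coefB coefC coefZ coefXn /= mulr0 subr0.
have eN : \prod_(k | (k != i) && (k != j)) (1 - (- v k) *: 'X) =
   \prod_(k | (k != i) && (k != j)) (1 - (- w k) *: 'X) :> {poly A}.
  by apply: eq_bigr => k /andP[ki kj]; rewrite vw.
have eP : \prod_(k | (k != i) && (k != j)) (1 - v k *: 'X) =
   \prod_(k | (k != i) && (k != j)) (1 - w k *: 'X) :> {poly A}.
  by apply: eq_bigr => k /andP[ki kj]; rewrite vw.
rewrite pv eP nv eN -mulrA mulrCA [X in eqmodX _ (_ * X)]mulrA -pw.
rewrite [X in eqmodX _ _ X]mulrCA -nw; apply: eqmodXM => //. exact: qseries_spec.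
Qed.

End Truncation.

Lemma qcoef_morph (A B : comNzRingType) (f : {rmorphism A -> B}) N (v : 'I_N -> A) r :
  f (qcoef v r) = qcoef (f \o v) r.
Proof.
rewrite /qcoef -coef_map; congr (nth _ (polyseq _) _).
rewrite /qseries rmorph_prod; apply: eq_bigr => i _ /=.
rewrite rmorphM rmorphD rmorph1 /= map_polyZ /= map_polyX /geomX rmorph_sum /=.
by congr (_ * _); apply: eq_bigr => k _; rewrite map_polyZ map_polyXn rmorphXn.
Qed.

Section Delete.
Variables (A : comNzRingType) (N : nat).
Implicit Types v : 'I_N.+1 -> A.

Lemma Epoly_lift v i :
  Epoly v = (1 - v i *: 'X) * Epoly (fun j => v (lift i j)).
Proof. by rewrite /Epoly (bigD1_ord i). Qed.

(** Comparison of coefficients in (1 + v_i X) Q' = (1 - v_i X) Q, where Q' is the series of the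
    variables other than v_i. *)
Lemma qcoef_lift v i r :
  qcoef (fun j => v (lift i j)) r.+1 =
  qcoef v r.+1 - v i * qcoef v r - v i * qcoef (fun j => v (lift i j)) r.
Proof.
set w := fun j => _; set x := v i.
have: eqmodX r.+2 ((1 + x *: 'X) * qseries r.+2 w) ((1 - x *: 'X) * qseries r.+2 v).
  apply: (@eqmodX_cancel _ _ (Epoly v)); first exact: Epoly0.
  rewrite {1}(Epoly_lift v i) -/x -/w mulrACA.
  apply: eqmodX_trans (_ : eqmodX _ _ ((1 - x *: 'X) * Epoly (fun i => - v i))) _.
    rewrite (Epoly_lift (fun k => - v k) i) [X in eqmodX _ _ X]mulrA; apply: eqmodXM => //; last exact: qseries_spec.
    by rewrite -/x scaleNr opprK.
  by rewrite [X in eqmodX _ _ X]mulrCA; apply/eqmodX_sym/eqmodXM => //; exact: qseries_spec.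
move=> /(_ r.+1 (ltnSn _)).
rewrite mulrDl mulrBl !mul1r coefD coefB -!scalerAl !coefZ !coefXM /= !qseries_coef //.
by move=> <-; rewrite addrK.
Qed.

End Delete.

(** * Lagrange interpolation and q_r as a weighted power sum *)

Section Interpolation.
Variable K : numFieldType.

Lemma size_prodD N (v : 'I_N -> K) (Q : pred 'I_N) :
  size (\prod_(i | Q i) ('X - (v i)%:P)) = #|Q|.+1.
Proof. by rewrite -big_filter size_prod_XsubC -cardE. Qed.

Lemma lagrange N (v : 'I_N -> K) (P : {poly K}) : injective v -> (size P <= N)%N ->
  P = \sum_i (P.[v i] / \prod_(j | j != i) (v i - v j)) *:
             \prod_(j | j != i) ('X - (v j)%:P).
Proof.
move=> vI sP; apply/eqP; rewrite -subr_eq0; set R := \sum_i _; apply/negPn/negP => n0.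
have sR : (size R <= N)%N.
  apply: (leq_trans (size_sum _ _ _)); apply/bigmax_leqP => i _.
  apply: (leq_trans (size_scale_leq _ _)); rewrite size_prodD.
  by have := cardC1 i; rewrite card_ord => ->; rewrite prednK // (leq_ltn_trans _ (ltn_ord i)).
have rts : all (root (P - R)) [seq v i | i <- enum 'I_N].
  apply/allP => _ /mapP[i _ ->]; apply/rootP; rewrite hornerD hornerN horner_sum.
  rewrite (bigD1 i) //= [\sum_(j | j != i) _]big1 ?addr0 => [|j ji].
    rewrite hornerZ horner_prod; under [X in _ * X]eq_bigr do rewrite hornerXsubC.
    rewrite divfK ?subrr //; apply/prodf_neq0 => j ji.
    by rewrite subr_eq0; apply: contra ji => /eqP/vI ->.
  by rewrite hornerZ horner_prod [X in _ * X](bigD1 i) 1?eq_sym //= hornerXsubC subrr mul0r mulr0.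
have := max_poly_roots n0 rts; rewrite map_inj_uniq ?enum_uniq // => /(_ isT).
rewrite size_map size_enum_ord ltnNge => /negP; apply.
by apply: (leq_trans (size_polyD _ _)); rewrite geq_max sP size_polyN.
Qed.

Lemma lagrange_lead N (v : 'I_N.+1 -> K) (P : {poly K}) : injective v -> (size P <= N.+1)%N ->
  P`_N = \sum_i P.[v i] / \prod_(j | j != i) (v i - v j).
Proof.
move=> vI sP; rewrite [in LHS](lagrange vI sP) coef_sum; apply: eq_bigr => i _.
rewrite coefZ (_ : (\prod_(j | j != i) ('X - (v j)%:P))`_N = 1) ?mulr1 //.
have := monicP (monic_prod_XsubC (index_enum 'I_N.+1) (fun j => j != i) v).
by rewrite /lead_coef size_prodD (cardC1 i) card_ord.
Qed.

Lemma sum_pow_lagrange N (v : 'I_N.+1 -> K) : injective v ->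
  \sum_i v i ^+ N / \prod_(j | j != i) (v i - v j) = 1.
Proof.
move=> vI; have := @lagrange_lead N v 'X^N vI; rewrite size_polyXn coefXn eqxx mulr1n => /(_ (ltnSn N)) e; rewrite [RHS]e.
by apply: eq_bigr => i _; rewrite hornerXn.
Qed.

(** Up to the factor v_i X / (1 - v_i X), the coefficients in the partial fraction expansion of
    E(-X) / E(X); Q^-_(r) is built with the same weights. *)
Definition qweight N (v : 'I_N -> K) (i : 'I_N) : K :=
  2 * \prod_(j | j != i) ((v i + v j) / (v i - v j)).

(** The partial fractions E(-X) / E(X) = 1 + sum_i w_i v_i X / (1 - v_i X), cleared of denominators.
    With T = 1/X this is Lagrange interpolation of prod (T + v_i) - prod (T - v_i), a difference of
    two monic polynomials, hence of degree below N. *)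
Lemma Epoly_opp N (v : 'I_N -> K) : injective v ->
  Epoly (fun i => - v i) = Epoly v + \sum_i (qweight v i * v i) *:
     ('X * \prod_(j | j != i) (1 - v j *: 'X)).
Proof.
move=> vI; apply/eqP; rewrite -subr_eq0; apply/eqP/poly_nat_eq0 => n.
set a : K := n.+1%:R; have a0 : a != 0 by rewrite pnatr_eq0.
pose G : {poly K} := \prod_i ('X - (- v i)%:P) - \prod_i ('X - (v i)%:P).
have sG : (size G <= N)%N.
  have sz (w : 'I_N -> K) : size (\prod_i ('X - (w i)%:P)) = N.+1.
    by rewrite size_prodD card_ord.
  have ld (w : 'I_N -> K) : (\prod_i ('X - (w i)%:P))`_N = 1.
    have := monicP (monic_prod_XsubC (index_enum 'I_N) predT w).
    by rewrite /lead_coef sz.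
  apply/leq_sizeP => j; rewrite leq_eqVlt => /orP[/eqP <-|Nj].
    by rewrite coefB !ld subrr.
  by rewrite coefB !nth_default ?subrr // sz.
have := congr1 (horner^~ a^-1) (lagrange vI sG) => /=.
rewrite hornerD hornerN horner_sum !horner_prod => e.
have prodE (w : 'I_N -> K) (Q : pred 'I_N) :
   \prod_(i | Q i) (1 - w i *: 'X).[a] = a ^+ #|Q| * \prod_(i | Q i) ('X - (w i)%:P).[a^-1].
  rewrite -prodr_const -big_split /=; apply: eq_bigr => i _.
  by rewrite !hornerE /= mulrBr divff // mulrC.
rewrite hornerD hornerN hornerD horner_sum /Epoly !horner_prod !prodE !card_ord.
rewrite opprD addrA -mulrBr e mulr_sumr -sumrB big1 // => i _.
rewrite hornerZ [in X in _ - X]hornerZ hornerM hornerX !horner_prod prodE (cardC1 i) card_ord.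
rewrite !mulrA -mulrBl -horner_prod (_ : _ - _ = 0) ?mul0r //.
have -> : a ^+ N = a * a ^+ N.-1 by rewrite -exprS prednK // (leq_ltn_trans _ (ltn_ord i)).
have -> : G.[v i] = 2 * v i * \prod_(j | j != i) (v i + v j).
  rewrite /G hornerD hornerN !horner_prod (bigD1 i) //= hornerXsubC opprK.
  rewrite [X in _ - X](bigD1 i) //= hornerXsubC subrr mul0r subr0 mulr_natl.
  by congr (_ * _); apply: eq_bigr => j _; rewrite hornerXsubC opprK.
rewrite /qweight prodf_div; ring.
Qed.

(** The partial fractions of [Epoly_opp] expanded into geometric series. The index is positive
    because the constant term 1 is not part of the sum. *)
Lemma qcoef_sum N (v : 'I_N -> K) r : injective v ->
  qcoef v r.+1 = \sum_i qweight v i * v i ^+ r.+1.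
Proof.
move=> vI; pose P : {poly K} := 1 + \sum_i (qweight v i * v i) *: ('X * geomX r.+2 (v i)).
rewrite -(@qcoef_unique _ _ r.+2 v P) //.
  rewrite /P coefD coefC add0r coef_sum; apply: eq_bigr => i _.
  rewrite coefZ coefXM /geomX coef_sum (bigD1 (widen_ord (leqnSn _) ord_max)) //= big1 ?addr0.
    by rewrite coefZ coefXn eqxx mulr1 -mulrA -exprS.
  by move=> k kr; rewrite coefZ coefXn eq_sym (negbTE (kr : k != r :> nat)) mulr0.
rewrite (Epoly_opp vI) /P mulrDr mulr1 => k kr; rewrite !coefD; congr (_ + _).
rewrite mulr_sumr !coef_sum; apply: eq_bigr => i _.
rewrite -scalerAr !coefZ mulrCA /Epoly (bigD1 i) //= [_ * geomX _ _]mulrAC mul_geomX.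
rewrite [_ * \prod_(_ | _) _]mulrBl mul1r mulrBr coefB -scalerAl -scalerAr mulrCA coefZ coefXnM kr.
by rewrite mulr0 subr0.
Qed.

Definition qpoly N r : {mpoly K[N]} := qcoef (fun i : 'I_N => 'X_i) r.

Lemma meval_qpoly N r (v : 'I_N -> K) : (qpoly N r).@[v] = qcoef v r.
Proof.
rewrite /qpoly (qcoef_morph (meval v)); congr (nth _ (polyseq _) _).
by apply: eq_bigr => i _; rewrite /= mevalXU.
Qed.

Lemma qpoly_homog N r : qpoly N r \is r.-homog.
Proof.
pose H (P : {poly {mpoly K[N]}}) := forall k, P`_k \is k.-homog.
have HM P Q : H P -> H Q -> H (P * Q).
  move=> HP HQ k; rewrite coefM rpred_sum // => i _.
  by have := dhomogM (HP i) (HQ (k - i)%N); rewrite subnKC // -ltnS.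
have HZ (i : 'I_N) j : H ('X_i ^+ j *: 'X^j).
  move=> k; rewrite coefZ coefXn; case: eqP => [->|_]; last by rewrite mulr0 rpred0.
  by rewrite mulr1 mpolyXn dhomogX /= mdegMn mdeg1 mul1n.
have H1 : H 1 by move=> k; rewrite coefC; case: eqP => [->|]; rewrite ?dhomog1 ?rpred0.
suff: H (qseries r.+1 (fun i : 'I_N => 'X_i)) by apply.
apply: (big_ind H) => // i _; apply: HM.
  by move=> k; rewrite coefD rpredD //; have := HZ i 1%N k; rewrite !expr1.
by move=> k; rewrite coef_sum rpred_sum // => j _; apply: HZ.
Qed.

End Interpolation.

(** * Generation of supersymmetric polynomials by the odd q_r *)

Section Supersymmetric.
Variable K : numFieldType.

(* Polynomial expressions in the q_r, to be evaluated both in polynomials and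
   at points of any number N of variables. *)
Inductive qexpr : Type :=
| QConst of K
| QGen of nat
| QAdd of qexpr & qexpr
| QMul of qexpr & qexpr.

Fixpoint evalq (A : nzRingType) (f : K -> A) (env : nat -> A) (e : qexpr) : A :=
  match e with
  | QConst c => f c
  | QGen r => env r
  | QAdd a b => evalq f env a + evalq f env b
  | QMul a b => evalq f env a * evalq f env b
  end.

Lemma eq_evalq (A : nzRingType) (f : K -> A) (env env' : nat -> A) e :
  env =1 env' -> evalq f env e = evalq f env' e.
Proof. by move=> ee; elim: e => [c|r|a IHa b IHb|a IHa b IHb] //=; rewrite IHa IHb. Qed.

Lemma meval_evalq N (env : nat -> {mpoly K[N]}) v e :
  (evalq (@mpolyC N K) env e).@[v] = evalq id (fun r => (env r).@[v]) e.
Proof.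
elim: e => [c|r|a IHa b IHb|a IHa b IHb] //=; first exact: mevalC.
  by rewrite mevalD IHa IHb.
by rewrite mevalM IHa IHb.
Qed.

(** The index is shifted because q_0 = 1 is not a generator. *)
Definition qenv N (v : 'I_N -> K) (r : nat) : K := qcoef v r.+1.

Definition flip N (v : 'I_N -> K) (i j : 'I_N) (t : K) (k : 'I_N) : K :=
  if k == i then t else if k == j then - t else v k.

Definition supersymmetric N (f : {mpoly K[N]}) : Prop :=
  (forall (s : 'S_N) v, f.@[v \o s] = f.@[v]) /\
  (forall i j v t, i != j -> f.@[flip v i j t] = f.@[flip v i j 0]).

Lemma qcoef_extend0 N (v : 'I_N -> K) r : qcoef (extend v 0) r = qcoef v r.
Proof.
elim: r => [|r IH]; first by rewrite !qcoef0.
have := qcoef_lift (extend v 0) ord_max r.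
rewrite extend_max !mul0r !subr0 => <-.
by congr (nth _ (polyseq _) _); apply: eq_bigr => j _; rewrite extend_lift.
Qed.

Lemma qcoef_flip N (v : 'I_N -> K) i j t r : i != j ->
  qcoef (flip v i j t) r = qcoef (flip v i j 0) r.
Proof.
move=> ij; apply: (qcoef_cancel ij); rewrite /flip ?eqxx.
- by rewrite eq_sym (negbTE ij).
- by rewrite eq_sym (negbTE ij).
- by move=> k /negbTE-> /negbTE->.
Qed.

Lemma supersymmetric_evalq N e :
  supersymmetric (evalq (@mpolyC N K) (fun r => qpoly K N r.+1) e).
Proof.
split=> [s v|i j v t ij]; rewrite !meval_evalq; apply: eq_evalq => r.
  by rewrite !meval_qpoly qcoef_perm.
by rewrite !meval_qpoly qcoef_flip.
Qed.

Lemma supersymmetricB N (f g : {mpoly K[N]}) :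
  supersymmetric f -> supersymmetric g -> supersymmetric (f - g).
Proof.
move=> [fS fF] [gS gF]; split=> [s v|i j v t ij]; rewrite !mevalB.
  by rewrite fS gS.
by rewrite fF // gF.
Qed.

Lemma extend_perm N (v : 'I_N -> K) t (s : 'S_N) :
  extend (v \o s) t =1 extend v t \o lift_perm ord_max ord_max s.
Proof.
move=> k /=; case: (unliftP ord_max k) => [j|] ->.
  by rewrite lift_perm_lift !extend_lift.
by rewrite lift_perm_id !extend_max.
Qed.

Lemma extend_flip N (v : 'I_N -> K) t i j u :
  extend (flip v i j u) t =1 flip (extend v t) (lift ord_max i) (lift ord_max j) u.
Proof.
move=> k; rewrite /flip; case: (unliftP ord_max k) => [l|] ->.
  by rewrite !extend_lift !(inj_eq lift_inj).
by rewrite !extend_max !(negbTE (neq_lift _ _)).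
Qed.

(* [delexpr F] : F (v, i) is a polynomial in v_i with coefficients in the algebra
   generated by the q_r (v). *)
Inductive delexpr N : (('I_N -> K) -> 'I_N -> K) -> Prop :=
| delexpr0 F : (forall v i, F v i = 0) -> delexpr F
| delexprX F e F' : delexpr F' ->
    (forall v i, F v i = evalq id (qenv v) e + v i * F' v i) -> delexpr F.

Lemma delexpr_ext N (F G : ('I_N -> K) -> 'I_N -> K) :
  delexpr F -> (forall v i, G v i = F v i) -> delexpr G.
Proof.
case=> [{}F F0|{}F e F' dF' eF] eG; first by apply: delexpr0 => v i; rewrite eG.
by apply: delexprX dF' _ => v i; rewrite eG eF.
Qed.

Lemma delexprD N (F G : ('I_N -> K) -> 'I_N -> K) :
  delexpr F -> delexpr G -> delexpr (fun v i => F v i + G v i).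
Proof.
move=> dF; elim: dF G => [{}F F0|{}F e F' dF' IH eF] G dG.
  by apply: delexpr_ext dG _ => v i; rewrite F0 add0r.
case: dG => [{}G G0|{}G e' G' dG' eG].
  by apply: delexprX dF' _ => v i; rewrite G0 addr0 eF.
by apply: (delexprX (e := QAdd e e') (IH _ dG')) => v i; rewrite eF eG /=; ring.
Qed.

Lemma delexprZ N e (F : ('I_N -> K) -> 'I_N -> K) :
  delexpr F -> delexpr (fun v i => evalq id (qenv v) e * F v i).
Proof.
elim=> [{}F F0|{}F e' F' dF' IH eF].
  by apply: delexpr0 => v i; rewrite F0 mulr0.
by apply: (delexprX (e := QMul e e') IH) => v i; rewrite eF /=; ring.
Qed.

Lemma delexprMX N (F : ('I_N -> K) -> 'I_N -> K) :
  delexpr F -> delexpr (fun v i => v i * F v i).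
Proof. by move=> dF; apply: (delexprX (e := QConst 0) dF) => v i; rewrite add0r. Qed.

Lemma delexprM N (F G : ('I_N -> K) -> 'I_N -> K) :
  delexpr F -> delexpr G -> delexpr (fun v i => F v i * G v i).
Proof.
elim=> [{}F F0|{}F e F' dF' IH eF] dG.
  by apply: delexpr0 => v i; rewrite F0 mul0r.
apply: delexpr_ext (delexprD (delexprZ e dG) (delexprMX (IH dG))) _ => v i.
by rewrite eF; ring.
Qed.

Lemma delexpr_e N e : delexpr (fun (v : 'I_N -> K) i => evalq id (qenv v) e).
Proof.
by apply: (@delexprX _ _ e (fun _ _ => 0)) => [|v i]; [exact: delexpr0|rewrite mulr0 addr0].
Qed.

(** Iterating [qcoef_lift] turns each q_r of the variables other than v_i into a polynomial in v_i
    over the q_r of all variables. *)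
Lemma delexpr_lift N e :
  delexpr (fun (v : 'I_N.+1 -> K) i => evalq id (qenv (fun j => v (lift i j))) e).
Proof.
elim: e => [c|r|a IHa b IHb|a IHa b IHb] /=.
- exact: (delexpr_e _ (QConst c)).
- suff: delexpr (fun (v : 'I_N.+1 -> K) i => qcoef (fun j => v (lift i j)) r.+1) by [].
  have dm1 := delexpr_e N.+1 (QConst (- 1)).
  elim: r => [|r IH].
    apply: delexpr_ext (delexprD (delexpr_e _ (QGen 0))
      (delexprMX (delexpr_e _ (QConst (- 1 - 1))))) _ => v i /=.
    by rewrite qcoef_lift !qcoef0 /qenv; ring.
  apply: delexpr_ext (delexprD (delexpr_e _ (QGen r.+1))
    (delexprM (delexprMX dm1) (delexprD (delexpr_e _ (QGen r)) IH))) _ => v i /=.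
  by rewrite qcoef_lift /qenv; ring.
- exact: delexprD.
- exact: delexprM.
Qed.

(** Each power of v_i in F joins v_i^(a+1), and by [qcoef_sum] the weighted sum of a power is a
    single q. The exponent a + 1 keeps the index of this q positive. *)
Lemma delexpr_sum N (F : ('I_N -> K) -> 'I_N -> K) a : delexpr F ->
  exists e, forall v, injective v ->
    \sum_i qweight v i * v i ^+ a.+1 * F v i = evalq id (qenv v) e.
Proof.
move=> dF; elim: dF a => [{}F F0|{}F e F' _ IH eF] a.
  by exists (QConst 0) => v _ /=; apply: big1 => i _; rewrite F0 mulr0.
have [e' IHe'] := IH a.+1; exists (QAdd (QMul (QGen a) e) e') => v vI /=.
rewrite -IHe' // [qenv v a]/qenv qcoef_sum // mulr_suml -big_split /=.
by apply: eq_bigr => i _; rewrite eF [v i ^+ a.+2]exprSr; ring.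
Qed.

Lemma factor_uniq_roots (A : idomainType) (rs : seq A) (p : {poly A}) :
  uniq rs -> all (root p) rs -> exists q, p = q * \prod_(c <- rs) ('X - c%:P).
Proof.
elim: rs p => [|c rs IH] p /= => [_ _|/andP[cr ur] /andP[/factor_theorem[q ->] rt]].
  by exists p; rewrite big_nil mulr1.
have [|q' ->] := IH q ur; last by exists q'; rewrite big_cons mulrAC mulrA.
apply/allP => d dr; have := allP rt d dr; rewrite rootM root_XsubC => /orP[//|/eqP dc].
by rewrite -dc dr in cr.
Qed.

Lemma prod_lift N (F : 'I_N.+1 -> K) i :
  \prod_(j | j != i) F j = \prod_j F (lift i j).
Proof.
rewrite big_mkcond (bigD1_ord i) //= eqxx mul1r.
by apply: eq_bigr => j _; rewrite eq_sym neq_lift.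
Qed.

(** By symmetry each variable can play the part of the last one. *)
Lemma meval_extend_lift N (f : {mpoly K[N.+1]}) v i : supersymmetric f ->
  f.@[v] = f.@[extend (fun j => v (lift i j)) (v i)].
Proof.
move=> [fS _]; rewrite -(fS (lift_perm ord_max i 1)%g); apply: meval_eq => k /=.
case: (unliftP ord_max k) => [j|] ->.
  by rewrite lift_perm_lift extend_lift perm1.
by rewrite lift_perm_id extend_max.
Qed.

(** Meant for the cofactor g in [supersymmetric_gen], whose coefficients in the last variable are
    reached by the induction on N. *)
Lemma delexpr_horner N (s : seq {mpoly K[N]}) :
  (forall g, g \in s -> exists e, forall v, injective v -> g.@[v] = evalq id (qenv v) e) ->
  exists F, delexpr F /\ forall (v : 'I_N.+1 -> K) i, injective v ->
    F v i = \sum_(m < size s) (s`_m).@[fun j : 'I_N => v (lift i j)] * v i ^+ m.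
Proof.
elim: s => [|g s IH] es.
  exists (fun _ _ => 0); split; first exact: delexpr0.
  by move=> v i _; rewrite big_ord0.
have [|F [dF eF]] := IH; first by move=> h hs; apply: es; rewrite inE hs orbT.
have [e ee] := es g (mem_head _ _).
exists (fun v i => evalq id (qenv (fun j => v (lift i j))) e + v i * F v i); split.
  by apply: delexprD; [exact: delexpr_lift|exact: delexprMX].
move=> v i vI; rewrite big_ord_recl /= expr0 mulr1 ee; last by move=> j k /vI/lift_inj.
congr (_ + _); rewrite eF // mulr_sumr; apply: eq_bigr => m _.
by rewrite mulrCA -exprS.
Qed.

(** The expression found for f with its last variable set to 0, taken in all variables and
    subtracted from f, leaves f1 = x prod_j (x + x_j) g with x the last variable. Multiplying f1 by
    1 = sum_i v_i^N / prod_(j != i) (v_i - v_j) and taking x = v_i in the i-th term gives half of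
    the sum of the weights times v_i^(N+1) g, to which [delexpr_sum] applies. *)
Theorem supersymmetric_gen N (f : {mpoly K[N]}) : supersymmetric f ->
  exists e, forall v, injective v -> f.@[v] = evalq id (qenv v) e.
Proof.
elim: N f => [|N IH] f ssf.
  by exists (QConst f@_0%MM) => v _ /=; rewrite {1}[f]nvar0_mpolyC mevalC.
have coef0E (h : {mpoly K[N.+1]}) v : ((muni h)`_0).@[v] = h.@[extend v 0].
  by rewrite -meval_muni horner_coef0 coef_map.
have [|e0 he0] := IH (muni f)`_0.
  case: ssf => fS fF; split=> [s v|i j v t ij]; rewrite !coef0E.
    by rewrite -[RHS](fS (lift_perm ord_max ord_max s)); apply: meval_eq; exact: extend_perm.
  by rewrite !(meval_eq _ (extend_flip _ _ _ _ _)) fF // (inj_eq lift_inj).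
pose f1 := f - evalq (@mpolyC N.+1 K) (fun r => qpoly K N.+1 r.+1) e0.
have ssf1 : supersymmetric f1 by apply: supersymmetricB => //; exact: supersymmetric_evalq.
have f10 : (muni f1)`_0 = 0.
  apply: mpoly_injective_eq0 => v vI; rewrite coef0E mevalB -coef0E he0 // meval_evalq.
  apply/eqP; rewrite subr_eq0; apply/eqP/eq_evalq => r.
  by rewrite meval_qpoly qcoef_extend0.
have van w k : w k = 0 -> f1.@[w] = 0.
  by move=> wk; rewrite (meval_extend_lift _ k ssf1) wk -coef0E f10 meval0.
have [g eg] : exists g, muni f1 =
    g * \prod_(c <- 0 :: [seq - 'X_j | j <- enum 'I_N]) ('X - c%:P).
  apply: factor_uniq_roots => /=.
    rewrite map_inj_uniq ?enum_uniq ?andbT => [|i j /oppr_inj/(congr1 (mcoeff U_(i)))].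
      apply/mapP => -[j _ /eqP]; rewrite eq_sym oppr_eq0 => /eqP/(congr1 (mcoeff U_(j))).
      by rewrite mcoeffXU eqxx mcoeff0 => /eqP; rewrite oner_eq0.
    by rewrite !mcoeffXU eqxx; case: (eqVneq j i) => // _ /eqP; rewrite oner_eq0.
  rewrite rootE horner_coef0 f10 eqxx /=; apply/allP => _ /mapP[j _ ->]; apply/rootP.
  (* At x = - v_j the coordinates x and v_j have the form t, -t; t can be moved to 0, where f1
     vanishes. *)
  apply: mpoly_meval_eq0 => v; rewrite -horner_map /= mevalN mevalXU meval_muni.
  case: (ssf1) => _ f1F; pose w := flip (extend v 0) ord_max (lift ord_max j).
  rewrite (meval_eq (v2 := w (- v j))) => [|k]; last first.
    rewrite /w /flip; case: (unliftP ord_max k) => [l|] ->; last by rewrite eqxx extend_max.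
    rewrite eq_sym (negbTE (neq_lift _ _)) (inj_eq lift_inj) !extend_lift opprK.
    by case: eqP => [->|].
  by rewrite f1F ?neq_lift //; apply: (van _ ord_max); rewrite /flip eqxx.
have {}eg : muni f1 = g * ('X * \prod_j ('X + ('X_j)%:P)).
  rewrite eg big_cons big_map big_enum /=; congr (_ * (_ * _)); first exact: subr0.
  by apply: eq_bigr => j _; rewrite polyCN opprK.
pose U v := map_poly (meval v) (muni f1); pose C (v : 'I_N -> K) : {poly K} := 'X * \prod_j ('X + (v j)%:P).
have UE v : U v = map_poly (meval v) g * C v.
  rewrite /U eg rmorphM /= rmorphM /= map_polyX rmorph_prod.
  congr (_ * (_ * _)); apply: eq_bigr => j _.
  by rewrite rmorphD /= map_polyX map_polyC /= mevalXU.
have C0 v : C v != 0.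
  rewrite mulf_neq0 ?polyX_eq0 //; apply/prodf_neq0 => j _.
  by rewrite -[(v j)]opprK polyCN polyXsubC_eq0.
have ssg m : supersymmetric g`_m.
  split=> [s v|i j v t ij]; rewrite -!(@coef_map _ _ (meval _)) /=.
    congr (nth _ (polyseq _) _); apply: (mulIf (C0 v)); rewrite -[RHS]UE.
    have -> : C v = C (v \o s) by rewrite /C [in LHS](reindex_inj (@perm_inj _ s)).
    rewrite -UE; apply: poly_horner_inj => u; rewrite !meval_muni; case: ssf1 => f1S _.
    by rewrite -[RHS](f1S (lift_perm ord_max ord_max s)); apply: meval_eq; exact: extend_perm.
  (* When two coordinates are u, -u, moving u to 0 shows that f1 vanishes whatever the last variable
     is. As C is not 0, g itself vanishes there, so it does not depend on u. *)
  have g0 u : map_poly (meval (flip v i j u)) g = 0.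
    apply/eqP; have : U (flip v i j u) == 0.
      apply/eqP/poly_horner_inj => x; rewrite meval_muni horner0 (meval_eq _ (extend_flip _ _ _ _ _)).
      case: (ssf1) => _ -> //; last by rewrite (inj_eq lift_inj).
      by apply: (van _ (lift ord_max i)); rewrite /flip eqxx.
    by rewrite UE mulf_eq0 (negbTE (C0 _)) orbF.
  by rewrite !g0.
have [|F [dF eF]] := @delexpr_horner N g.
  by move=> h /(nthP 0)[m _ <-]; exact: IH.
have [e ee] := delexpr_sum N dF.
exists (QAdd (QMul (QConst 2^-1) e) e0) => v vI /=.
have -> : f = f1 + evalq (@mpolyC N.+1 K) (fun r => qpoly K N.+1 r.+1) e0 by rewrite subrK.
rewrite mevalD meval_evalq; congr (_ + _); last first.
  by apply: eq_evalq => r; rewrite meval_qpoly.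
rewrite -ee // -[LHS]mulr1 -[in LHS](sum_pow_lagrange vI) !mulr_sumr; apply: eq_bigr => i _.
have -> : f1.@[v] = F v i * (v i * \prod_(j | j != i) (v i + v j)).
  rewrite (meval_extend_lift _ i ssf1) -meval_muni -/(U _) UE hornerM; congr (_ * _).
    rewrite eF // (horner_coef_wide _ (size_poly _ _)); apply: eq_bigr => m _.
    by rewrite coef_map.
  rewrite hornerM hornerX horner_prod prod_lift; congr (_ * _).
  by apply: eq_bigr => j _; rewrite !hornerE.
rewrite /qweight prodf_div exprS; set D := \prod_(_ | _) (_ - _).
have D0 : D != 0 by apply/prodf_neq0 => j ji; rewrite subr_eq0 eq_sym; apply: contra ji => /eqP/vI ->.
by field; rewrite D0.
Qed.

(** As [qenv v r] is q_(r+1), an even r is the case of an odd index. For r odd, the relation of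
    degree r + 1 contains q_(r+1) twice with sign +, and all its other terms have smaller positive
    indices. The expression is the same for all N. *)
Lemma qcoef_odd r : exists e, forall N (v : 'I_N -> K),
  qenv v r = evalq id (fun k => qcoef v k.*2.+1) e.
Proof.
elim/ltn_ind: r => r IH.
case: (boolP (odd r)) => [oddr|evr]; last first.
  by exists (QGen r./2) => N v /=; rewrite even_halfK.
have ex2 k : (0 < k <= r)%N -> exists e, forall N (v : 'I_N -> K),
    qcoef v k * qcoef v (r.+1 - k) = evalq id (fun k => qcoef v k.*2.+1) e.
  case/andP=> k0 kr; have [|a ea] := IH k.-1; first by rewrite prednK.
  have [|b eb] := IH (r - k)%N; first by rewrite ltn_subrL k0 (leq_trans k0 kr).
  exists (QMul a b) => N v /=; rewrite -ea -eb /qenv prednK // subSn //.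
have sums m : (m <= r)%N -> exists e, forall N (v : 'I_N -> K),
    \sum_(k < m) (-1) ^+ (r - k) * (qcoef v k.+1 * qcoef v (r - k)) =
    evalq id (fun k => qcoef v k.*2.+1) e.
  elim: m => [|m IHm] mr; first by exists (QConst 0) => N v; rewrite big_ord0.
  have [e ee] := IHm (ltnW mr); have [e' ee'] := ex2 m.+1 mr.
  exists (QAdd e (QMul (QConst ((-1) ^+ (r - m))) e')) => N v.
  by rewrite big_ord_recr /= ee -ee' subSS.
have [e ee] := sums r (leqnn r); exists (QMul (QConst (- 2^-1)) e) => N v /=.
rewrite -ee /qenv; have := qcoef_even v (ltn0Sn r).
rewrite big_ord_recl big_ord_recr /= subn0 subnn qcoef0 !mul1r mulr1.
rewrite [in X in X + _](_ : (-1) ^+ r.+1 = 1 :> K); last by rewrite -signr_odd /= oddr.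
rewrite mul1r /bump /= addrCA -mulr2n => /eqP; rewrite addr_eq0.
under [X in X == _]eq_bigr => k _ do rewrite add1n subSS.
by move/eqP ->; rewrite -mulr_natl; field.
Qed.

Theorem supersymmetric_gen_odd N (f : {mpoly K[N]}) : supersymmetric f ->
  exists e, f = evalq (@mpolyC N K) (fun k => qpoly K N k.*2.+1) e.
Proof.
move=> /supersymmetric_gen[e ee].
(* Equality at points with distinct coordinates is enough to identify the polynomials. *)
suff [e' ee'] : exists e', forall v : 'I_N -> K,
    evalq id (qenv v) e = evalq id (fun k => qcoef v k.*2.+1) e'.
  exists e'; apply: mpoly_injective_eq => v vI; rewrite ee // ee' meval_evalq.
  by apply: eq_evalq => k; rewrite meval_qpoly.
elim: e {ee} => [c|r|a [a' IHa] b [b' IHb]|a [a' IHa] b [b' IHb]] /=.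
- by exists (QConst c).
- by have [e ee] := qcoef_odd r; exists e => v; rewrite -ee.
- by exists (QAdd a' b') => v; rewrite IHa IHb.
- by exists (QMul a' b') => v; rewrite IHa IHb.
Qed.

End Supersymmetric.

(** * Superpolynomials on the queer superalgebra *)

Section MpolyCoef.
Variables (K : numFieldType) (n : nat).
Implicit Types (p : {mpoly K[n]}) (i : 'I_n) (m : 'X_{1..n}).

Lemma mcoeffXM i p m :
  ('X_i * p)@_m = if m i == 0%N then 0 else p@_(m - U_(i)).
Proof.
case: ifPn => [/eqP mi|mi].
  apply/eqP; rewrite mcoeff_eq0; apply/negP => /msuppM_le/allpairsP[[a b] /= []].
  rewrite msuppX inE => /eqP -> _ e; move: mi.
  by rewrite e mnmDE mnm1E eqxx.
have le_im : (U_(i) <= m)%MM by rewrite lep1mP.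
by rewrite mulrC -[in LHS](submK le_im) addmC mcoeffMX.
Qed.

Definition mtrunc (Q : pred 'X_{1..n}) p : {mpoly K[n]} :=
  \sum_(m <- msupp p | Q m) p@_m *: 'X_[m].

Lemma mcoeff_mtrunc Q p m : (mtrunc Q p)@_m = if Q m then p@_m else 0.
Proof.
rewrite /mtrunc raddf_sum /= big_mkcond /=.
case: (boolP (m \in msupp p)) => [mp|mp].
  rewrite (bigD1_seq m) ?msupp_uniq //= mcoeffZ mcoeffX eqxx mulr1 big1 ?addr0 // => k km.
  by case: ifP => // _; rewrite mcoeffZ mcoeffX (negbTE km) mulr0.
rewrite (memN_msupp_eq0 mp) if_same big1_seq // => k /= kp; case: ifP => // _.
rewrite mcoeffZ mcoeffX; case: eqP => [e|]; last by rewrite mulr0.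
by move: kp; rewrite e (negbTE mp).
Qed.

Lemma mcoeff_pihomog d p m :
  (pihomog mdeg d p)@_m = if mdeg m == d then p@_m else 0.
Proof. by rewrite pihomogE -(mcoeff_mtrunc (fun m => mdeg m == d)). Qed.

Lemma mdeg_subU m i : m i != 0%N -> mdeg m = (mdeg (m - U_(i))).+1.
Proof.
by move=> mi; rewrite -[in LHS](submK (_ : (U_(i) <= m)%MM)) ?lep1mP // mdegD mdeg1 addn1.
Qed.

Lemma pihomog_XM d i p : pihomog mdeg d.+1 ('X_i * p) = 'X_i * pihomog mdeg d p.
Proof.
apply/mpolyP => m; rewrite mcoeff_pihomog !mcoeffXM mcoeff_pihomog.
by case: (boolP (m i == 0%N)) => mi; rewrite ?if_same // (mdeg_subU mi) eqSS.
Qed.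

Lemma pihomog0_XM i p : pihomog mdeg 0 ('X_i * p) = 0.
Proof.
apply/mpolyP => m; rewrite mcoeff_pihomog mcoeffXM mcoeff0.
by case: eqP => // /eqP; rewrite mdeg_eq0 => /eqP ->; rewrite mnm0E.
Qed.

Lemma pihomog_deriv d i p : pihomog mdeg d p^`M(i) = (pihomog mdeg d.+1 p)^`M(i).
Proof.
apply/mpolyP => m; rewrite mcoeff_pihomog !mcoeff_deriv mcoeff_pihomog mdegD mdeg1 addn1 eqSS.
by case: ifP => // _; rewrite mul0rn.
Qed.

(** Multiplication by x_a or x_b respects Q, so the part of p supported on Q is itself killed by the
    linear form, in a domain. *)
Lemma mtrunc_lin_eq0 (Q : pred 'X_{1..n}) (a b : 'I_n) (c d : K) p :
  (forall m, m a != 0%N -> Q (m - U_(a))%MM = Q m) ->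
  (forall m, m b != 0%N -> Q (m - U_(b))%MM = Q m) ->
  c *: 'X_a + d *: 'X_b != 0 :> {mpoly K[n]} ->
  (forall m, Q m -> ((c *: 'X_a + d *: 'X_b) * p)@_m = 0) ->
  forall m, Q m -> p@_m = 0.
Proof.
move=> Qa Qb l0 lp m Qm.
have tX x k : (forall m, m x != 0%N -> Q (m - U_(x))%MM = Q m) ->
    ('X_x * mtrunc Q p)@_k = if Q k then ('X_x * p)@_k else 0.
  move=> Qx; rewrite !mcoeffXM mcoeff_mtrunc; case: ifPn => [|k0]; first by rewrite if_same.
  by rewrite Qx.
have: (c *: 'X_a + d *: 'X_b) * mtrunc Q p = 0.
  apply/mpolyP => k; rewrite mcoeff0 mulrDl mcoeffD -!scalerAl !mcoeffZ !tX //.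
  case: ifP => Qk; last by rewrite !mulr0 addr0.
  by rewrite -[RHS](lp k Qk) mulrDl mcoeffD -!scalerAl !mcoeffZ.
move/eqP; rewrite mulf_eq0 (negbTE l0) => /eqP/(congr1 (mcoeff m)).
by rewrite mcoeff_mtrunc Qm mcoeff0.
Qed.

End MpolyCoef.

(* The superpolynomial algebra on even letters (o, false) and odd letters
   (o, true): [phi B] is the coefficient of the exterior monomial with support B. *)
Section Fock.
Variables (K : numFieldType) (O : finType).
Local Notation n := #|O|.
Local Notation letter := (O * bool)%type.

Definition fock : Type := {ffun {set O} -> {mpoly K[n]}}.
HB.instance Definition _ := GRing.Lmodule.on fock.

Implicit Types (o p : O) (B : {set O}) (phi : fock) (g h : letter).

Definition before o p : bool := (enum_rank o < enum_rank p)%N.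

Lemma beforeC o p : o != p -> before o p = ~~ before p o.
Proof.
move=> op; rewrite /before -leqNgt ltn_neqAle.
by rewrite [_ != _](_ : _ = true) // (inj_eq val_inj) (inj_eq enum_rank_inj).
Qed.

Lemma beforexx o : before o o = false.
Proof. by rewrite /before ltnn. Qed.

(* the sign of moving the odd letter o to its place in the exterior monomial B *)
Definition jw_sign o B : K := \prod_(p in B | before p o) (-1).

Lemma jw_signK o B : jw_sign o B * jw_sign o B = 1.
Proof. by rewrite /jw_sign -big_split /= big1 // => i _; rewrite mulrNN mulr1. Qed.

Lemma jw_signU o p B : p \notin B ->
  jw_sign o (p |: B) = (if before p o then -1 else 1) * jw_sign o B.
Proof.
by move=> pB; rewrite /jw_sign !big_mkcondr big_setU1.
Qed.

Lemma jw_signD o p B : p \in B ->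
  jw_sign o (B :\ p) = (if before p o then -1 else 1) * jw_sign o B.
Proof.
move=> pB; rewrite -{2}(setD1K pB) jw_signU ?setD11 // mulrA.
by case: ifP; rewrite ?mulrNN !mul1r.
Qed.

Definition mul_letter g phi : fock :=
  if g.2 then [ffun B : {set O} => if g.1 \in B then jw_sign g.1 B *: phi (B :\ g.1) else 0]
  else [ffun B : {set O} => 'X_(enum_rank g.1) * phi B].

Definition der_letter g phi : fock :=
  if g.2 then [ffun B : {set O} => if g.1 \in B then 0 else jw_sign g.1 B *: phi (g.1 |: B)]
  else [ffun B : {set O} => (phi B)^`M(enum_rank g.1)].

Lemma mul_letter_linear g : linear (mul_letter g).
Proof.
move=> a u v; case: g => o []; rewrite /mul_letter /=; apply/ffunP => B; rewrite !ffunE /=.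
  case: ifP => _; last by rewrite scaler0 addr0.
  by rewrite scalerDr !scalerA mulrC.
by rewrite mulrDr scalerAr.
Qed.
HB.instance Definition _ g :=
  GRing.isLinear.Build K fock fock *:%R (mul_letter g) (mul_letter_linear g).

Lemma der_letter_linear g : linear (der_letter g).
Proof.
move=> a u v; case: g => o []; rewrite /der_letter /=; apply/ffunP => B; rewrite !ffunE /=.
  case: ifP => _; first by rewrite scaler0 addr0.
  by rewrite scalerDr !scalerA mulrC.
by rewrite linearP.
Qed.
HB.instance Definition _ g :=
  GRing.isLinear.Build K fock fock *:%R (der_letter g) (der_letter_linear g).

(** The Koszul sign of two parities. *)
Definition ksign (a b : bool) : K := (-1) ^+ (a && b).

(** Of two distinct odd letters exactly one precedes the other, so exactly one of the two orders of
    insertion acquires a further sign. *)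
Lemma mul_letterC g h phi : mul_letter g (mul_letter h phi) =
  ksign g.2 h.2 *: mul_letter h (mul_letter g phi).
Proof.
case: g h => [o []] [p []]; rewrite /mul_letter /ksign /= ?expr0 ?scale1r;
  apply/ffunP => B; rewrite !ffunE; first last.
- by rewrite mulrCA.
- by case: ifP; rewrite ?mulr0 // -scalerAr.
- by case: ifP; rewrite ?mulr0 // -scalerAr.
rewrite !in_setD1 expr1 scaleN1r; case: (eqVneq o p) => [->|op].
  by rewrite /=; case: ifP; rewrite ?scaler0 oppr0.
rewrite /=.
case: ifP => oB; case: ifP => pB; rewrite ?oB ?pB ?scaler0 ?oppr0 //.
rewrite !scalerA !jw_signD // (beforeC op) [B :\ o :\ p]setDDl setUC -setDDl -scaleNr.
by congr (_ *: _); case: (before p o) => /=; ring.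
Qed.

Lemma der_letterC g h phi : der_letter g (der_letter h phi) =
  ksign g.2 h.2 *: der_letter h (der_letter g phi).
Proof.
case: g h => [o []] [p []]; rewrite /der_letter /ksign /= ?expr0 ?scale1r;
  apply/ffunP => B; rewrite !ffunE; first last.
- exact: mderiv_comm.
- by case: ifP; rewrite ?linear0 // linearZ.
- by case: ifP; rewrite ?linear0 // linearZ.
rewrite !in_setU1 expr1 scaleN1r; case: (eqVneq o p) => [->|op].
  by rewrite /=; case: ifP; rewrite ?scaler0 oppr0.
rewrite /=.
case: ifP => oB; case: ifP => pB; rewrite ?oB ?pB ?scaler0 ?oppr0 //.
rewrite !scalerA !jw_signU ?oB ?pB // (beforeC op) setUCA -scaleNr.
by congr (_ *: _); case: (before p o) => /=; ring.
Qed.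

(** The Weyl relations of the even letters and the Clifford relations of the odd ones, in one
    formula. *)
Lemma der_mul_letter g h phi : der_letter g (mul_letter h phi) =
  (g == h)%:R *: phi + ksign g.2 h.2 *: mul_letter h (der_letter g phi).
Proof.
case: g h => [o []] [p []]; rewrite /der_letter /mul_letter /ksign xpair_eqE /= ?expr0 ?scale1r;
  apply/ffunP => B; rewrite !ffunE ?andbF ?andbT ?mulr0n ?scale0r ?add0r; first last.
- rewrite mderivM mderivX; congr (_ + _).
  rewrite mnm1E (inj_eq enum_rank_inj) eq_sym; case: eqP => [->|_]; last by rewrite !scale0r mul0r.
  rewrite (_ : (_ - _)%MM = 0%MM) ?mpolyX0 ?scale1r ?mul1r //.
  by apply/mnmP => i; rewrite mnmBE subnn mnm0E.
- by case: ifP; rewrite ?linear0 // linearZ.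
- by case: ifP; rewrite ?mulr0 // -scalerAr.
rewrite !in_setU1 !in_setD1 expr1 scaleN1r; case: (eqVneq o p) => [->|op].
  rewrite /= mulr1n scale1r; case: ifP => pB; rewrite ?pB.
    by rewrite setD1K // scalerA jw_signD // beforexx mul1r jw_signK scale1r subrr.
  by rewrite oppr0 addr0 setU1K ?pB // scalerA jw_signU ?pB // beforexx mul1r jw_signK scale1r.
rewrite /= mulr0n scale0r add0r.
case: ifP => oB; case: ifP => pB; rewrite ?oB ?pB ?scaler0 ?oppr0 //.
rewrite !scalerA jw_signU ?oB // jw_signD // (beforeC op) -scaleNr.
rewrite (_ : (o |: B) :\ p = o |: B :\ p).
  by congr (_ *: _); case: (before p o) => /=; ring.
by apply/setP => q; rewrite !inE; case: eqP => [->|]; rewrite //= eq_sym (negbTE op).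
Qed.

Definition vac : fock := [ffun B : {set O} => if B == set0 then 1 else 0].

Lemma der_letter_vac g : der_letter g vac = 0.
Proof.
case: g => o []; rewrite /der_letter /=; apply/ffunP => B; rewrite !ffunE.
  case: ifP => // oB; rewrite (_ : _ == _ = false) ?scaler0 //.
  by apply/eqP => /setP/(_ o); rewrite !inE eqxx.
by case: ifP; rewrite ?linear0 // -mpolyC1 mderivC.
Qed.

(** Component of total degree d, an exterior monomial B counting for |B|; the test guards the
    truncated subtraction. *)
Definition fock_proj (d : nat) phi : fock :=
  [ffun B : {set O} => if (#|B| <= d)%N then pihomog mdeg (d - #|B|) (phi B) else 0].

Lemma fock_proj_linear d : linear (fock_proj d).
Proof.
move=> a u v; apply/ffunP => B; rewrite !ffunE.
by case: ifP => _; rewrite ?linearP // scaler0 addr0.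
Qed.
HB.instance Definition _ d :=
  GRing.isLinear.Build K fock fock *:%R (fock_proj d) (fock_proj_linear d).

Lemma fock_proj_mul d g phi :
  fock_proj d.+1 (mul_letter g phi) = mul_letter g (fock_proj d phi).
Proof.
case: g => o []; rewrite /mul_letter /=; apply/ffunP => B; rewrite !ffunE.
  case: (boolP (o \in B)) => oB; last by rewrite linear0 if_same.
  rewrite (cardsD1 o) oB /= add1n ltnS subSS.
  by case: ifP => _; rewrite ?linearZ // scaler0.
case: (leqP #|B| d) => [Bd|dB]; first by rewrite (leqW Bd) subSn // pihomog_XM.
rewrite mulr0; case: ifP => // Bd.
by rewrite (_ : (_ - _ = 0)%N) ?pihomog0_XM //; apply/eqP; rewrite subn_eq0.
Qed.

Lemma fock_proj0_mul g phi : fock_proj 0 (mul_letter g phi) = 0.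
Proof.
case: g => o []; rewrite /mul_letter /=; apply/ffunP => B; rewrite !ffunE leqn0 cards_eq0.
  by case: ifP => // /eqP ->; rewrite inE linear0.
by case: ifP => // _; rewrite pihomog0_XM.
Qed.

Lemma fock_proj_der d g phi :
  fock_proj d (der_letter g phi) = der_letter g (fock_proj d.+1 phi).
Proof.
case: g => o []; rewrite /der_letter /=; apply/ffunP => B; rewrite !ffunE.
  case: (boolP (o \in B)) => oB; first by rewrite linear0 if_same.
  rewrite cardsU1 oB /= add1n ltnS subSS.
  by case: ifP => _; rewrite ?linearZ // scaler0.
case: (leqP #|B| d) => [Bd|dB]; first by rewrite (leqW Bd) subSn // pihomog_deriv.
case: ifP => [Bd|]; last by rewrite linear0.
rewrite (_ : (_ - _ = 0)%N); last by apply/eqP; rewrite subn_eq0.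
apply/mpolyP => m; rewrite mcoeff0 mcoeff_deriv mcoeff_pihomog mdegD mdeg1 addn1.
by rewrite mul0rn.
Qed.

Lemma fock_proj_vac d : fock_proj d vac = if d == 0%N then vac else 0.
Proof.
apply/ffunP => B; rewrite !ffunE; case: (eqVneq B set0) => [->|B0]; last first.
  by rewrite linear0 if_same; case: ifP => _; rewrite !ffunE // (negbTE B0).
rewrite cards0 /= subn0 -mpolyX0 pihomogX /= mdeg0 eq_sym.
by case: ifP; rewrite !ffunE ?eqxx ?mpolyX0.
Qed.

Definition mul_word (w : seq letter) : fock := foldr mul_letter vac w.

Definition word_mon (w : seq letter) : 'X_{1..n} :=
  [multinom count_mem (enum_val i, false) w | i < n].
Definition word_set (w : seq letter) : {set O} := [set o | (o, true) \in w].

Lemma mul_word_mon w : (forall o, (count_mem (o, true) w <= 1)%N) ->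
  exists2 e : K, e != 0 &
    mul_word w = [ffun B : {set O} => if B == word_set w then e *: 'X_[word_mon w] else 0].
Proof.
elim: w => [|[o b] w IH] cw.
  exists 1; first exact: oner_neq0.
  have S0 : word_set [::] = set0 by apply/setP => o; rewrite !inE.
  have M0 : word_mon [::] = 0%MM by apply/mnmP => i; rewrite !mnmE.
  by apply/ffunP => B; rewrite !ffunE scale1r S0 M0 mpolyX0.
have [|e e0 ew] := IH; first by move=> p; apply: leq_trans (cw p); rewrite leq_addl.
rewrite /= ew; case: b {ew IH} (ew) cw => ew cw; last first.
  exists e => //; apply/ffunP => B; rewrite /mul_letter /= !ffunE.
  have -> : word_set ((o, false) :: w) = word_set w.
    by apply/setP => p; rewrite !inE xpair_eqE andbF.
  case: ifP => _; last by rewrite mulr0.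
  rewrite -scalerAr -mpolyXD; congr (_ *: 'X_[_]); apply/mnmP => i.
  rewrite mnmDE mnm1E !mnmE /= xpair_eqE eqxx andbT; congr (nat_of_bool _ + _)%N.
  by rewrite -(inj_eq enum_val_inj) enum_rankK.
have ow : (o, true) \notin w.
  by apply/count_memPn/eqP; rewrite -leqn0 -ltnS; apply: leq_trans (cw o); rewrite /= eqxx.
exists (jw_sign o (o |: word_set w) * e).
  rewrite mulf_neq0 //; apply/eqP => s0; have := jw_signK o (o |: word_set w).
  by rewrite s0 mul0r => /esym/eqP; rewrite oner_eq0.
apply/ffunP => B; rewrite /mul_letter /= !ffunE.
have ws : word_set ((o, true) :: w) = o |: word_set w.
  by apply/setP => p; rewrite !inE xpair_eqE andbT.
have wm : word_mon ((o, true) :: w) = word_mon w.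
  by apply/mnmP => i; rewrite !mnmE /= xpair_eqE andbF.
have oS : o \notin word_set w by rewrite inE.
rewrite ws wm; case: (eqVneq B (o |: word_set w)) => [->|nB].
  by rewrite setU11 setU1K // eqxx scalerA.
case: ifP => // oB; case: eqP => [e'|]; last by rewrite scaler0.
by case/eqP: nB; rewrite -e' setD1K.
Qed.

Lemma mul_word_coef w : (forall o, (count_mem (o, true) w <= 1)%N) ->
  (mul_word w (word_set w))@_(word_mon w) != 0.
Proof.
by move=> /mul_word_mon[e e0 ->]; rewrite ffunE eqxx mcoeffZ mcoeffX eqxx mulr1.
Qed.

(** [word_mon] and [word_set] together recover the multiset of letters, since an odd letter occurs
    at most once. With [mul_word_coef] this yields the independence of ordered words. *)
Lemma mul_word_coef0 w w' : (forall o, (count_mem (o, true) w <= 1)%N) ->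
  (forall o, (count_mem (o, true) w' <= 1)%N) -> ~~ perm_eq w w' ->
  (mul_word w (word_set w'))@_(word_mon w') = 0.
Proof.
move=> cw cw'; have [e _ ->] := mul_word_mon cw; rewrite ffunE; case: eqP => [es|]; last by rewrite mcoeff0.
rewrite mcoeffZ mcoeffX; case: eqP => [em|]; last by rewrite mulr0.
case/negP; apply/allP => [[o b] _] /=; case: b; last first.
  have := congr1 (fun m : 'X_{1..n} => m (enum_rank o)) em.
  by rewrite !mnmE enum_rankK => ->.
have := congr1 (fun B : {set O} => o \in B) es; rewrite !inE -!has_pred1 !has_count => e1.
have := cw o; have := cw' o; move: e1.
by case: (count _ w) => [|[|]] //; case: (count _ w') => [|[|]].
Qed.

End Fock.

(* (i, j, s) stands for F_ij if s = false and for F_(i,-j) if s = true; then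
   F_(i,j,s) F_(k,l,t) = delta_jk F_(i,l,s+t) in gl(N|N). *)
Notation qletter N := (('I_N * 'I_N) * bool)%type (only parsing).

(** * Derivations of S(q_N) and the action of q_N on it *)

Section QueerFock.
Variables (K : numFieldType) (N : nat).

Implicit Types g h k : qletter N.

Definition qmatch g h : bool := g.1.2 == h.1.1.
Definition qprod g h : qletter N := ((g.1.1, h.1.2), g.2 (+) h.2).

(** The superbracket of F_g and F_h, with F a family indexed by letters in any module: the same
    formula serves for matrices, for elements of U(q_N) and for operators. *)
Definition qbracket (W : lmodType K) (F : qletter N -> W) g h : W :=
  (qmatch g h)%:R *: F (qprod g h)
  - ksign K g.2 h.2 *: ((qmatch h g)%:R *: F (qprod h g)).

Lemma qbracket_map (W W' : lmodType K) (f : {linear W -> W'}) (F : qletter N -> W)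
    (F' : qletter N -> W') g h : (forall k, f (F k) = F' k) ->
  f (qbracket F g h) = qbracket F' g h.
Proof. by move=> fF; rewrite /qbracket linearB !linearZ /= !fF. Qed.

Local Notation V := (fock K ('I_N * 'I_N)%type).
Implicit Type phi : V.

Lemma ksignC a b : ksign K a b = ksign K b a.
Proof. by rewrite /ksign andbC. Qed.

Lemma ksignDl a b c : ksign K (a (+) b) c = ksign K a c * ksign K b c.
Proof. by case: a b c => [] [] []; rewrite /ksign /= ?expr0 ?expr1 ?mulr1 ?mulrNN ?mul1r ?mulr1. Qed.

Lemma ksignDr a b c : ksign K a (b (+) c) = ksign K a b * ksign K a c.
Proof. by rewrite !(ksignC a) ksignDl. Qed.

Lemma ksignK a b : ksign K a b * ksign K a b = 1.
Proof. by case: a b => [] []; rewrite /ksign /= ?expr0 ?expr1 ?mulrNN mulr1. Qed.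

(* On S(q_N), [lder g] and [rder g] are the superderivations extending
   x |-> g x and x |-> (-1)^(|g||x|) x g, products in gl(N|N). *)
Definition lder g phi : V :=
  \sum_l \sum_t mul_letter ((g.1.1, l), g.2 (+) t) (der_letter ((g.1.2, l), t) phi).
Definition rder g phi : V :=
  \sum_l \sum_t ksign K g.2 t *: mul_letter ((l, g.1.2), g.2 (+) t) (der_letter ((l, g.1.1), t) phi).

Lemma lder_linear g : linear (lder g).
Proof.
move=> a u v; rewrite /lder scaler_sumr -big_split /=; apply: eq_bigr => l _.
by rewrite scaler_sumr -big_split /=; apply: eq_bigr => t _; rewrite !linearP.
Qed.
HB.instance Definition _ g := GRing.isLinear.Build K V V *:%R (lder g) (lder_linear g).

Lemma rder_linear g : linear (rder g).
Proof.
move=> a u v; rewrite /rder scaler_sumr -big_split /=; apply: eq_bigr => l _.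
rewrite scaler_sumr -big_split /=; apply: eq_bigr => t _.
by rewrite !linearP.
Qed.
HB.instance Definition _ g := GRing.isLinear.Build K V V *:%R (rder g) (rder_linear g).

Lemma sum_delta_r (W : lmodType K) (F : 'I_N -> bool -> W) j h :
  \sum_l \sum_t (((j, l), t) == h)%:R *: F l t = (j == h.1.1)%:R *: F h.1.2 h.2.
Proof.
rewrite (bigD1 h.1.2) //= (bigD1 h.2) //= !big1 ?addr0 => [|l lh|t th].
- by case: h => [[a b] c] /=; rewrite !xpair_eqE !eqxx !andbT.
- apply: big1 => t _; case: h lh => [[a b] c] /= lb.
  by rewrite !xpair_eqE (negbTE lb) andbF scale0r.
- by case: h th => [[a b] c] /= tc; rewrite !xpair_eqE (negbTE tc) andbF scale0r.
Qed.

Lemma sum_delta_l (W : lmodType K) (F : 'I_N -> bool -> W) j h :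
  \sum_l \sum_t (((l, j), t) == h)%:R *: F l t = (j == h.1.2)%:R *: F h.1.1 h.2.
Proof.
rewrite (bigD1 h.1.1) //= (bigD1 h.2) //= !big1 ?addr0 => [|l lh|t th].
- by case: h => [[a b] c] /=; rewrite !xpair_eqE !eqxx !andbT.
- apply: big1 => t _; case: h lh => [[a b] c] /= lb.
  by rewrite !xpair_eqE (negbTE lb) scale0r.
- by case: h th => [[a b] c] /= tc; rewrite !xpair_eqE (negbTE tc) andbF scale0r.
Qed.

Lemma lder_mul g h phi : lder g (mul_letter h phi) =
  ksign K g.2 h.2 *: mul_letter h (lder g phi)
  + (qmatch g h)%:R *: mul_letter (qprod g h) phi.
Proof.
rewrite /lder addrC /qmatch.
rewrite -(sum_delta_r (fun l t => mul_letter ((g.1.1, l), g.2 (+) t) phi)).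
rewrite linear_sum scaler_sumr -big_split /=; apply: eq_bigr => l _.
rewrite linear_sum scaler_sumr -big_split /=; apply: eq_bigr => t _.
rewrite der_mul_letter linearD !linearZ /=; congr (_ + _).
by rewrite mul_letterC !scalerA /= ksignDl mulrCA ksignK mulr1.
Qed.

Lemma rder_mul g h phi : rder g (mul_letter h phi) =
  ksign K g.2 h.2 *: mul_letter h (rder g phi)
  + ksign K g.2 h.2 *: ((qmatch h g)%:R *: mul_letter (qprod h g) phi).
Proof.
rewrite /rder addrC /qmatch eq_sym.
have -> : ksign K g.2 h.2 *: ((g.1.1 == h.1.2)%:R *: mul_letter (qprod h g) phi) =
  (g.1.1 == h.1.2)%:R *: (ksign K g.2 h.2 *: mul_letter ((h.1.1, g.1.2), g.2 (+) h.2) phi).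
  by rewrite !scalerA mulrC /qprod addbC.
rewrite -(sum_delta_l (fun l t => ksign K g.2 t *: mul_letter ((l, g.1.2), g.2 (+) t) phi)).
rewrite linear_sum scaler_sumr -big_split /=; apply: eq_bigr => l _.
rewrite linear_sum scaler_sumr -big_split /=; apply: eq_bigr => t _.
rewrite der_mul_letter linearD !linearZ /= scalerDr; congr (_ + _).
rewrite mul_letterC !scalerA /= ksignDl; congr (_ *: _).
by rewrite mulrACA mulrA -[RHS]mulr1 -(ksignK t h.2); ring.
Qed.

(** Dual to [lder_mul]: the extra term is the derivative along the letter h with g h = k, which
    exists when g and k have the same row. *)
Lemma der_lder g k phi : der_letter k (lder g phi) =
  ksign K g.2 k.2 *: lder g (der_letter k phi)
  + (k.1.1 == g.1.1)%:R *: der_letter ((g.1.2, k.1.2), g.2 (+) k.2) phi.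
Proof.
rewrite /lder addrC eq_sym linear_sum scaler_sumr.
have -> : (g.1.1 == k.1.1)%:R *: der_letter (g.1.2, k.1.2, g.2 (+) k.2) phi =
  \sum_l \sum_t (((g.1.1, l), t) == k)%:R *: der_letter ((g.1.2, l), g.2 (+) t) phi.
  by rewrite (sum_delta_r (fun l t => der_letter ((g.1.2, l), g.2 (+) t) phi)).
rewrite -big_split /=; apply: eq_bigr => l _; rewrite linear_sum scaler_sumr.
rewrite [X in _ = X + _](reindex_inj (can_inj (addKb g.2))) -big_split /=.
apply: eq_bigr => t _; rewrite der_mul_letter addKb eq_sym; congr (_ + _).
rewrite der_letterC linearZ !scalerA /= ksignDr.
by rewrite -mulrA ksignK mulr1 ksignC.
Qed.

Lemma lder_vac g : lder g (vac K _) = 0.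
Proof. by rewrite /lder big1 // => l _; rewrite big1 // => t _; rewrite der_letter_vac linear0. Qed.

Lemma rder_vac g : rder g (vac K _) = 0.
Proof.
by rewrite /rder big1 // => l _; rewrite big1 // => t _; rewrite der_letter_vac linear0 scaler0.
Qed.

(** [lder_mul] expands one composition and [der_lder] the other. The second order parts agree up to
    the Koszul sign, and the two delta terms are the products in the bracket. *)
Lemma lder_comm g h phi :
  lder g (lder h phi) - ksign K g.2 h.2 *: lder h (lder g phi) =
  qbracket (fun k => lder k phi) g h.
Proof.
have ->: lder g (lder h phi) = \sum_l \sum_t
    (ksign K g.2 (h.2 (+) t) *: mul_letter ((h.1.1, l), h.2 (+) t) (lder g (der_letter ((h.1.2, l), t) phi))
     + (qmatch g h)%:R *: mul_letter ((g.1.1, l), g.2 (+) h.2 (+) t) (der_letter ((h.1.2, l), t) phi)).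
  rewrite [in LHS]/(lder h phi) linear_sum; apply: eq_bigr => l _.
  rewrite linear_sum; apply: eq_bigr => t _; rewrite /= lder_mul /=.
  by rewrite /qprod /= addbA.
have ->: lder h (lder g phi) = \sum_l \sum_t
    (ksign K g.2 t *: mul_letter ((h.1.1, l), h.2 (+) t) (lder g (der_letter ((h.1.2, l), t) phi))
     + (qmatch h g)%:R *: mul_letter ((h.1.1, l), h.2 (+) t) (der_letter ((g.1.2, l), g.2 (+) t) phi)).
  rewrite [in LHS]/lder; apply: eq_bigr => l _; apply: eq_bigr => t _.
  by rewrite der_lder linearD !linearZ.
rewrite /qbracket /= scaler_sumr -sumrB.
have -> : lder (qprod h g) phi = \sum_l \sum_t
   mul_letter ((h.1.1, l), h.2 (+) t) (der_letter ((g.1.2, l), g.2 (+) t) phi).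
  apply: eq_bigr => l _; rewrite [RHS](reindex_inj (can_inj (addKb g.2))).
  by apply: eq_bigr => t _; rewrite addKb addbA.
rewrite !scaler_sumr -sumrB; apply: eq_bigr => l _.
rewrite !scaler_sumr -!sumrB; apply: eq_bigr => t _.
rewrite scalerDr !scalerA ksignDr addrAC opprD addrA subrr add0r addrC.
by rewrite /= !linearZ.
Qed.

(* q_N is closed under the product of gl(N|N), so [lder] is an action of q_N,
   and adding the multiplication operators keeps the commutation relations. *)
Definition rho_letter g phi : V := mul_letter g phi + lder g phi.

Lemma rho_letter_linear g : linear (rho_letter g).
Proof. by move=> a u v; rewrite /rho_letter !linearP scalerDr addrACA. Qed.
HB.instance Definition _ g :=
  GRing.isLinear.Build K V V *:%R (rho_letter g) (rho_letter_linear g).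

(** The multiplications supercommute, the mixed commutators give the two multiplication terms of the
    bracket by [lder_mul], and [lder_comm] gives the rest. *)
Lemma rho_letter_comm g h phi :
  rho_letter g (rho_letter h phi) - ksign K g.2 h.2 *: rho_letter h (rho_letter g phi) =
  qbracket (fun k => rho_letter k phi) g h.
Proof.
have -> : qbracket (fun k => rho_letter k phi) g h =
    qbracket (fun k => mul_letter k phi) g h + qbracket (fun k => lder k phi) g h.
  by rewrite /qbracket /rho_letter !scalerDr opprD addrACA.
rewrite -lder_comm /rho_letter !linearD /= !lder_mul (mul_letterC g h) /qbracket.
rewrite !scalerDr !scalerA [ksign K h.2 _]ksignC ksignK scale1r.
set a := _ *: mul_letter h (mul_letter g _); set b := mul_letter g _.
set c := _ *: mul_letter h (lder _ _).
set x := _ *: mul_letter (qprod g h) _; set y := _ *: mul_letter (qprod h g) _.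
set u := lder g _; set v := _ *: lder h _.
rewrite [- (b + y)]opprD !addrA [LHS](ACl (1*6*(2*8)*(3*7)*4*9*5*10)) /=.
by rewrite !subrr !add0r.
Qed.

(** The superderivation extending x |-> [F_g, x]: the adjoint action on S(q_N). *)
Definition adv g phi : V := lder g phi - rder g phi.

Lemma adv_linear g : linear (adv g).
Proof. by move=> a u v; rewrite /adv lder_linear rder_linear scalerBr opprD addrACA. Qed.
HB.instance Definition _ g := GRing.isLinear.Build K V V *:%R (adv g) (adv_linear g).

Lemma adv_mul g h phi : adv g (mul_letter h phi) =
  ksign K g.2 h.2 *: mul_letter h (adv g phi)
  + qbracket (fun k => mul_letter k phi) g h.
Proof.
by rewrite /adv lder_mul rder_mul linearB /= scalerBr /qbracket opprD addrACA.
Qed.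

Lemma adv_vac g : adv g (vac K _) = 0.
Proof. by rewrite /adv lder_vac rder_vac subrr. Qed.

Lemma fock_proj_lder d g phi : fock_proj d (lder g phi) = lder g (fock_proj d phi).
Proof.
rewrite linear_sum; apply: eq_bigr => l _; rewrite linear_sum; apply: eq_bigr => t _.
case: d => [|d]; last by rewrite /= fock_proj_mul fock_proj_der.
rewrite /= fock_proj0_mul.
have -> : der_letter (g.1.2, l, t) (fock_proj 0 phi) = 0; last by rewrite linear0.
apply/ffunP => B; rewrite /der_letter !ffunE; case: ifP => t0; rewrite !ffunE.
  case: ifP => // lB; rewrite leqn0 cards_eq0 (_ : _ == set0 = false) ?scaler0 //.
  by apply/eqP => /setP/(_ (g.1.2, l)); rewrite !inE eqxx.
case: ifP => _; last by rewrite linear0.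
apply/mpolyP => m; rewrite mcoeff0 mcoeff_deriv mcoeff_pihomog mdegD mdeg1 addn1.
by rewrite sub0n mul0rn.
Qed.

Lemma fock_proj_rho d g phi :
  fock_proj d.+1 (rho_letter g phi) = mul_letter g (fock_proj d phi) + lder g (fock_proj d.+1 phi).
Proof. by rewrite /rho_letter linearD /= fock_proj_mul fock_proj_lder. Qed.

Definition rho_word (w : seq (qletter N)) : V := foldr rho_letter (vac K _) w.

Lemma fock_proj_rho_word_gt d w : (size w < d)%N -> fock_proj d (rho_word w) = 0.
Proof.
elim: w d => [|g w IH] [|d] //=; first by rewrite fock_proj_vac.
by rewrite ltnS => wd; rewrite fock_proj_rho !IH ?linear0 ?addr0 // ltnW.
Qed.

(** The derivation in [rho_letter] preserves the degree, so only the multiplications reach degree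
    [size w]. *)
Lemma fock_proj_rho_word w : fock_proj (size w) (rho_word w) = mul_word K w.
Proof.
elim: w => [|g w IH] /=; first by rewrite fock_proj_vac.
by rewrite fock_proj_rho IH fock_proj_rho_word_gt // linear0 addr0.
Qed.

End QueerFock.

(** * Invariant superpolynomials *)

Section Invariants.
Variables (K : numFieldType) (N : nat).
Local Notation O := ('I_N * 'I_N)%type.
Local Notation V := (fock K O).
Local Notation letter := (qletter N).
Local Notation er := (@enum_rank O).
Implicit Types (g h : letter) (phi : V) (B : {set O}) (m : 'X_{1..#|{: O}|}).

Definition diag_letter g : bool := ~~ g.2 && (g.1.1 == g.1.2).
Definition offdiag (o : O) : bool := o.1 != o.2.

(* The degree in the letters other than F_11, .., F_NN; an invariant vanishing
   in codegree 0 vanishes in every codegree. *)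
Definition codeg B m : nat := (#|B| + \sum_(o : O | offdiag o) m (er o))%N.

Lemma codeg_subU B m o : m (er o) != 0%N ->
  codeg B m = (codeg B (m - U_(er o)) + offdiag o)%N.
Proof.
move=> mo; rewrite /codeg -addnA; congr (_ + _)%N.
rewrite (eq_bigr (fun p => (m - U_(er o))%MM (er p) + (p == o))%N); last first.
  move=> p _; rewrite mnmBE mnm1E (inj_eq enum_rank_inj) eq_sym; case: eqP => [->|_].
    by rewrite subnK // lt0n.
  by rewrite subn0 addn0.
rewrite big_split /=; congr (_ + _)%N; rewrite big_mkcond /= (bigD1 o) //= eqxx.
rewrite big1 ?addn0 => [|p po]; first by case: (offdiag o).
by rewrite (negbTE po) if_same.
Qed.

Definition low k phi : Prop := forall B m, (codeg B m < k)%N -> (phi B)@_m = 0.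

Lemma lowD k phi psi : low k phi -> low k psi -> low k (phi + psi).
Proof. by move=> l l' B m lt; rewrite ffunE mcoeffD l ?l' ?addr0. Qed.

Lemma lowZ k a phi : low k phi -> low k (a *: phi).
Proof. by move=> l B m lt; rewrite ffunE mcoeffZ l ?mulr0. Qed.

Lemma lowN k phi : low k phi -> low k (- phi).
Proof. by move=> l; rewrite -scaleN1r; apply: lowZ. Qed.

Lemma low_sum k (I : finType) (Q : pred I) (F : I -> V) :
  (forall i, Q i -> low k (F i)) -> low k (\sum_(i | Q i) F i).
Proof.
move=> l; elim/big_rec: _ => [B m _|i x Qi lx]; first by rewrite ffunE mcoeff0.
by apply: lowD => //; exact: l.
Qed.

Lemma low_mul k g phi : ~~ diag_letter g -> low k phi -> low k.+1 (mul_letter g phi).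
Proof.
case: g => o []; rewrite /diag_letter /mul_letter /= => nd l B m; rewrite ltnS ffunE => lt.
  case: ifP => [oB|]; last by rewrite mcoeff0.
  rewrite mcoeffZ l ?mulr0 //; move: lt; rewrite /codeg (cardsD1 o) oB.
  by rewrite add1n addSn.
rewrite mcoeffXM; case: ifPn => // mo; apply: l.
by move: lt; rewrite (codeg_subU B mo) /offdiag nd addn1.
Qed.

Lemma low_der k g phi : low k.+1 phi -> low k (der_letter g phi).
Proof.
case: g => o []; rewrite /der_letter /= => l B m lt; rewrite ffunE.
  case: ifPn => [|oB]; first by rewrite mcoeff0.
  rewrite mcoeffZ l ?mulr0 // /codeg cardsU1 oB.
  by rewrite add1n addSn.
rewrite mcoeff_deriv l ?mul0rn //.
have mo : (m + U_(er o))%MM (er o) != 0%N by rewrite mnmDE mnm1E eqxx addn1.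
rewrite (codeg_subU B mo) addmK; apply: leq_trans (_ : (codeg B m).+2 <= _)%N; last by [].
by rewrite ltnS -addn1 leq_add2l leq_b1.
Qed.

Definition opposite g : letter := ((g.1.2, g.1.1), g.2).

(** In adv g phi = 0 the terms multiplied by a nondiagonal letter have codegree at least k. The two
    others are x_ii and x_jj times the derivative along the opposite letter, so a linear form that
    preserves the codegree kills this derivative below codegree k. This improves on [low_der] by
    one. *)
Lemma low_der_opposite k g phi : adv g phi = 0 -> ~~ diag_letter g ->
  low k phi -> low k (der_letter (opposite g) phi).
Proof.
case: k => // k ag nd l; case: g ag nd => [[i j] s] ag nd.
set psi := der_letter _ phi.
have lt a b : ~~ diag_letter a -> low k.+1 (mul_letter a (der_letter b phi)).
  by move=> na; apply: low_mul => //; exact: low_der.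
(* Only the term l = i, t = s multiplies by a diagonal letter; likewise l = j, t = s in [rder]. *)
have e1 : lder ((i, j), s) phi = mul_letter ((i, i), false) psi +
    (\sum_(l | l != i) \sum_t mul_letter ((i, l), s (+) t) (der_letter ((j, l), t) phi) +
     \sum_(t | t != s) mul_letter ((i, i), s (+) t) (der_letter ((j, i), t) phi)).
  rewrite /lder (bigD1 i) //= (bigD1 s) //= addbb -addrA; congr (_ + _).
  by rewrite addrC.
have e2 : rder ((i, j), s) phi = ksign K s s *: mul_letter ((j, j), false) psi +
    (\sum_(l | l != j) \sum_t ksign K s t *: mul_letter ((l, j), s (+) t) (der_letter ((l, i), t) phi) +
     \sum_(t | t != s) ksign K s t *: mul_letter ((j, j), s (+) t) (der_letter ((j, i), t) phi)).
  rewrite /rder (bigD1 j) //= (bigD1 s) //= addbb -addrA; congr (_ + _).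
  by rewrite addrC.
have lT : low k.+1 (mul_letter ((i, i), false) psi - ksign K s s *: mul_letter ((j, j), false) psi).
  move: ag; rewrite /adv e1 e2; set r1 := (_ + _ in X in _ + X - _).
  set r2 := (_ + _ in X in - (_ + X)) => /eqP; rewrite subr_eq add0r => /eqP e.
  have -> : mul_letter ((i, i), false) psi - ksign K s s *: mul_letter ((j, j), false) psi = r2 - r1.
    by apply/eqP; rewrite subr_eq addrAC eq_sym subr_eq [r2 + _]addrC eq_sym; apply/eqP.
  have nds (a t : bool) z : t != a -> ~~ diag_letter (z, a (+) t) by case: t a => [] [].
  apply: lowD; [|apply: lowN]; apply: lowD; apply: low_sum => x xP.
  - by apply: low_sum => t _; apply/lowZ/lt; rewrite /diag_letter /= (negbTE xP) andbF.
  - by apply/lowZ/lt/nds.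
  - by apply: low_sum => t _; apply/lt; rewrite /diag_letter /= eq_sym (negbTE xP) andbF.
  - exact/lt/nds.
move=> B m; move: m; apply: (@mtrunc_lin_eq0 _ _ _ (er (i, i)) (er (j, j)) 1 (- ksign K s s)).
- by move=> m m0; rewrite (codeg_subU B m0) /offdiag /= eqxx addn0.
- by move=> m m0; rewrite (codeg_subU B m0) /offdiag /= eqxx addn0.
(* If i = j the letter is odd, the Koszul sign is -1 and the form is 2 x_ii. *)
- apply/eqP => /(congr1 (mcoeff U_(er (i, i)))); rewrite mcoeffD !mcoeffZ !mcoeffXU eqxx mcoeff0.
  rewrite (inj_eq enum_rank_inj) xpair_eqE andbb mulr1; apply/eqP.
  move: nd; rewrite /diag_letter /= [j == i]eq_sym; case: eqP => _; last by rewrite mulr0 addr0 oner_eq0.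
  by case: s {ag psi e1 e2 lT} => //= _; rewrite /ksign expr1 opprK mulr1 -mulr2n pnatr_eq0.
- move=> m lm; have := lT B m lm; rewrite /mul_letter /= !ffunE.
  by rewrite scale1r mulrDl scaleNr mulNr -scalerAl.
Qed.

(** A monomial of codegree k > 0 contains a nondiagonal letter. Its coefficient, times a sign or a
    positive integer, is a coefficient of codegree k - 1 in the derivative along this letter, which
    vanishes by [low_der_opposite]. *)
Lemma low_step k phi : (forall g, adv g phi = 0) -> (0 < k)%N -> low k phi -> low k.+1 phi.
Proof.
move=> inv k0 l B m; rewrite ltnS leq_eqVlt => /orP[/eqP ck|]; last exact: l.
have ld h : ~~ diag_letter h -> low k (der_letter h phi).
  move=> nh; have -> : h = opposite (opposite h) by case: h nh => [[]].
  by apply: low_der_opposite => //; move: nh; rewrite /diag_letter /= eq_sym.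
have [B0|[o oB]] := set_0Vmem B; last first.
  have /(_ (B :\ o) m) := ld (o, true) isT.
  have cB : codeg B m = (codeg (B :\ o) m).+1 by rewrite /codeg (cardsD1 o) oB add1n addSn.
  rewrite -ck cB ltnSn => /(_ isT); rewrite /der_letter /= ffunE setD11 setD1K // mcoeffZ.
  move/eqP; rewrite mulf_eq0 => /orP[/eqP s0|/eqP //].
  by have := jw_signK K o (B :\ o); rewrite s0 mul0r => /esym/eqP; rewrite oner_eq0.
have [o no mo] : exists2 o, offdiag o & m (er o) != 0%N.
  apply/exists_inP; apply: contraTT k0; rewrite negb_exists_in -leqNgt => /forall_inP m0.
  by rewrite -ck /codeg B0 cards0 big1 // => o oo; apply/eqP; rewrite -[_ == _]negbK m0.
have nd : ~~ diag_letter (o, false) by [].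
have /(_ B (m - U_(er o))%MM) := ld _ nd.
rewrite -ck (codeg_subU B mo) no addn1 ltnSn => /(_ isT).
rewrite /der_letter /= ffunE mcoeff_deriv submK ?lep1mP //.
by move/eqP; rewrite mulrn_eq0 /= => /eqP.
Qed.

Definition diag_point (A : nzRingType) (v : 'I_N -> A) (e : 'I_#|{: O}|) : A :=
  let o := enum_val e in if o.1 == o.2 then v o.1 else 0.

Definition restrict phi : {mpoly K[N]} :=
  mmap (@mpolyC N K) (diag_point (fun i => 'X_i)) (phi set0).

Lemma restrict_linear : linear restrict.
Proof.
move=> a u v; rewrite /restrict !ffunE mmapD mmapZ.
by rewrite mul_mpolyC.
Qed.
HB.instance Definition _ := GRing.isLinear.Build K V {mpoly K[N]} *:%R restrict restrict_linear.

Lemma restrict_coef phi m : codeg set0 m = 0%N ->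
  (restrict phi)@_[multinom m (er (i, i)) | i < N] = (phi set0)@_m.
Proof.
rewrite /codeg cards0 add0n => /eqP; rewrite sum_nat_eq0 => /forallP m0.
have {}m0 o : offdiag o -> m (er o) = 0%N by move=> oo; have := m0 o; rewrite oo => /eqP.
rewrite /restrict /mmap raddf_sum /=.
have E (k : 'X_{1..#|{: O}|}) : (((phi set0)@_k)%:MP_[N] *
     mmap1 (diag_point (fun i : 'I_N => 'X_i : {mpoly K[N]})) k)@_[multinom m (er (i, i)) | i < N] =
     (phi set0)@_k * (k == m)%:R.
  rewrite mul_mpolyC mcoeffZ; congr (_ * _).
  case: (boolP [forall o : O, offdiag o ==> (k (er o) == 0%N)]) => [/forall_inP k0|].
    rewrite (_ : mmap1 _ k = 'X_[[multinom k (er (i, i)) | i < N]]).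
      rewrite mcoeffX; congr (_%:R); congr nat_of_bool; apply/eqP/eqP => [/mnmP e|->//].
      apply/mnmP => x; rewrite -[x]enum_valK; case: (enum_val x) => i j.
      case: (eqVneq i j) => [<-|ij]; first by have := e i; rewrite !mnmE.
      by rewrite m0 //; apply/eqP/k0.
    rewrite mpolyXE_id /mmap1 (reindex (@enum_rank O)) /=; last first.
      by exists enum_val => x _; rewrite ?enum_rankK ?enum_valK.
    rewrite (bigID (fun o : O => offdiag o)) /= big1 ?mul1r => [|o oo].
      rewrite (reindex (fun i : 'I_N => (i, i))) /=.
        apply: eq_big => [i|i _]; first by rewrite /offdiag eqxx.
        by rewrite mnmE /diag_point enum_rankK /= eqxx.
      exists fst => [//|[i j]]; rewrite inE /offdiag /= negbK => /eqP -> //.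
    by rewrite (eqP (k0 o oo)) expr0.
  rewrite negb_forall_in => /exists_inP[o oo ko].
  rewrite (_ : mmap1 _ k = 0) ?mcoeff0.
    by case: eqP => // e; move: ko; rewrite e m0.
  rewrite /mmap1 (bigD1 (er o)) //= /diag_point enum_rankK (negbTE (oo : o.1 != o.2)).
  by rewrite expr0n (negbTE ko) mul0r.
under eq_bigr do rewrite E.
case: (boolP (m \in msupp (phi set0))) => [mp|mp].
  by rewrite (bigD1_seq m) ?msupp_uniq //= eqxx mulr1 big1 ?addr0 // => k /negbTE->; rewrite mulr0.
rewrite (memN_msupp_eq0 mp) big1_seq // => k /= kp; case: eqP => [e|]; last by rewrite mulr0.
by move: kp; rewrite e (negbTE mp).
Qed.

Theorem invariant_restrict_eq0 phi :
  (forall g, adv g phi = 0) -> restrict phi = 0 -> phi = 0.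
Proof.
move=> inv r0; have l k : low k.+1 phi.
  elim: k => [|k IH]; last exact: low_step.
  move=> B m; rewrite ltnS leqn0 => /eqP c0.
  have B0 : B = set0.
    by apply/eqP; rewrite -cards_eq0 -leqn0 -c0 leq_addr.
  by rewrite B0 in c0 *; rewrite -restrict_coef // r0 mcoeff0.
apply/ffunP => B; rewrite [RHS]ffunE; apply/mpolyP => m; rewrite mcoeff0.
exact: (l (codeg B m)).
Qed.

End Invariants.

(** * Derivatives along polynomial curves *)

Section ChainRule.
Variables (K : numFieldType) (n : nat).

Lemma horner_mmap (c : 'I_n -> {poly K}) (p : {mpoly K[n]}) t :
  (mmap polyC c p).[t] = p.@[fun i => (c i).[t]].
Proof.
rewrite /mmap horner_sum mevalE; apply: eq_bigr => m _.
by rewrite hornerM hornerC /mmap1 horner_prod; congr (_ * _); apply: eq_bigr => i _; rewrite horner_exp.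
Qed.

Lemma deriv_mmap (c : 'I_n -> {poly K}) (p : {mpoly K[n]}) :
  (mmap polyC c p)^`() = \sum_i mmap polyC c (p^`M(i)) * (c i)^`().
Proof.
pose P (q : {mpoly K[n]}) := (mmap polyC c q)^`() = \sum_i mmap polyC c (q^`M(i)) * (c i)^`().
have PM q r : P q -> P r -> P (q * r).
  rewrite /P rmorphM /= derivM => -> ->; rewrite mulr_suml mulr_sumr -big_split /=.
  by apply: eq_bigr => i _; rewrite mderivM mmapD !rmorphM /=; ring.
have P1 : P 1.
  by rewrite /P rmorph1 derivC big1 // => i _; rewrite -mpolyC1 mderivC mmap0 mul0r.
have PX i : P 'X_i.
  rewrite /P mmapX mmap1U (bigD1 i) //= mderivX mnm1E eqxx scale1r.
  rewrite (_ : (U_(i) - U_(i))%MM = 0%MM); last by apply/mnmP => j; rewrite mnmBE subnn mnm0E.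
  rewrite mpolyX0 rmorph1 mul1r big1 ?addr0 // => j ji.
  by rewrite mderivX mnm1E eq_sym (negbTE ji) scale0r mmap0 mul0r.
elim/mpolyind: p => [|a m p _ _ IH].
  by rewrite mmap0 deriv0 big1 // => i _; rewrite mderiv0 mmap0 mul0r.
have PXm : P 'X_[m].
  rewrite mpolyXE_id; apply: (big_ind P) => // i _.
  by elim: (m i) => [|k IHk]; rewrite ?expr0 ?exprS //; exact: PM.
rewrite mmapD derivD IH mmapZ derivM derivC mul0r add0r PXm mulr_sumr -big_split /=.
by apply: eq_bigr => i _; rewrite mderivD mderivZ mmapD mmapZ mulrDl mulrA.
Qed.

Lemma deriv_eq0_horner (p : {poly K}) : p^`() = 0 -> forall t u, p.[t] = p.[u].
Proof.
move=> p0 t u; rewrite (_ : p = (p`_0)%:P) ?hornerC //.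
apply/polyP => -[|k]; rewrite coefC //=.
have := congr1 (fun q : {poly K} => q`_k) p0.
by rewrite coef_deriv coef0 => /eqP; rewrite mulrn_eq0 => /eqP.
Qed.

End ChainRule.

(** * Supersymmetry of the restriction of an invariant *)

Section RestrictSupersymmetric.
Variables (K : numFieldType) (N : nat).
Local Notation O := ('I_N * 'I_N)%type.
Local Notation V := (fock K O).
Local Notation er := (@enum_rank O).
Implicit Types (phi : V) (M : 'I_N -> 'I_N -> {poly K}).

Definition curve M (e : 'I_#|{: O}|) : {poly K} := M (enum_val e).1 (enum_val e).2.

Lemma curveE M i j : curve M (er (i, j)) = M i j.
Proof. by rewrite /curve enum_rankK. Qed.

Local Notation ev M := (mmap polyC (curve M)).

Lemma deriv_curve M (p : {mpoly K[#|{: O}|]}) :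
  (ev M p)^`() = \sum_i \sum_j ev M (p^`M(er (i, j))) * (M i j)^`().
Proof.
rewrite deriv_mmap pair_big /= (reindex (@enum_rank O)) /=; last first.
  by exists enum_val => x _; rewrite ?enum_rankK ?enum_valK.
by apply: eq_bigr => -[i j] _; rewrite curveE.
Qed.

Lemma meval_restrict phi v : (restrict phi).@[v] = (phi set0).@[diag_point v].
Proof.
rewrite /restrict /mmap raddf_sum /= mevalE; apply: eq_bigr => m _.
rewrite mevalM mevalC /mmap1 rmorph_prod; congr (_ * _); apply: eq_bigr => e _.
rewrite rmorphXn /= /diag_point; case: ifP => _; first by rewrite mevalXU.
by rewrite meval0.
Qed.

Lemma adv_even_set0 i j phi : adv ((i, j), false) phi set0 =
  \sum_l 'X_(er (i, l)) * (phi set0)^`M(er (j, l))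
  - \sum_l 'X_(er (l, j)) * (phi set0)^`M(er (l, i)).
Proof.
rewrite /adv !ffunE; congr (_ - _); rewrite sum_ffunE; apply: eq_bigr => l _.
  by rewrite sum_ffunE big_bool /= /mul_letter /der_letter /= !ffunE inE add0r.
rewrite sum_ffunE big_bool /= /mul_letter /der_letter /ksign /= !ffunE inE scaler0 add0r.
by rewrite expr0 scale1r.
Qed.

Lemma ev_adv_even M i j phi : adv ((i, j), false) phi = 0 ->
  \sum_l M i l * ev M ((phi set0)^`M(er (j, l))) =
  \sum_l M l j * ev M ((phi set0)^`M(er (l, i))).
Proof.
move=> inv; have := adv_even_set0 i j phi; rewrite inv ffunE => /esym/eqP.
rewrite subr_eq0 => /eqP/(congr1 (ev M)); rewrite !raddf_sum /= => e.
transitivity (\sum_l ev M ('X_(er (i, l)) * (phi set0)^`M(er (j, l)))).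
  by apply: eq_bigr => l _; rewrite rmorphM /= mmapX mmap1U curveE.
by rewrite e; apply: eq_bigr => l _; rewrite rmorphM /= mmapX mmap1U curveE.
Qed.

Section Transposition.
Variables (i j : 'I_N).
Hypothesis ij : i != j.

(* [phi set0] is constant along t |-> diag(v) + t E_ij, as E_ii rescales E_ij. *)
Lemma invariant_unipotent phi v t u : adv ((i, i), false) phi = 0 ->
  (phi set0).@[fun e => if e == er (i, j) then t else diag_point v e] =
  (phi set0).@[fun e => if e == er (i, j) then u else diag_point v e].
Proof.
move=> inv; pose M a b : {poly K} := if (a == i) && (b == j) then 'X else
  if a == b then (v a)%:P else 0.
have evE x : (ev M (phi set0)).[x] =
    (phi set0).@[fun e => if e == er (i, j) then x else diag_point v e].
  rewrite horner_mmap; apply: meval_eq => e; rewrite -[e]enum_valK (inj_eq enum_rank_inj).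
  case: (enum_val e) => a b; rewrite curveE /M /diag_point enum_rankK xpair_eqE /=.
  by case: ifP => _; rewrite ?hornerX //; case: ifP => _; rewrite ?hornerC ?horner0.
rewrite -!evE; apply: deriv_eq0_horner; rewrite deriv_curve.
have D a b : ev M ((phi set0)^`M(er (a, b))) * (M a b)^`() =
    if (a == i) && (b == j) then ev M ((phi set0)^`M(er (i, j))) else 0.
  rewrite /M; case: ifP => [/andP[/eqP -> /eqP ->]|_]; first by rewrite derivX mulr1.
  by case: ifP => _; rewrite ?derivC ?deriv0 mulr0.
rewrite (bigD1 i) //= (bigD1 j) //= D !eqxx /= !big1 ?addr0; first last.
- by move=> b bj; rewrite D eqxx (negbTE bj).
- by move=> a ai; rewrite big1 // => b _; rewrite D (negbTE ai).
(* Along this curve the equation of F_ii is X times the derivative in the (i, j) direction, and X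
   can be cancelled. *)
have := ev_adv_even M inv.
rewrite (bigD1 i) //= (bigD1 j) 1?eq_sym //= [X in _ + (_ + X)]big1 ?addr0; last first.
  by move=> l /andP[li lj]; rewrite /M (negbTE lj) andbF eq_sym (negbTE li) mul0r.
rewrite [RHS](bigD1 i) //= [X in _ = _ + X]big1 ?addr0; last first.
  by move=> l li; rewrite /M (negbTE li) mul0r.
move/eqP; rewrite eq_sym addrC -subr_eq subrr eq_sym mulf_eq0 => /orP[|/eqP //].
by rewrite /M !eqxx /= polyX_eq0.
Qed.

(* the conjugate of diag(v) + E_ij by 1 + t E_ji has diagonal
   v_i - t, v_j + t and (j, i) entry t (v_i - v_j) - t^2 *)
Lemma invariant_swap phi v : adv ((i, j), false) phi = 0 ->
  (phi set0).@[fun e => if e == er (i, j) then 1 else diag_point v e] =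
  (phi set0).@[fun e => if e == er (i, j) then 1 else diag_point (v \o tperm i j) e].
Proof.
move=> inv; pose M a b : {poly K} :=
  if (a == i) && (b == j) then 1 else
  if (a == j) && (b == i) then (v i - v j) *: 'X - 'X^2 else
  if a == b then (if a == i then (v i)%:P - 'X else if a == j then (v j)%:P + 'X else (v a)%:P)
  else 0.
have ji : j == i = false by rewrite eq_sym (negbTE ij).
have evE x : (ev M (phi set0)).[x] = (phi set0).@[fun e => if e == er (i, j) then 1 else
     if e == er (j, i) then x * (v i - v j - x) else
     diag_point (fun k => if k == i then v i - x else if k == j then v j + x else v k) e].
  rewrite horner_mmap; apply: meval_eq => e; rewrite -[e]enum_valK !(inj_eq enum_rank_inj).
  case: (enum_val e) => a b; rewrite curveE /M /diag_point enum_rankK !xpair_eqE /=.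
  case: ifP => _; first by rewrite hornerC.
  case: ifP => _; first by rewrite !hornerE /=; ring.
  case: ifP => _; last by rewrite horner0.
  by case: ifP => _; [rewrite !hornerE|case: ifP => _; rewrite !hornerE].
have -> : (phi set0).@[fun e => if e == er (i, j) then 1 else diag_point v e] =
    (ev M (phi set0)).[0].
  rewrite evE; apply: meval_eq => e; case: ifP => // _.
  rewrite /diag_point; case: (eqVneq e (er (j, i))) => [->|_].
    by rewrite enum_rankK /= ji mul0r.
  case: ifP => // _; case: ifP => [/eqP ->|_]; first by rewrite subr0.
  by case: ifP => [/eqP ->|_ //]; rewrite addr0.
(* At t = v_i - v_j the (j, i) entry vanishes again and the two diagonal entries are exchanged. *)
have -> : (phi set0).@[fun e => if e == er (i, j) then 1 else diag_point (v \o tperm i j) e] =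
    (ev M (phi set0)).[v i - v j].
  rewrite evE; apply: meval_eq => e; case: ifP => // _.
  rewrite /diag_point; case: (eqVneq e (er (j, i))) => [->|_].
    by rewrite enum_rankK /= ji subrr mulr0.
  case: ifP => // _ /=; case: tpermP => [->|->|/eqP/negbTE-> /eqP/negbTE-> //].
    by rewrite eqxx; ring.
  by rewrite ji eqxx; ring.
apply: deriv_eq0_horner; rewrite deriv_curve.
pose A := ev M ((phi set0)^`M(er (i, i))); pose B := ev M ((phi set0)^`M(er (j, j))).
pose C := ev M ((phi set0)^`M(er (j, i))).
have D0 a b : a != b -> ~~ ((a == j) && (b == i)) -> (M a b)^`() = 0.
  move=> ab nab; rewrite /M (negbTE nab) (negbTE ab).
  by case: ifP => _; rewrite ?derivC ?deriv0.
have D1 a : a != i -> a != j -> (M a a)^`() = 0.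
  by move=> ai aj; rewrite /M (negbTE ai) (negbTE aj) /= eqxx derivC.
have Dii : (M i i)^`() = -1.
  by rewrite /M eqxx (negbTE ij) /= derivB derivC derivX sub0r.
have Djj : (M j j)^`() = 1.
  by rewrite /M eqxx ji /= derivD derivC derivX add0r.
have Dji : (M j i)^`() = (v i - v j)%:P - 'X *+ 2.
  by rewrite /M !eqxx ji /= derivB derivZ derivX derivXn alg_polyC expr1.
rewrite (bigD1 i) //= [X in _ + X](bigD1 j) 1?eq_sym //=.
rewrite [X in _ + (_ + X)]big1 ?addr0; last first.
  move=> a /andP[ai aj]; rewrite big1 // => b _.
  case: (eqVneq a b) => [<-|ab]; first by rewrite D1 ?mulr0.
  by rewrite D0 ?mulr0 // (negbTE aj).
rewrite (bigD1 i) //= big1 ?addr0; last first.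
  by move=> b bi; rewrite (D0 i b) ?mulr0 ?(negbTE ij) // eq_sym.
rewrite [X in _ + X](bigD1 i) //= [X in _ + (_ + X)](bigD1 j) 1?eq_sym //= big1 ?addr0; last first.
  by move=> b /andP[bi bj]; rewrite (D0 j b) ?mulr0 ?(negbTE bi) ?andbF // eq_sym.
rewrite Dii Djj Dji -/A -/B -/C.
(* The equation of F_ij reads B - A = (M_jj - M_ii) C, while the derivative along the curve is B - A
   + (M_ii - M_jj) C. *)
have := ev_adv_even M inv.
rewrite (bigD1 i) //= (bigD1 j) 1?eq_sym //= [X in _ + (_ + X) = _]big1 ?addr0; last first.
  by move=> l /andP[li lj]; rewrite /M (negbTE lj) andbF (negbTE ij) /= eq_sym (negbTE li) mul0r.
rewrite [RHS](bigD1 i) //= [X in _ = _ + X](bigD1 j) 1?eq_sym //=.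
rewrite [X in _ = _ + (_ + X)]big1 ?addr0; last first.
  by move=> l /andP[li lj]; rewrite /M (negbTE li) (negbTE lj) /= mul0r.
have -> : M i i = (v i)%:P - 'X by rewrite /M !eqxx (negbTE ij).
have -> : M j j = (v j)%:P + 'X by rewrite /M !eqxx ji.
have -> : M i j = 1 by rewrite /M !eqxx.
rewrite -/A -/B -/C !mul1r => e.
have {e} eB : B = A + ((v j)%:P + 'X) * C - ((v i)%:P - 'X) * C by rewrite -e; ring.
by rewrite eB polyCB; ring.
Qed.

End Transposition.

(** The (i, j) entry is raised from 0 to 1 by [invariant_unipotent], the diagonal entries are
    exchanged by [invariant_swap], and the (i, j) entry is lowered again. *)
Lemma restrict_tperm phi i j v : (forall g, adv g phi = 0) ->
  (restrict phi).@[v \o tperm i j] = (restrict phi).@[v].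
Proof.
move=> inv; case: (eqVneq i j) => [->|ij].
  by apply: meval_eq => k /=; rewrite tperm1 perm1.
rewrite !meval_restrict.
have uni w : (phi set0).@[diag_point w] =
    (phi set0).@[fun e => if e == er (i, j) then 1 else diag_point w e].
  rewrite -(invariant_unipotent ij w 0 1 (inv _)); apply: meval_eq => e.
  by case: eqP => // ->; rewrite /diag_point enum_rankK /= (negbTE ij).
by rewrite !uni -invariant_swap.
Qed.

Lemma restrict_perm phi (s : 'S_N) v : (forall g, adv g phi = 0) ->
  (restrict phi).@[v \o s] = (restrict phi).@[v].
Proof.
move=> inv; have [ts -> _] := prod_tpermP s.
elim: ts v => [|[i j] ts IH] v.
  by apply: meval_eq => k; rewrite /= big_nil perm1.
rewrite big_cons /= -[RHS]IH -[RHS](restrict_tperm i j _ inv).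
by apply: meval_eq => k /=; rewrite permM.
Qed.

(** The equation of F_(i,-j) is read at the exterior monomial {(i, j)} along the diagonal curve x_i
    = t, x_j = -t. The derivative along F_(j,-i) enters with the factor x_i + x_j = 0, so the
    derivatives in x_ii and x_jj agree; their difference is the derivative along the curve. *)
Lemma restrict_flip phi i j v t : (forall g, adv g phi = 0) -> i != j ->
  (restrict phi).@[flip v i j t] = (restrict phi).@[flip v i j 0].
Proof.
move=> inv ij; have ji : j == i = false by rewrite eq_sym (negbTE ij).
pose w k : {poly K} := if k == i then 'X else if k == j then - 'X else (v k)%:P.
pose M a b : {poly K} := if a == b then w a else 0.
have evE x : (ev M (phi set0)).[x] = (restrict phi).@[flip v i j x].
  rewrite meval_restrict horner_mmap; apply: meval_eq => e.
  rewrite /curve /M /diag_point /flip /w; case: ifP => _; last by rewrite horner0.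
  by case: ifP => _; rewrite ?hornerX //; case: ifP => _; rewrite ?hornerC // hornerN hornerX.
rewrite -!evE; apply: deriv_eq0_horner; rewrite deriv_curve.
have D a b : (M a b)^`() = if a == b then (if a == i then 1 else if a == j then -1 else 0) else 0.
  rewrite /M /w; case: ifP => _; last by rewrite deriv0.
  case: ifP => _; first by rewrite derivX.
  by case: ifP => _; rewrite ?derivN ?derivX ?derivC.
transitivity (ev M ((phi set0)^`M(er (i, i))) - ev M ((phi set0)^`M(er (j, j)))).
  rewrite (bigD1 i) //= [X in _ + X](bigD1 j) 1?eq_sym //= [X in _ + (_ + X)]big1 ?addr0; last first.
    move=> a /andP[ai aj]; rewrite big1 // => b _.
    by rewrite D (negbTE ai) (negbTE aj) if_same mulr0.
  rewrite (bigD1 i) //= big1 ?addr0 => [|b bi]; last by rewrite D eq_sym (negbTE bi) mulr0.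
  rewrite [X in _ + X](bigD1 j) //= big1 ?addr0 => [|b bj]; last by rewrite D eq_sym (negbTE bj) mulr0.
  by rewrite !D !eqxx ji mulr1 mulrN1.
pose chi psi := ev M ((psi : V) [set (i, j)]).
pose pi psi := ev M ((psi : V) set0).
have chiE a b psi : chi (mul_letter ((a, b), false) psi) = if a == b then w a * chi psi else 0.
  rewrite /chi /mul_letter ffunE rmorphM /= mmapX mmap1U curveE /M.
  by case: ifP => // _; rewrite mul0r.
have chiO a b psi : chi (mul_letter ((a, b), true) psi) = if (a == i) && (b == j) then pi psi else 0.
  rewrite /chi /mul_letter ffunE inE xpair_eqE /=; case: ifP => [/andP[/eqP -> /eqP ->]|_]; last exact: mmap0.
  rewrite /jw_sign big1 ?scale1r => [|o /andP[/set1P -> ]]; last by rewrite beforexx.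
  by rewrite setDv.
have chi_sum (F : 'I_N -> bool -> V) : chi (\sum_l \sum_t F l t) = \sum_l \sum_t chi (F l t).
  rewrite /chi sum_ffunE raddf_sum; apply: eq_bigr => l _ /=.
  by rewrite sum_ffunE raddf_sum.
have chiL : chi (lder ((i, j), true) phi) =
    w i * chi (der_letter ((j, i), true) phi) + pi (der_letter ((j, j), false) phi).
  rewrite chi_sum; under eq_bigr do rewrite big_bool /= chiE chiO eqxx /=.
  rewrite big_split /= -!big_mkcond /= (big_pred1 i) 1?eq_sym // (big_pred1 j) //.
have chiZ c psi : chi (c *: psi) = c%:P * chi psi by rewrite /chi ffunE mmapZ.
have chiR : chi (rder ((i, j), true) phi) =
    - (w j * chi (der_letter ((j, i), true) phi)) + pi (der_letter ((i, i), false) phi).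
  rewrite chi_sum; under eq_bigr do rewrite big_bool /= !chiZ chiE chiO eqxx andbT /=.
  rewrite big_split /= /ksign /= expr0 expr1 -!mulr_sumr -!big_mkcond /= (big_pred1 j) // (big_pred1 i) //.
  by rewrite polyCN !polyC1 mulN1r mul1r.
have : chi (adv ((i, j), true) phi) = 0 by rewrite inv /chi ffunE mmap0.
have -> : chi (adv ((i, j), true) phi) = chi (lder ((i, j), true) phi) - chi (rder ((i, j), true) phi).
  by rewrite /chi /adv !ffunE mmapB.
have -> : ev M ((phi set0)^`M(er (i, i))) = pi (der_letter ((i, i), false) phi).
  by rewrite /pi /der_letter ffunE.
have -> : ev M ((phi set0)^`M(er (j, j))) = pi (der_letter ((j, j), false) phi).
  by rewrite /pi /der_letter ffunE.
rewrite chiL chiR {1 2}/w eqxx ji eqxx => e.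
by rewrite -[RHS]oppr0 -[in RHS]e; ring.
Qed.

Theorem restrict_supersymmetric phi :
  (forall g, adv g phi = 0) -> supersymmetric (restrict phi).
Proof.
move=> inv; split=> [s v|i j v t ij]; first exact: restrict_perm.
exact: restrict_flip.
Qed.

End RestrictSupersymmetric.

(** * The action of the enveloping algebra *)

Lemma sign_scale (K : fieldType) (A : lalgType K) (b : bool) (u : A) :
  (-1) ^+ b * u = (-1) ^+ b *: u.
Proof. by case: b; rewrite ?expr0 ?scale1r ?mul1r ?expr1 ?scaleN1r ?mulN1r. Qed.

Section UniversalAction.
Import monalg finmap.

Variables (K : fieldType) (g : lmodType K).
Variables (hom : bool -> g -> Prop) (br : bool -> bool -> g -> g -> g).
Variables (V : lmodType K) (rho : g -> V -> V).
Hypothesis rho_linear : forall x, linear (rho x).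
Hypothesis rho_linear_l : forall a x y v, rho (a *: x + y) v = a *: rho x v + rho y v.
Hypothesis rho_br : forall p q x y v, hom p x -> hom q y ->
  rho x (rho y v) - (-1) ^+ (p && q) *: rho y (rho x v) = rho (br p q x y) v.

Local Notation fm := (fmonom g).
Local Notation free := (free_alg g).

Definition mon_act (m : fm) (v : V) : V := foldr rho v (fmonom_val m).

Lemma mon_act_linear m : linear (mon_act m).
Proof.
move=> a u v; rewrite /mon_act; elim: (fmonom_val m) => //= x s ->.
exact: rho_linear.
Qed.

Lemma mon_actM (m1 m2 : fm) v : mon_act (mmul m1 m2) v = mon_act m1 (mon_act m2 v).
Proof. by rewrite /mon_act fmM foldr_cat. Qed.

Definition free_act (u : free) (v : V) : V :=
  \sum_(m <- msupp u) mcoeff m u *: mon_act m v.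

Lemma free_act_wide (d : {fset fm}) (u : free) v :
  fsubset (msupp u) d ->
  free_act u v = \sum_(m <- d) mcoeff m u *: mon_act m v.
Proof.
move=> le; rewrite [LHS](big_fset_incl _ le) => //= x xd /mcoeff_outdom ->.
by rewrite scale0r.
Qed.

Lemma free_act_linear_l a u w v : free_act (a *: u + w) v = a *: free_act u v + free_act w v.
Proof.
pose E := fsetU (msupp (a *: u + w)) (fsetU (msupp u) (msupp w)).
rewrite !(@free_act_wide E) ?fsubsetUl //; first last.
- by rewrite /E fsetUCA fsubsetUl.
- by rewrite /E fsetUA fsetUC fsubsetUl.
rewrite scaler_sumr -big_split /=; apply: eq_bigr => m _.
by rewrite mcoeffD mcoeffZ scalerDl scalerA.
Qed.

Lemma free_actU c m v : free_act (mkmalgU m c) v = c *: mon_act m v.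
Proof. by rewrite (free_act_wide _ msuppU_le) big_seq_fset1 mcoeffUU. Qed.

Lemma free_act0 v : free_act 0 v = 0.
Proof.
by have := free_act_linear_l (-1) 0 0 v; rewrite scaler0 addr0 scaleN1r addNr.
Qed.

Lemma free_actD u w v : free_act (u + w) v = free_act u v + free_act w v.
Proof. by have := free_act_linear_l 1 u w v; rewrite !scale1r. Qed.

Lemma free_actZ a u v : free_act (a *: u) v = a *: free_act u v.
Proof. by have := free_act_linear_l a u 0 v; rewrite free_act0 !addr0. Qed.

Lemma free_actB u w v : free_act (u - w) v = free_act u v - free_act w v.
Proof. by rewrite -!scaleN1r free_actD free_actZ. Qed.

Lemma free_act_sum (I : Type) (r : seq I) (P : pred I) (F : I -> free) v :
  free_act (\sum_(i <- r | P i) F i) v = \sum_(i <- r | P i) free_act (F i) v.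
Proof. by apply: (big_morph (free_act^~ v)) => [u w|]; [exact: free_actD|exact: free_act0]. Qed.

Lemma mon_act0 m : mon_act m 0 = 0.
Proof. by have := mon_act_linear m (-1) 0 0; rewrite scaler0 addr0 scaleN1r addNr. Qed.

Lemma mon_actD m v w : mon_act m (v + w) = mon_act m v + mon_act m w.
Proof. by have := mon_act_linear m 1 v w; rewrite !scale1r. Qed.

Lemma mon_actZ m a v : mon_act m (a *: v) = a *: mon_act m v.
Proof. by have := mon_act_linear m a v 0; rewrite mon_act0 !addr0. Qed.

Lemma free_actM (u w : free) v : free_act (u * w) v = free_act u (free_act w v).
Proof.
rewrite malgME free_act_sum; apply: eq_bigr => m1 _.
rewrite free_act_sum (big_morph (mon_act m1) (mon_actD m1) (mon_act0 m1)) scaler_sumr.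
apply: eq_bigr => m2 _; rewrite free_actU mon_actM mon_actZ scalerA.
by [].
Qed.

Lemma free_act_gen x v : free_act (free_gen x) v = rho x v.
Proof. by rewrite free_actU scale1r /mon_act fmU. Qed.

Lemma free_act1 v : free_act 1 v = v.
Proof. by rewrite free_actU scale1r /mon_act fm1. Qed.

Lemma free_act_ideal u v : uea_ideal hom br u -> free_act u v = 0.
Proof.
move=> Iu; elim: Iu v => {u} [a x y|p q x y hx hy||u w _ IHu _ IHw|u w t _ IHw] v.
- by rewrite free_actB free_act_linear_l !free_act_gen rho_linear_l subrr.
- have e1 : free_act (free_gen x * free_gen y) v = rho x (rho y v).
    by apply: etrans (free_actM _ _ _) _; rewrite !free_act_gen.
  have e2 : free_act ((-1) ^+ (p && q) * (free_gen y * free_gen x)) v =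
      (-1) ^+ (p && q) *: rho y (rho x v).
    rewrite sign_scale; apply: etrans (free_actZ _ _ _) _; congr (_ *: _).
    by apply: etrans (free_actM _ _ _) _; rewrite !free_act_gen.
  apply: etrans (free_actB _ _ _) _; apply/eqP; rewrite subr_eq0; apply/eqP.
  apply: etrans (free_actB _ _ _) (etrans _ (esym (free_act_gen _ _))).
  exact: etrans (congr2 (fun a b => a - b) e1 e2) (rho_br _ hx hy).
- exact: free_act0.
- by rewrite free_actD IHu IHw addr0.
- rewrite !free_actM IHw.
  by rewrite -(free_act0 0) -free_actM mulr0 free_act0.
Qed.

Definition uea_act (z : uea hom br) (v : V) : V := free_act (uea_repr z) v.

Lemma free_act_pi (u w : free) v :
  uea_pi hom br u = uea_pi hom br w -> free_act u v = free_act w v.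
Proof.
by move=> /uea_pi_eq/(@free_act_ideal _ v); rewrite free_actB => /eqP; rewrite subr_eq0 => /eqP.
Qed.

Lemma uea_act_linear_l a y z v : uea_act (a *: y + z) v = a *: uea_act y v + uea_act z v.
Proof.
rewrite /uea_act -free_act_linear_l; apply: free_act_pi.
by rewrite uea_reprK (linearP (uea_pi hom br) a (uea_repr y) (uea_repr z)) /= !uea_reprK.
Qed.

Lemma uea_act1 v : uea_act 1 v = v.
Proof.
transitivity (free_act 1 v); last exact: free_act1.
by apply: free_act_pi; rewrite uea_reprK.
Qed.

Lemma uea_act_gen x (y : uea hom br) v : uea_act (uea_gen hom br x * y) v = rho x (uea_act y v).
Proof.
rewrite -free_act_gen /uea_act -free_actM; apply: free_act_pi.
by rewrite uea_reprK (rmorphM (uea_pi hom br)) /= uea_reprK.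
Qed.

End UniversalAction.

Section UniversalInduction.
Import monalg finmap.

Variables (K : fieldType) (g : lmodType K).
Variables (hom : bool -> g -> Prop) (br : bool -> bool -> g -> g -> g).
Local Notation U := (uea hom br).

Lemma uea_ind_gen (P : U -> Prop) : P 1 -> (forall u v, P u -> P v -> P (u + v)) ->
  (forall (a : K) u, P u -> P (a *: u)) -> (forall x u, P u -> P (uea_gen hom br x * u)) ->
  forall u, P u.
Proof.
move=> P1 PD PZ PX u; rewrite -[u]uea_reprK [uea_repr u]monalgE.
pose pi := uea_pi hom br; have eqPP y z : y = z -> P z -> P y by move=> ->.
have P0 : P 0 by rewrite -(scale0r (1 : U)); exact: PZ.
rewrite (raddf_sum (uea_pi hom br)); apply: (big_ind P) => // m _.
have cU c : mkmalgU m c = c *: (mkmalgU m 1 : free_alg g).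
  by apply/malgP => k; rewrite mcoeffZ !mcoeffU mulr_natr.
suff Pm : P (uea_pi hom br (mkmalgU m 1)).
  apply: eqPP (etrans (congr1 pi (cU _)) (linearZZ pi _ _)) _.
  exact: PZ.
case: m {cU} => s; elim: s => [|x s IH].
  have -> : mkmalgU (FMonom [::]) 1 = 1 :> free_alg g by rewrite -fmoneE.
  exact: P1.
have -> : mkmalgU (FMonom (x :: s)) 1 = free_gen x * mkmalgU (FMonom s) 1 :> free_alg g.
  apply/esym; apply: etrans (fgmulUU _ _ _ _) _.
  by rewrite mulr1 /mmul /mul /= fmmulE fmuE.
apply: eqPP (rmorphM pi _ _) _; exact: PX.
Qed.

End UniversalInduction.

(** * The basis of q_N and the action of U(q_N) on superpolynomials *)

Section Basis.
Variables (K : numFieldType) (N : nat).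
Local Notation qN := (qN K N).
Local Notation U := (U_q K N).
Local Notation V := (fock K ('I_N * 'I_N)%type).
Local Notation letter := (qletter N).
Implicit Types (g h : letter) (x y : qN).
Local Arguments unsplit : simpl never.

Definition col_idx g : sidx N := if g.2 then neg (pos g.1.2) else pos g.1.2.
Definition mxF g : 'M[K]_(N + N) := gl_F K (pos g.1.1) (col_idx g).
Definition eF g : qN := vsproj (qspace K N) (mxF g).
Definition UF g : U := U_gen (eF g).
(** A matrix of q_N is determined by its rows of positive index, since its (-i, -j) and (i, j)
    entries are equal; the coordinates are read there. *)
Definition qcoord x g : K := vsval x (unsplit (pos g.1.1)) (unsplit (col_idx g)).

Lemma vsval_eF g : vsval (eF g) = mxF g.
Proof. by rewrite vsprojK ?gl_F_in. Qed.

Lemma mxF_pos g (k : 'I_N) (l : sidx N) :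
  mxF g (unsplit (pos k)) (unsplit l) = ((k == g.1.1) && (l == col_idx g))%:R.
Proof. by rewrite gl_FE /= addr0. Qed.

Lemma col_idx_inj (i j : 'I_N) b i' j' b' :
  (col_idx ((i, j), b) == col_idx ((i', j'), b')) = ((j, b) == (j', b')).
Proof. by case: b b' => [] []; rewrite xpair_eqE ?andbT ?andbF. Qed.

Lemma qcoord_eF g h : qcoord (eF g) h = (h == g)%:R.
Proof.
rewrite /qcoord vsval_eF mxF_pos; case: g h => [[i j] b] [[k l] c].
by rewrite col_idx_inj !xpair_eqE andbA.
Qed.

Lemma qcoord_linear g a x y : qcoord (a *: x + y) g = a * qcoord x g + qcoord y g.
Proof. by rewrite /qcoord linearP !mxE. Qed.

Lemma qN_ext x y : (forall g, qcoord x g = qcoord y g) -> x = y.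
Proof.
move=> xy; apply/subvs_inj/matrixP => k l; rewrite -[k]splitK -[l]splitK.
move: (split k) (split l) => {}k {}l.
have {}xy (a : 'I_N) (j : sidx N) :
    vsval x (unsplit (pos a)) (unsplit j) = vsval y (unsplit (pos a)) (unsplit j).
  by case: j => b; [exact: (xy ((a, b), false))|exact: (xy ((a, b), true))].
case: k => k; first exact: xy.
have /qspaceP qx := subvsP x; have /qspaceP qy := subvsP y.
by rewrite -[LHS]qx -[RHS]qy; exact: xy.
Qed.

Lemma qcoord_sum (I : Type) (r : seq I) (P : pred I) (F : I -> qN) g :
  qcoord (\sum_(i <- r | P i) F i) g = \sum_(i <- r | P i) qcoord (F i) g.
Proof.
apply: (big_morph (qcoord^~ g)) => [x y|].
  by rewrite -[x in LHS]scale1r qcoord_linear mul1r.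
by rewrite /qcoord linear0 mxE.
Qed.

Lemma qcoordZ a x g : qcoord (a *: x) g = a * qcoord x g.
Proof. by rewrite /qcoord linearZ mxE. Qed.

Lemma eF_sum x : x = \sum_g qcoord x g *: eF g.
Proof.
apply: qN_ext => g; rewrite qcoord_sum (bigD1 g) //= qcoordZ qcoord_eF eqxx mulr1.
rewrite big1 ?addr0 // => h hg.
by rewrite qcoordZ qcoord_eF eq_sym (negbTE hg) mulr0.
Qed.

Lemma qcoord_hom p x g : q_hom p x -> g.2 != p -> qcoord x g = 0.
Proof.
by move=> hx gp; apply: hx; case: g gp => [[i j] []].
Qed.

Lemma eF_hom g : q_hom g.2 (eF g).
Proof.
rewrite /q_hom vsval_eF => i j; rewrite gl_FE /col_idx.
case: g => [[a b] []]; case: i => i; case: j => j //= _;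
  by rewrite ?andbF ?addr0.
Qed.

Lemma mxF_mul g h : mxF g *m mxF h = (qmatch g h)%:R *: mxF (qprod g h).
Proof.
have EE (i j k l : sidx N) : gl_E K i j *m gl_E K k l = (j == k)%:R *: gl_E K i l.
  by rewrite mul_delta_mx_cond (inj_eq (@unsplit_inj N)); case: eqP => _; rewrite ?scale1r ?scale0r ?mulr1n ?mulr0n.
rewrite /mxF /gl_F !mulmxDl !mulmxDr !EE /qmatch /col_idx /qprod.
case: g h => [[i j] b] [[k l] c]; case: b c => [] [] /=;
  rewrite ?[inl _ == inr _](_ : _ = false) ?[inr _ == inl _](_ : _ = false) //
    ?(inj_eq (@inl_inj _ _)) ?(inj_eq (@inr_inj _ _)) ?scale0r ?addr0 ?add0r -?scalerDr //;
  by rewrite addrC.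
Qed.

Lemma q_br_eF g h : q_br g.2 h.2 (eF g) (eF h) = qbracket eF g h.
Proof.
apply: subvs_inj; rewrite q_brE /gl_br !vsval_eF !mxF_mul /qbracket /ksign.
by rewrite linearB !linearZ /= !vsval_eF.
Qed.

Definition rhoq x (phi : V) : V := \sum_g qcoord x g *: rho_letter g phi.

Lemma rhoq_linear x : linear (rhoq x).
Proof.
move=> a u v; rewrite /rhoq scaler_sumr -big_split /=; apply: eq_bigr => g _.
by rewrite rho_letter_linear scalerDr !scalerA mulrC.
Qed.

Lemma rhoq_linear_l a x y v : rhoq (a *: x + y) v = a *: rhoq x v + rhoq y v.
Proof.
rewrite /rhoq scaler_sumr -big_split /=; apply: eq_bigr => g _.
by rewrite qcoord_linear scalerDl scalerA.
Qed.

Lemma rhoq_eF g v : rhoq (eF g) v = rho_letter g v.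
Proof.
rewrite /rhoq (bigD1 g) //= qcoord_eF eqxx scale1r big1 ?addr0 // => h hg.
by rewrite qcoord_eF (negbTE hg) scale0r.
Qed.

Lemma rhoqZ a x v : rhoq (a *: x) v = a *: rhoq x v.
Proof.
rewrite /rhoq scaler_sumr; apply: eq_bigr => g _.
by rewrite qcoordZ scalerA.
Qed.

Lemma rhoqB x y v : rhoq (x - y) v = rhoq x v - rhoq y v.
Proof. by rewrite addrC -scaleN1r rhoq_linear_l scaleN1r addrC. Qed.

Lemma rhoq_sum (I : Type) (r : seq I) (P : pred I) (F : I -> qN) v :
  rhoq (\sum_(i <- r | P i) F i) v = \sum_(i <- r | P i) rhoq (F i) v.
Proof.
apply: (big_morph (rhoq^~ v)) => [x y|].
  by rewrite -[x in LHS]scale1r rhoq_linear_l scale1r.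
by rewrite -[0](scale0r (0 : qN)) rhoqZ scale0r.
Qed.

Lemma q_br_sum p q x y :
  q_br p q x y = \sum_g \sum_h (qcoord x g * qcoord y h) *: q_br p q (eF g) (eF h).
Proof.
have vs z : vsval z = \sum_g qcoord z g *: mxF g.
  rewrite {1}[z]eF_sum linear_sum; apply: eq_bigr => g _.
  by rewrite linearZ /= vsval_eF.
have mulE z z' : vsval z *m vsval z' =
    \sum_g \sum_h (qcoord z g * qcoord z' h) *: (mxF g *m mxF h).
  rewrite (vs z) (vs z') mulmx_suml; apply: eq_bigr => g _.
  rewrite mulmx_sumr; apply: eq_bigr => h _.
  by rewrite -scalemxAl -scalemxAr scalerA.
apply: subvs_inj; rewrite q_brE /gl_br !mulE [X in _ - _ *: X]exchange_big /=.
rewrite scaler_sumr -sumrB linear_sum; apply: eq_bigr => g _.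
rewrite scaler_sumr -sumrB linear_sum; apply: eq_bigr => h _.
rewrite [RHS]linearZ /= q_brE /gl_br !vsval_eF scalerBr !scalerA.
by congr (_ - _ *: _); rewrite mulrC [qcoord y h * _]mulrC.
Qed.

Lemma rhoq_br p q x y v : q_hom p x -> q_hom q y ->
  rhoq x (rhoq y v) - (-1) ^+ (p && q) *: rhoq y (rhoq x v) = rhoq (q_br p q x y) v.
Proof.
move=> hx hy; rewrite q_br_sum rhoq_sum.
have -> : rhoq x (rhoq y v) = \sum_g \sum_h (qcoord x g * qcoord y h) *: rho_letter g (rho_letter h v).
  apply: eq_bigr => g _; rewrite linear_sum scaler_sumr; apply: eq_bigr => h _.
  by rewrite linearZ scalerA.
have -> : rhoq y (rhoq x v) = \sum_g \sum_h (qcoord x g * qcoord y h) *: rho_letter h (rho_letter g v).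
  rewrite exchange_big; apply: eq_bigr => h _; rewrite linear_sum scaler_sumr; apply: eq_bigr => g _.
  by rewrite linearZ scalerA mulrC.
rewrite scaler_sumr -sumrB; apply: eq_bigr => g _.
rewrite rhoq_sum scaler_sumr -sumrB; apply: eq_bigr => h _.
have scC (s c : K) (A B : V) : c *: A - s *: (c *: B) = c *: (A - s *: B).
  by rewrite scalerBr !scalerA mulrC.
(* By homogeneity only letters of parity p in x and q in y contribute, so the given sign is the
   Koszul sign of the letters. *)
rewrite rhoqZ scC; have [gp|/(qcoord_hom hx) ->] := eqVneq g.2 p; last first.
  by rewrite mul0r !scale0r.
have [hq|/(qcoord_hom hy) ->] := eqVneq h.2 q; last by rewrite mulr0 !scale0r.
congr (_ *: _); rewrite -gp -hq.
rewrite q_br_eF /qbracket rhoqB !rhoqZ !rhoq_eF -[(-1) ^+ _]/(ksign K g.2 h.2).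
by rewrite rho_letter_comm.
Qed.

Definition pbw (u : U) : V := uea_act rhoq u (vac K _).

Lemma pbw_linear : linear pbw.
Proof. by move=> a u v; exact: uea_act_linear_l rhoq_linear rhoq_linear_l rhoq_br _ _ _ _. Qed.
HB.instance Definition _ := GRing.isLinear.Build K U V *:%R pbw pbw_linear.

Lemma pbw1 : pbw 1 = vac K _.
Proof. exact: uea_act1 rhoq_linear rhoq_linear_l rhoq_br _. Qed.

Lemma pbw_UF g u : pbw (UF g * u) = rho_letter g (pbw u).
Proof. by rewrite -rhoq_eF; exact: uea_act_gen rhoq_linear rhoq_linear_l rhoq_br _ _ _. Qed.

Lemma U_gen_linear : linear (@U_gen K N).
Proof.
move=> a x y; have /uea_pi_eq e := uea_ideal_lin (@q_hom K N) (@q_br K N) a x y.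
exact: etrans e (linearP (uea_pi _ _) _ _ _).
Qed.
HB.instance Definition _ := GRing.isLinear.Build K qN U *:%R (@U_gen K N) U_gen_linear.

Lemma U_gen_sum x : U_gen x = \sum_g qcoord x g *: UF g.
Proof.
rewrite {1}[x]eF_sum (raddf_sum (@U_gen K N)) /=.
by apply: eq_bigr => g _; exact: (linearZZ (@U_gen K N)).
Qed.

Lemma UF_br g h : UF g * UF h - ksign K g.2 h.2 *: (UF h * UF g) = qbracket UF g h.
Proof.
have -> : qbracket UF g h = U_gen (q_br g.2 h.2 (eF g) (eF h)).
  have gZ a x : U_gen (a *: x) = a *: U_gen x by exact: (linearZZ (@U_gen K N)).
  rewrite q_br_eF; apply/esym; apply: etrans (linearB (@U_gen K N) _ _) _.
  by congr (_ - _); rewrite /= !gZ.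
have /uea_pi_eq e := uea_ideal_br (@q_br K N) (@eF_hom g) (@eF_hom h).
pose pi := uea_pi (@q_hom K N) (@q_br K N).
have piM x y : pi (free_gen x * free_gen y) = U_gen x * U_gen y by exact: (rmorphM pi).
have e1 : pi ((-1) ^+ (g.2 && h.2) * (free_gen (eF h) * free_gen (eF g))) =
    ksign K g.2 h.2 *: (UF h * UF g).
  by rewrite sign_scale; apply: etrans (linearZZ pi _ _) _; rewrite [X in _ *: X = _]piM.
have e2 : pi (free_gen (eF g) * free_gen (eF h)
              - (-1) ^+ (g.2 && h.2) * (free_gen (eF h) * free_gen (eF g))) =
    UF g * UF h - ksign K g.2 h.2 *: (UF h * UF g).
  exact: etrans (raddfB pi _ _) (congr2 (fun a b => a - b) (piM _ _) e1).
exact: etrans (esym e2) e.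
Qed.

Lemma UF_hom g : @uea_hom K qN (@q_hom K N) (@q_br K N) g.2 (UF g).
Proof. by apply: uea_hom_gen; exact: eF_hom. Qed.

End Basis.

(** * Straightening *)

Section Span.
Variables (K : numFieldType) (N : nat) (A : algType K) (X : qletter N -> A).
Local Notation letter := (qletter N).
Local Notation V := (fock K ('I_N * 'I_N)%type).
Implicit Types (g h : letter) (w : seq letter) (u v : A) (P Q : seq letter -> Prop).

(** The algebra is abstract here: only the bracket relations and, later, a linear map to
    superpolynomials are assumed of it. *)
Definition word w : A := foldr (fun g u => X g * u) 1 w.

Lemma word_cat w1 w2 : word (w1 ++ w2) = word w1 * word w2.
Proof. by elim: w1 => [|g w1 IH] /=; rewrite ?mul1r // IH mulrA. Qed.

(** Indexing by a property of words carries parity, length and shape through linear combinations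
    together. *)
Inductive span P : A -> Prop :=
| span0 : span P 0
| span_cons c w u : P w -> span P u -> span P (c *: word w + u).

Lemma spanW P Q u : (forall w, P w -> Q w) -> span P u -> span Q u.
Proof. by move=> PQ; elim=> [|c w v Pw _ IH]; [exact: span0|apply: span_cons => //; exact: PQ]. Qed.

Lemma span_word P w : P w -> span P (word w).
Proof. by move=> Pw; rewrite -[word w]scale1r -[_ *: _]addr0; apply: span_cons => //; exact: span0. Qed.

Lemma spanD P u v : span P u -> span P v -> span P (u + v).
Proof. by elim=> [|c w x Pw _ IH] sv; rewrite ?add0r // -addrA; apply: span_cons => //; exact: IH. Qed.

Lemma spanZ P a u : span P u -> span P (a *: u).
Proof.
elim=> [|c w x Pw _ IH]; first by rewrite scaler0; exact: span0.
by rewrite scalerDr scalerA; apply: span_cons.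
Qed.

Lemma spanB P u v : span P u -> span P v -> span P (u - v).
Proof. by move=> su sv; apply: spanD => //; rewrite -scaleN1r; exact: spanZ. Qed.

Lemma span_sum P (I : Type) (r : seq I) (R : pred I) (F : I -> A) :
  (forall i, R i -> span P (F i)) -> span P (\sum_(i <- r | R i) F i).
Proof. by move=> sF; apply: big_ind => //; [exact: span0|exact: spanD]. Qed.

Lemma spanM P Q R u v : (forall w w', P w -> Q w' -> R (w ++ w')) ->
  span P u -> span Q v -> span R (u * v).
Proof.
move=> PQR su sv; elim: su => [|c w x Pw _ IH]; first by rewrite mul0r; exact: span0.
rewrite mulrDl -scalerAl; apply: spanD => //; apply: spanZ.
elim: sv => [|c' w' x' Qw' _ IH']; first by rewrite mulr0; exact: span0.
by rewrite mulrDr -scalerAr -word_cat; apply: span_cons => //; exact: PQR.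
Qed.

Definition parity w : bool := foldr (fun g b => g.2 (+) b) false w.

Lemma parity_cat w1 w2 : parity (w1 ++ w2) = parity w1 (+) parity w2.
Proof. by elim: w1 => //= g w1 ->; rewrite addbA. Qed.

(* the triangular block of a letter: n_-, h, n_+ *)
Definition block g : nat :=
  if (g.1.2 < g.1.1)%N then 0%N else if g.1.1 == g.1.2 then 1%N else 2%N.

(** The block is the leading digit, so an ordered word is triangular: n_-, then h, then n_+. *)
Definition rank g : nat := (block g * #|{: letter}| + enum_rank g)%N.

Lemma rank_inj : injective rank.
Proof.
move=> g h e; apply/enum_rank_inj/val_inj.
have := congr1 (modn^~ #|{: letter}|) e.
by rewrite /rank !modnMDl !modn_small.
Qed.

Lemma rank_block g h : (rank g <= rank h)%N -> (block g <= block h)%N.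
Proof.
rewrite /rank; apply: contraTT; rewrite -!ltnNge => lt.
apply: leq_trans (leq_addr _ _); apply: leq_trans (_ : (block h).+1 * #|{: letter}| <= _)%N.
  by rewrite mulSn addnC ltn_add2r.
by rewrite leq_mul2r lt orbT.
Qed.

(** Odd letters are not repeated, because the square of an odd letter is half its superbracket with
    itself. *)
Definition pbw_rel g h : bool := (rank g < rank h)%N || ((g == h) && ~~ g.2).

Lemma pbw_rel_trans : transitive pbw_rel.
Proof.
move=> h g k /orP[gh|/andP[/eqP -> hh]] /orP[hk|/andP[/eqP <- ko]].
- by rewrite /pbw_rel (ltn_trans gh hk).
- by rewrite /pbw_rel gh.
- by rewrite /pbw_rel hk.
- by rewrite /pbw_rel eqxx hh orbT.
Qed.

Lemma pbw_rel_le g h : pbw_rel g h -> (rank g <= rank h)%N.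
Proof. by case/orP => [/ltnW //|/andP[/eqP ->]]. Qed.

Definition standard w : bool := sorted pbw_rel w.

Lemma standard_count w o : standard w -> (count_mem (o, true) w <= 1)%N.
Proof.
rewrite /standard; elim: w => //= g w IH pw.
have sw : sorted pbw_rel w by exact: path_sorted pw.
case: (eqVneq g (o, true)) => [eg|_]; last by rewrite add0n IH.
have /allP ow := order_path_min pbw_rel_trans pw.
rewrite (count_memPn _) // ; apply/negP => /ow; rewrite eg.
by rewrite /pbw_rel ltnn eqxx.
Qed.

Lemma standard_eq w w' : standard w -> standard w' -> perm_eq w w' -> w = w'.
Proof.
have st s : standard s -> sorted (fun g h => rank g <= rank h)%N s.
  by apply: sub_sorted => g h; exact: pbw_rel_le.
move=> /st sw /st sw'; apply: (@sorted_eq _ (fun g h => rank g <= rank h)%N) => //.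
  by move=> g h k; exact: leq_trans.
by move=> g h; rewrite -eqn_leq => /eqP/rank_inj.
Qed.

Lemma standard_block w : standard w -> sorted leq (map block w).
Proof.
rewrite sorted_map; apply: sub_sorted => g h /pbw_rel_le; exact: rank_block.
Qed.

Lemma nonstandard_split w : ~~ standard w ->
  exists w1 g h w2, w = w1 ++ g :: h :: w2 /\ ~~ pbw_rel g h.
Proof.
rewrite /standard; elim: w => // g [|h w] IH //=.
rewrite negb_and; case: (boolP (pbw_rel g h)) => [gh /= /IH[w1 [a [b [w2 [-> ab]]]]]|gh _].
  by exists (g :: w1), a, b, w2.
by exists [::], g, h, w.
Qed.

(** Every word produced by one rewriting step must stay in P, so that straightening can be carried
    out inside P. *)
Definition closed_words P : Prop := forall w1 g h w2, ~~ pbw_rel g h ->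
  P (w1 ++ g :: h :: w2) ->
  [/\ P (w1 ++ h :: g :: w2), qmatch g h -> P (w1 ++ qprod g h :: w2)
    & qmatch h g -> P (w1 ++ qprod h g :: w2)].

(** Termination measure of straightening: a letter counts its rank once for each letter to its
    right, so moving the larger of two neighbours to the right lowers the total. *)
Fixpoint disorder w : nat := if w is g :: w' then (rank g * size w' + disorder w')%N else 0%N.

Lemma disorder_swap w1 g h w2 : (rank h < rank g)%N ->
  (disorder (w1 ++ h :: g :: w2) < disorder (w1 ++ g :: h :: w2))%N.
Proof.
move=> hg; elim: w1 => [|k w1 IH] /=; last by rewrite !size_cat /= ltn_add2l.
by rewrite !mulnS !addnA ltn_add2r addnAC !ltn_add2r.
Qed.

Hypothesis X_br : forall g h,
  X g * X h - ksign K g.2 h.2 *: (X h * X g) = qbracket X g h.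

Lemma word_swap w1 g h w2 : word (w1 ++ g :: h :: w2) =
  ksign K g.2 h.2 *: word (w1 ++ h :: g :: w2)
  + ((qmatch g h)%:R *: word (w1 ++ qprod g h :: w2)
     - (ksign K g.2 h.2 * (qmatch h g)%:R) *: word (w1 ++ qprod h g :: w2)).
Proof.
rewrite !word_cat /= !mulrA.
have /eqP := X_br g h; rewrite subr_eq => /eqP e.
rewrite -[_ * X g * X h]mulrA e /qbracket mulrDr mulrDl addrC; congr (_ + _).
  by rewrite -scalerAr -scalerAl mulrA.
by rewrite mulrBr mulrBl -!scalerAr -!scalerAl scalerA.
Qed.

(** Induction on [disorder]: a swap keeps the length, and the bracket terms are shorter and go
    unsorted into the second part. *)
Lemma straighten_word P w : closed_words P -> P w -> exists u1 u2,
  [/\ word w = u1 + u2, span (fun w' => [/\ P w', standard w' & size w' = size w]) u1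
    & span (fun w' => P w' /\ (size w' < size w)%N) u2].
Proof.
move=> cP; have [n] := ubnP (disorder w); elim: n w => // n IH w.
rewrite ltnS => dw Pw; case: (boolP (standard w)) => [sw|].
  by exists (word w), 0; split; [rewrite addr0|exact: span_word|exact: span0].
move=> /nonstandard_split[w1 [g [h [w2 [ew gh]]]]]; subst w.
have [Ps Pgh Phg] := cP w1 g h w2 gh Pw.
set L := (qmatch g h)%:R *: word (w1 ++ qprod g h :: w2)
  - (ksign K g.2 h.2 * (qmatch h g)%:R) *: word (w1 ++ qprod h g :: w2).
have sL : span (fun w' => P w' /\ (size w' < size (w1 ++ g :: h :: w2))%N) L.
  apply: spanB; [case: (boolP (qmatch g h)) => m|case: (boolP (qmatch h g)) => m];
    rewrite ?mulr0 ?scale0r; try exact: span0; apply/spanZ/span_word; split; auto;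
    by rewrite !size_cat /= ltn_add2l.
move: gh; rewrite /pbw_rel negb_or -leqNgt leq_eqVlt => /andP[/orP[/eqP/rank_inj e|lt _]].
  (* An odd letter next to itself: the relation says that twice the word equals the bracket
     terms. *)
  subst h; rewrite eqxx negbK /= => go; exists 0, (2^-1 *: L).
  split; [|exact: span0|exact: spanZ]; rewrite add0r.
  have := word_swap w1 g g w2; rewrite -/L /ksign go /= expr1 scaleN1r => /eqP.
  rewrite addrC -subr_eq opprK -mulr2n -scaler_nat => /eqP <-.
  by rewrite scalerA mulVf ?scale1r // pnatr_eq0.
have [|u1 [u2 [eu su1 su2]]] := IH (w1 ++ h :: g :: w2) _ Ps.
  exact: leq_trans (disorder_swap w1 w2 lt) dw.
have es : size (w1 ++ h :: g :: w2) = size (w1 ++ g :: h :: w2) by rewrite !size_cat.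
exists (ksign K g.2 h.2 *: u1), (ksign K g.2 h.2 *: u2 + L); rewrite -es.
split; [|exact: spanZ|by apply: spanD; [exact: spanZ|rewrite es]].
by rewrite addrA -scalerDr -eu word_swap.
Qed.

Lemma straighten_span P d u : closed_words P -> span (fun w => P w /\ (size w < d.+1)%N) u ->
  exists u1 u2,
  [/\ u = u1 + u2, span (fun w => [/\ P w, standard w & size w = d]) u1
    & span (fun w => P w /\ (size w < d)%N) u2].
Proof.
move=> cP; elim=> [|c w x [Pw sw] _ [u1 [u2 [eu s1 s2]]]].
  by exists 0, 0; split; [rewrite addr0|exact: span0|exact: span0].
move: sw; rewrite ltnS leq_eqVlt => /orP[/eqP sw|sw].
  have [v1 [v2 [ev t1 t2]]] := straighten_word cP Pw.
  exists (c *: v1 + u1), (c *: v2 + u2); rewrite -sw in s1 s2 *.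
  split; [|by apply: spanD => //; exact: spanZ|by apply: spanD => //; exact: spanZ].
  by rewrite ev eu scalerDr addrACA.
exists u1, (c *: word w + u2); split=> //; last by apply: span_cons.
by rewrite eu addrCA.
Qed.

Lemma span_standard P d u : closed_words P -> span (fun w => P w /\ (size w < d)%N) u ->
  span (fun w => [/\ P w, standard w & (size w < d)%N]) u.
Proof.
move=> cP; elim: d u => [|d IH] u su; first by apply: spanW su => w [].
have [u1 [u2 [-> s1 s2]]] := straighten_span cP su.
apply: spanD; first by apply: spanW s1 => w [Pw sw ->].
by apply: spanW (IH _ s2) => w [Pw sw lt]; split=> //; apply: leqW.
Qed.

Variable pbw : {linear A -> V}.
Hypothesis pbw1 : pbw 1 = vac K _.
Hypothesis pbwX : forall g u, pbw (X g * u) = rho_letter g (pbw u).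

Lemma pbw_word w : pbw (word w) = rho_word K w.
Proof. by elim: w => [|g w IH] /=; rewrite ?pbw1 // pbwX IH. Qed.

Definition symbol d u : V := fock_proj d (pbw u).

Lemma symbol_linear d : linear (symbol d).
Proof. by move=> a u v; rewrite /symbol !linearP. Qed.
HB.instance Definition _ d := GRing.isLinear.Build K A V *:%R (symbol d) (symbol_linear d).

Lemma symbol_word w : symbol (size w) (word w) = mul_word K w.
Proof. by rewrite /symbol pbw_word fock_proj_rho_word. Qed.

Lemma symbol_small P d u : span (fun w => P w /\ (size w < d)%N) u -> symbol d u = 0.
Proof.
elim=> [|c w x [Pw sw] _ IH]; first exact: linear0.
by rewrite linearP /= IH addr0 /symbol pbw_word fock_proj_rho_word_gt ?scaler0.
Qed.

(** The independence half of PBW: distinct ordered words of length d have as symbols nonzero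
    multiples of distinct monomials. *)
Lemma standard_free P d u :
  span (fun w => [/\ P w, standard w & size w = d]) u -> symbol d u = 0 -> u = 0.
Proof.
(* Collecting the combination over tuples gives each word a single coefficient. *)
move=> su; have [c ->] : exists c : d.-tuple letter -> K,
    u = \sum_(w : d.-tuple letter | standard w) c w *: word w.
  elim: su => [|a w x [Pw sw ew] _ [c ->]].
    by exists (fun=> 0); rewrite big1 // => i _; rewrite scale0r.
  have tw : size w == d by apply/eqP.
  exists (fun t => (t == Tuple tw)%:R * a + c t).
  under [RHS]eq_bigr do rewrite scalerDl; rewrite big_split /=; congr (_ + _).
  rewrite (bigD1 (Tuple tw)) //= eqxx mul1r big1 ?addr0 // => t /andP[_ /negbTE->].
  by rewrite mul0r scale0r.
move=> s0; apply: big1 => w0 sw0; suff -> : c w0 = 0 by rewrite scale0r.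
have := congr1 (fun phi : V => (phi (word_set w0))@_(word_mon w0)) s0.
rewrite linear_sum sum_ffunE raddf_sum ffunE mcoeff0 (bigD1 w0) //= big1 ?addr0.
  rewrite linearZ ffunE mcoeffZ /= -[d in symbol d](size_tuple w0) symbol_word => /eqP.
  rewrite mulf_eq0 => /orP[/eqP //|]; rewrite (negbTE (mul_word_coef _ _)) // => o.
  exact: standard_count.
move=> w /andP[sw ww0]; rewrite linearZ ffunE mcoeffZ /= -[d in symbol d](size_tuple w) symbol_word.
rewrite mul_word_coef0 ?mulr0 // => [o|o|]; [exact: standard_count|exact: standard_count|].
by apply: contra ww0 => pw; apply/eqP/val_inj/standard_eq.
Qed.

(** After straightening, the symbol sees only the ordered words of length d. By independence their
    combination vanishes, and what remains is shorter and still in P. *)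
Lemma span_lower P d u : closed_words P -> span (fun w => P w /\ (size w < d.+1)%N) u ->
  symbol d u = 0 -> span (fun w => P w /\ (size w < d)%N) u.
Proof.
move=> cP su; have [u1 [u2 [-> s1 s2]]] := straighten_span cP su.
by rewrite linearD /= (symbol_small s2) addr0 => /(standard_free s1) ->; rewrite add0r.
Qed.

End Span.

(** * Central elements *)

Section LetterValue.
Variables (K : numFieldType) (N : nat).
Local Notation V := (fock K ('I_N * 'I_N)%type).
Implicit Types g : qletter N.

Definition letter_value g : {mpoly K[N]} := if diag_letter g then 'X_(g.1.1) else 0.

Lemma restrict_mul_letter g (phi : V) :
  restrict (mul_letter g phi) = letter_value g * restrict phi.
Proof.
case: g => [[i j] b]; rewrite /restrict /mul_letter /letter_value /diag_letter /=.
case: b; first by rewrite ffunE inE mmap0 mul0r.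
rewrite ffunE rmorphM /= mmapX mmap1U /diag_point enum_rankK /=.
by case: ifP => // _; rewrite !mul0r.
Qed.

Lemma restrict_vac : restrict (vac K _) = 1 :> {mpoly K[N]}.
Proof. by rewrite /restrict ffunE eqxx rmorph1. Qed.

End LetterValue.

Section Center.
Local Opaque fock_proj mul_letter lder rder adv rho_letter restrict vac.
Variables (K : numFieldType) (N : nat) (A : algType K) (X : qletter N -> A).
Local Notation letter := (qletter N).
Local Notation V := (fock K ('I_N * 'I_N)%type).
Implicit Types (g h : letter) (w : seq letter) (u v : A) (P : seq letter -> Prop).
Hypothesis X_br : forall g h,
  X g * X h - ksign K g.2 h.2 *: (X h * X g) = qbracket X g h.
Variable pbw : {linear A -> V}.
Hypothesis pbw1 : pbw 1 = vac K _.
Hypothesis pbwX : forall g u, pbw (X g * u) = rho_letter g (pbw u).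

Local Notation word := (word X).
Local Notation symbol := (symbol pbw).

Definition supercomm g (q : bool) u : A := X g * u - ksign K g.2 q *: (u * X g).

Lemma supercomm_linear g q : linear (supercomm g q).
Proof.
move=> a u v; rewrite /supercomm mulrDr mulrDl -scalerAr -scalerAl scalerBr !scalerDr opprD addrACA.
by rewrite !scalerA [a * _]mulrC.
Qed.
HB.instance Definition _ g q :=
  GRing.isLinear.Build K A A *:%R (supercomm g q) (supercomm_linear g q).

(** The Leibniz rule for [g, h w] pushed through the action. It bounds the degree of the commutator,
    and its top component follows the recursion [adv_mul]. *)
Lemma pbw_supercomm_cons g h w :
  pbw (supercomm g (parity (h :: w)) (word (h :: w))) =
  qbracket (fun k => rho_letter k (rho_word K w)) g h +
  ksign K g.2 h.2 *: rho_letter h (pbw (supercomm g (parity w) (word w))).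
Proof.
rewrite -pbwX -linearZ /= -(pbw_word pbw1 pbwX).
have -> : qbracket (fun k => rho_letter k (pbw (word w))) g h = pbw (qbracket X g h * word w).
  rewrite /qbracket mulrBl -!scalerAl linearB !linearZ /= !pbwX.
  by [].
rewrite -linearD /= -X_br /supercomm /=; congr (pbw _).
rewrite mulrBl -scalerAl mulrBr scalerBr -scalerAr scalerA -ksignDr !mulrA.
by rewrite addrA subrK.
Qed.

Lemma fock_proj_cons d c h (Q Q' C D : V) : fock_proj d.+1 Q = Q' -> fock_proj d.+1 C = 0 ->
  fock_proj d C = D ->
  fock_proj d.+1 (Q + c *: rho_letter h C) = Q' + c *: mul_letter h D.
Proof.
by move=> eQ e0 eD; rewrite linearD linearZ /= eQ fock_proj_rho e0 eD linear0 addr0.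
Qed.

Lemma proj_supercomm_gt g w j : (size w < j)%N ->
  fock_proj j (pbw (supercomm g (parity w) (word w))) = 0.
Proof.
elim: w j => [|h w IH] [|j] //.
  by rewrite /supercomm /= mul1r mulr1 /ksign andbF expr0 scale1r subrr !linear0.
rewrite /= ltnS => wj; rewrite pbw_supercomm_cons.
have r0 k : fock_proj j.+1 (rho_letter k (rho_word K w)) = 0.
  by apply: (@fock_proj_rho_word_gt _ _ j.+1 (k :: w)).
apply: etrans (fock_proj_cons _ _ (qbracket_map (f := fock_proj j.+1) _ _ r0) (IH _ (leqW wj)) (IH _ wj)) _.
by rewrite /qbracket (linear0 (mul_letter h)) !scaler0 subrr addr0.
Qed.

Lemma proj_supercomm_size g w :
  fock_proj (size w) (pbw (supercomm g (parity w) (word w))) = adv g (mul_word K w).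
Proof.
elim: w => [|h w IH].
  by rewrite /supercomm /= mul1r mulr1 /ksign andbF expr0 scale1r subrr !linear0 adv_vac.
rewrite pbw_supercomm_cons.
have r0 k : fock_proj (size w).+1 (rho_letter k (rho_word K w)) = mul_letter k (mul_word K w).
  by apply: (@fock_proj_rho_word _ _ (k :: w)).
apply: etrans (fock_proj_cons _ _ (qbracket_map (f := fock_proj (size w).+1) _ _ r0)
  (proj_supercomm_gt g (ltnSn (size w))) IH) _.
by rewrite /= adv_mul addrC.
Qed.

Lemma symbol_supercomm_word g d w : (size w < d.+1)%N ->
  symbol d (supercomm g (parity w) (word w)) = adv g (symbol d (word w)).
Proof.
rewrite ltnS leq_eqVlt => /orP[/eqP <-|lt].
  transitivity (adv g (mul_word K w)); first exact: proj_supercomm_size.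
  by congr (adv g _); apply: esym; exact: (symbol_word pbw1 pbwX).
have s0 : symbol d (word w) = 0.
  by apply: (symbol_small pbw1 pbwX (P := fun=> True)); exact: span_word.
exact: etrans (proj_supercomm_gt g lt) (esym (etrans (congr1 (adv g) s0) (linear0 (adv g)))).
Qed.

Lemma symbol_supercomm g q d u : span X (fun w => parity w = q /\ (size w < d.+1)%N) u ->
  symbol d (supercomm g q u) = adv g (symbol d u).
Proof.
elim=> [|c w x [<- sw] _ IH]; first by rewrite !linear0.
rewrite (linearP (supercomm g _)) !(linearP (symbol d)) /= IH (linearP (adv g)) /=.
by rewrite (symbol_supercomm_word g sw).
Qed.

(** The substitute for the component of degree d of the Harish-Chandra polynomial. *)
Definition hc_symbol d u : {mpoly K[N]} := restrict (symbol d u).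

Lemma hc_symbol_linear d : linear (hc_symbol d).
Proof. by move=> a u v; rewrite /hc_symbol (linearP (symbol d)) (linearP (@restrict K N)). Qed.
HB.instance Definition _ d :=
  GRing.isLinear.Build K A {mpoly K[N]} *:%R (hc_symbol d) (hc_symbol_linear d).

Lemma hc_symbol_small P d u : span X (fun w => P w /\ (size w < d)%N) u -> hc_symbol d u = 0.
Proof. by move=> su; rewrite /hc_symbol (symbol_small pbw1 pbwX su) linear0. Qed.

Lemma hc_symbol_word d w : (size w < d.+1)%N ->
  hc_symbol d (word w) = if size w == d then \prod_(g <- w) letter_value K g else 0.
Proof.
rewrite ltnS leq_eqVlt => /orP[/eqP <-|lt].
  rewrite eqxx /hc_symbol (symbol_word pbw1 pbwX); elim: w => [|g w IH] /=.
    by rewrite big_nil restrict_vac.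
  by rewrite restrict_mul_letter IH big_cons.
rewrite (ltn_eqF lt) (hc_symbol_small (P := fun=> True)) //; exact: span_word.
Qed.

Lemma hc_symbolM P Q d e u v : span X (fun w => P w /\ (size w < d.+1)%N) u ->
  span X (fun w => Q w /\ (size w < e.+1)%N) v ->
  hc_symbol (d + e) (u * v) = hc_symbol d u * hc_symbol e v.
Proof.
move=> su sv; elim: su => [|c w x [_ sw] _ IH]; first by rewrite mul0r !linear0 mul0r.
rewrite mulrDl -scalerAl !(linearP (hc_symbol _)) /= IH mulrDl -scalerAl; congr (_ *: _ + _).
elim: sv => [|c' w' x' [_ sw'] _ IH']; first by rewrite mulr0 !linear0 mulr0.
rewrite mulrDr -scalerAr !(linearP (hc_symbol _)) /= IH' mulrDr -scalerAr; congr (_ *: _ + _).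
rewrite -word_cat !hc_symbol_word // size_cat; last by rewrite ltnS leq_add.
rewrite big_cat /=; move: sw sw'; rewrite !ltnS => sw sw'.
case: (eqVneq (size w) d) => [->|wd].
  by rewrite eqn_add2l; case: ifP => //; rewrite mulr0.
rewrite mul0r (_ : (_ + _ == _)%N = false) //; apply/ltn_eqF.
by rewrite -addSn leq_add // ltn_neqAle wd.
Qed.

Lemma letter_value_homog g : letter_value K g \is 1.-homog.
Proof. by rewrite /letter_value; case: ifP => _; rewrite ?rpred0 // dhomogX /= mdeg1. Qed.

Lemma hc_symbol_homog P d u : span X (fun w => P w /\ (size w < d.+1)%N) u ->
  hc_symbol d u \is d.-homog.
Proof.
elim=> [|c w x [_ sw] _ IH]; first by rewrite linear0 rpred0.
rewrite linearP /= rpredD ?rpredZ // hc_symbol_word //; case: eqP => [<-|_]; last exact: rpred0.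
elim: w {sw} => [|g w IHw]; first by rewrite big_nil dhomog1.
by rewrite big_cons; have := dhomogM (letter_value_homog g) IHw; rewrite add1n.
Qed.

Lemma hc_symbol_odd d u : span X (fun w => parity w = true /\ (size w < d.+1)%N) u ->
  hc_symbol d u = 0.
Proof.
elim=> [|c w x [pw sw] _ IH]; first exact: linear0.
rewrite linearP /= IH addr0 hc_symbol_word //; case: ifP => _; rewrite ?scaler0 //.
suff -> : \prod_(g <- w) letter_value K g = 0 by rewrite scaler0.
elim: w pw {sw} => //= g w IHw; rewrite big_cons /letter_value /diag_letter.
by case: g.2 => /=; [rewrite mul0r|move=> /IHw ->; rewrite mulr0].
Qed.

Lemma parity_closed q : closed_words (fun w => parity w = q).
Proof.
move=> w1 g h w2 _ <-; rewrite !parity_cat /=; split.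
- by rewrite (addbCA h.2).
- by rewrite -!addbA.
- by rewrite [h.2 (+) g.2]addbC -!addbA.
Qed.

Lemma any_closed : closed_words (N := N) (fun=> True).
Proof. by []. Qed.

(* the words spanning n_- U + U n_+ *)
Definition kernel_word w : Prop :=
  sorted leq (map (@block N) w) /\ has (fun g => block g != 1%N) w.

Lemma block_qprod g h : qmatch g h -> block g = block h -> block (qprod g h) = block g.
Proof.
case: g h => [[i j] b] [[k l] c]; rewrite /qmatch /qprod /block /= => /eqP <- {k}.
rewrite -!(inj_eq val_inj) /=.
case: (ltngtP j i) => // ji; case: (ltngtP l j) => // lj _.
- by rewrite (ltn_trans lj ji).
- by have := ltn_trans ji lj; case: ltngtP.
- by rewrite lj ji ltnn eqxx.
Qed.

(** In a block-sorted word, neighbours that are out of order lie in the same block. Swapping or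
    multiplying them stays in that block, since n_-, h and n_+ are each closed under products. *)
Lemma kernel_closed : closed_words kernel_word.
Proof.
move=> w1 g h w2 gh; rewrite /kernel_word !map_cat !has_cat /= => -[st hs].
have le_gh : (block g <= block h)%N.
  by have [_ /andP[]] := cat_sorted2 st.
have le_hg : (block h <= block g)%N.
  apply: rank_block; move: gh; rewrite /pbw_rel negb_or -leqNgt.
  by case/andP.
have e : block g = block h by apply/eqP; rewrite eqn_leq le_gh le_hg.
have sub b : subseq (map (@block N) w1 ++ b :: map (@block N) w2)
                    (map (@block N) w1 ++ b :: b :: map (@block N) w2).
  by apply: cat_subseq; [exact: subseq_refl|exact: subseq_cons].
have lt : transitive leq by move=> x y z; exact: leq_trans.
have {}hs : [|| has (fun k => block k != 1%N) w1, block g != 1%N | has (fun k => block k != 1%N) w2].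
  by move: hs; rewrite e; case: (block h != 1%N).
rewrite e in st; split=> [|m|m].
- by rewrite -e in st *; split=> //; move: hs; case: (block g != 1%N).
- by rewrite block_qprod //; split; [rewrite e; exact: (subseq_sorted lt (sub _) st)|exact: hs].
- by rewrite block_qprod //; split; [exact: (subseq_sorted lt (sub _) st)|rewrite -e].
Qed.

Lemma span_letter g : span X (fun w => w = [:: g]) (X g).
Proof. by rewrite -[X g]mulr1; apply: (@span_word _ _ _ _ _ [:: g]). Qed.

(** The factor from U is ordered first; a letter of the lowest block in front then keeps the word
    block-sorted. In [kernel_consr] a letter of the highest block is put at the end. *)
Lemma kernel_consl d x u : span X (fun w => exists2 g, w = [:: g] & block g = 0%N) x ->
  span X (fun w => True /\ (size w < d)%N) u ->
  span X (fun w => kernel_word w /\ (size w < d.+1)%N) (x * u).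
Proof.
move=> sx /(span_standard X_br any_closed); apply: spanM sx => _ w [g -> g0] [_ sw lt].
split=> //; rewrite /kernel_word /= g0; split=> //.
by have := standard_block sw; case: (map _ w).
Qed.

Lemma kernel_consr d x u : span X (fun w => exists2 g, w = [:: g] & block g = 2) x ->
  span X (fun w => True /\ (size w < d)%N) u ->
  span X (fun w => kernel_word w /\ (size w < d.+1)%N) (u * x).
Proof.
move=> sx /(span_standard X_br any_closed) su; apply: spanM su sx => w _ [_ sw lt] [g -> g2].
rewrite cats1 size_rcons; split=> //; rewrite /kernel_word has_rcons g2 map_rcons; split=> //.
have := standard_block sw; have b2 h : (block h <= 2)%N.
  by rewrite /block; case: ifP => // _; case: ifP.
case: w {sw lt} => //= h w; rewrite rcons_path => ->; rewrite g2 /=.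
by elim: w h => //= k w IH h; exact: IH.
Qed.

(** If the kernel words may be longer than d, their top terms cancel in u, and [span_lower] shortens
    them without leaving the kernel words. Once they have length at most d, each contains a letter
    outside h, of value 0. *)
Lemma hc_symbol_kernel e d u : span X (fun w => kernel_word w /\ (size w < e)%N) u ->
  span X (fun w => True /\ (size w < d.+1)%N) u -> hc_symbol d u = 0.
Proof.
elim: e => [|e IH] ke au.
  have -> : u = 0 by elim: ke => // c w x [].
  exact: linear0.
case: (ltnP d e) => [de|ed].
  apply: IH => //; apply: (span_lower X_br pbw1 pbwX kernel_closed) => //.
  apply: (symbol_small pbw1 pbwX (P := fun=> True)); apply: spanW au => w [_ lt]; split=> //.
  exact: leq_trans lt de.
elim: ke => [|c w x [[_ hw] sw] _ IHx]; first exact: linear0.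
rewrite linearP /= IHx addr0 hc_symbol_word; last exact: leq_trans sw _.
case: ifP => _; rewrite ?scaler0 //.
suff -> : \prod_(g <- w) letter_value K g = 0 by rewrite scaler0.
elim: w hw {sw} => //= g w IHw /orP[g1|/IHw pw]; rewrite big_cons; last by rewrite pw mulr0.
suff -> : letter_value K g = 0 by rewrite mul0r.
rewrite /letter_value /diag_letter; case: ifP => // /andP[_ /eqP gd].
by move: g1; rewrite /block gd ltnn eqxx.
Qed.

Definition cartan_eval (f : {mpoly K[N]}) : A :=
  mpoly.mmap (fun c => c%:A) (fun i => X ((i, i), false)) f.

Lemma cartan_mon (m : 'X_{1..N}) :
  span X (fun w => True /\ (size w < (mdeg m).+1)%N) (mmap1 (fun i => X ((i, i), false)) m) /\
  hc_symbol (mdeg m) (mmap1 (fun i => X ((i, i), false)) m) = 'X_[m].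
Proof.
pose R d u p := span X (fun w => True /\ (size w < d.+1)%N) u /\ hc_symbol d u = p.
have R1 : R 0%N 1 1.
  split; first by apply: (@span_word _ _ _ _ _ [::]).
  by rewrite -[X in hc_symbol _ X]/(word [::]) hc_symbol_word // eqxx big_nil.
have RM d u p e v q : R d u p -> R e v q -> R (d + e)%N (u * v) (p * q).
  move=> [su <-] [sv <-]; split; last by rewrite (hc_symbolM su sv).
  apply: (spanM _ su sv) => w w' [_ lw] [_ lw']; split=> //.
  by rewrite size_cat ltnS leq_add.
have RX i : R 1%N (X ((i, i), false)) 'X_i.
  have -> : X ((i, i), false) = word [:: ((i, i), false)] by rewrite /= mulr1.
  split; first exact: span_word.
  by rewrite hc_symbol_word // eqxx big_seq1 /letter_value /diag_letter /= eqxx.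
rewrite mdegE mpolyXE_id /mmap1; apply: (big_ind3 R) => [//|d u p e v q|i _].
  exact: RM.
elim: (m i) => [|k IHk]; first by rewrite !expr0.
by rewrite !exprS -add1n; apply: RM.
Qed.

Lemma cartan_eval_symbol d f : (msize f <= d.+1)%N ->
  span X (fun w => True /\ (size w < d.+1)%N) (cartan_eval f) /\
  hc_symbol d (cartan_eval f) = pihomog mdeg d f.
Proof.
move=> fd; have md m : m \in msupp f -> (mdeg m <= d)%N.
  by move=> mf; rewrite -ltnS; apply: leq_trans fd; exact: msize_mdeg_lt.
rewrite /cartan_eval /mpoly.mmap.
have -> : \sum_(m <- msupp f) (f@_m)%:A * mmap1 (fun i => X ((i, i), false)) m =
    \sum_(m <- msupp f) f@_m *: mmap1 (fun i => X ((i, i), false)) m.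
  by apply: eq_bigr => m _; rewrite mulr_algl.
split.
  rewrite big_seq; apply: span_sum => m /md mf; apply: spanZ.
  have [sm _] := cartan_mon m; apply: spanW sm => w [_ lt]; split=> //.
  by apply: leq_trans lt _.
rewrite linear_sum pihomogE [RHS]big_mkcond /= !big_seq; apply: eq_bigr => m /md mf.
rewrite linearZ /=; have [sm hm] := cartan_mon m.
case: eqP => [<-|/eqP ne]; first by rewrite hm.
rewrite (hc_symbol_small (P := fun=> True)) ?scaler0 //; apply: spanW sm => w [_ lt]; split=> //.
by apply: leq_trans lt _; rewrite ltn_neqAle ne.
Qed.

Definition central q u : Prop := forall g, supercomm g q u = 0.

Lemma symbol_invariant q d u : span X (fun w => parity w = q /\ (size w < d.+1)%N) u ->
  central q u -> forall g, adv g (symbol d u) = 0.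
Proof. by move=> su cu g; rewrite -(symbol_supercomm g su) cu linear0. Qed.

Lemma central_lower q d u : span X (fun w => parity w = q /\ (size w < d.+1)%N) u ->
  central q u -> hc_symbol d u = 0 -> span X (fun w => parity w = q /\ (size w < d)%N) u.
Proof.
move=> su cu h0; apply: (span_lower X_br pbw1 pbwX (@parity_closed q) su).
by apply: invariant_restrict_eq0 h0; exact: symbol_invariant su cu.
Qed.

Lemma central_odd d u : span X (fun w => parity w = true /\ (size w < d)%N) u ->
  central true u -> u = 0.
Proof.
move=> + cu; elim: d => [|d IH] su; first by elim: su => // c w x [].
by apply/IH/central_lower => //; exact: hc_symbol_odd.
Qed.

(** For k >= r, once u has degree at most k, so has its difference with Q(F_ii); the difference lies
    in the kernel, hence the restricted symbol of u is the component of degree k of Q. It is 0 for k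
    > r, which brings an arbitrary bound d down to r + 1. *)
Lemma capelli_symbol r d Q u : span X (fun w => parity w = false /\ (size w < d)%N) u ->
  central false u -> (exists e, span X (fun w => kernel_word w /\ (size w < e)%N) (u - cartan_eval Q)) ->
  (msize Q <= r.+1)%N ->
  span X (fun w => parity w = false /\ (size w < r.+1)%N) u /\ hc_symbol r u = pihomog mdeg r Q.
Proof.
move=> su cu [e ku] Qr.
have eq_symbol k : (r <= k)%N -> span X (fun w => parity w = false /\ (size w < k.+1)%N) u ->
    hc_symbol k u = pihomog mdeg k Q.
  move=> rk sk; have [cQ <-] := cartan_eval_symbol (leq_trans Qr (rk : r.+1 <= k.+1)%N).
  apply/eqP; rewrite -subr_eq0 -linearB /=; apply/eqP; apply: (hc_symbol_kernel ku).
  by apply: spanB => //; apply: spanW sk => w [].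
suff sr : span X (fun w => parity w = false /\ (size w < r.+1)%N) u by split=> //; exact: eq_symbol.
elim: d su => [|d IH] su; first by apply: spanW su => w [].
case: (ltnP r d) => [rd|dr]; last first.
  by apply: spanW su => w [-> lt]; split=> //; apply: leq_trans lt _.
apply/IH/central_lower => //; rewrite eq_symbol ?(ltnW rd) //.
rewrite pihomogE big1_seq // => m /andP[/eqP md mQ].
by have := leq_trans (msize_mdeg_lt mQ) Qr; rewrite md ltnS leqNgt rd.
Qed.

Lemma pihomogM d (p q : {mpoly K[N]}) :
  pihomog mdeg d (p * q) = \sum_(a < d.+1) pihomog mdeg a p * pihomog mdeg (d - a) q.
Proof.
elim/mpolyind: p => [|c m p _ _ IH].
  by rewrite mul0r linear0 big1 // => a _; rewrite linear0 mul0r.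
rewrite mulrDl linearD /= IH; under [RHS]eq_bigr do rewrite linearD mulrDl.
rewrite big_split /=; congr (_ + _) => {IH p}.
elim/mpolyind: q => [|c' m' q _ _ IH].
  by rewrite mulr0 linear0 big1 // => a _; rewrite linear0 mulr0.
rewrite mulrDr linearD /= IH; under [RHS]eq_bigr do rewrite linearD mulrDr.
rewrite big_split /=; congr (_ + _) => {IH q}.
rewrite -scalerAl -scalerAr -mpolyXD !linearZ /= pihomogX /= mdegD.
under eq_bigr do rewrite !linearZ /= -scalerAl -scalerAr !pihomogX /=.
case: eqP => [e|ne].
  have lt : (mdeg m < d.+1)%N by rewrite ltnS -e leq_addr.
  have e' : mdeg m' = (d - mdeg m)%N by rewrite -e addKn.
  rewrite (bigD1 (Ordinal lt)) //= eqxx e' eqxx mpolyXD big1 ?addr0 // => a.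
  by rewrite -(inj_eq val_inj) /= eq_sym => /negbTE ->; rewrite mul0r !scaler0.
rewrite !scaler0 big1 // => a _; case: eqP => [ea|]; last by rewrite mul0r !scaler0.
case: eqP => [eb|]; last by rewrite mulr0 !scaler0.
by case: ne; rewrite ea eb subnKC // -ltnS.
Qed.

Lemma supercomm_even g u : supercomm g false u = X g * u - u * X g.
Proof. by rewrite /supercomm /ksign andbF expr0 scale1r. Qed.

Lemma centralM u v : central false u -> central false v -> central false (u * v).
Proof.
have cE x : central false x -> forall g, X g * x = x * X g.
  by move=> cx g; apply/eqP; rewrite -subr_eq0 -supercomm_even cx.
move=> /cE cu /cE cv g; rewrite supercomm_even mulrA cu -mulrA cv mulrA.
exact: subrr.
Qed.

(** Here [D k] stands for D_(2k+1). *)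
Variable D : nat -> A.
Hypothesis D_spec : forall k,
  [/\ span X (fun w => parity w = false /\ (size w < k.*2.+1.+1)%N) (D k), central false (D k)
    & hc_symbol k.*2.+1 (D k) = qpoly K N k.*2.+1].

Local Notation gen := (@subalg_gen K A (fun x => exists k, x = D k)).

Definition lifted d f v : Prop :=
  [/\ gen v, central false v, span X (fun w => parity w = false /\ (size w < d.+1)%N) v
    & hc_symbol d v = f].

Lemma lifted0 d : lifted d 0 0.
Proof.
split; [|by move=> g; exact: linear0|exact: span0|exact: linear0].
by rewrite -(scale0r (1 : A)); apply: subalg_genZ; exact: subalg_gen1.
Qed.

Lemma lifted1 : lifted 0 1 1.
Proof.
split; [exact: subalg_gen1| |by apply: (@span_word _ _ _ _ _ [::])|].
  by move=> g; rewrite supercomm_even mulr1 mul1r subrr.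
by rewrite -[X in hc_symbol _ X]/(word [::]) hc_symbol_word // eqxx big_nil.
Qed.

Lemma liftedZ d c f v : lifted d f v -> lifted d (c *: f) (c *: v).
Proof.
move=> [gv cv sv <-]; split; [exact: subalg_genZ| |exact: spanZ|by rewrite linearZ].
by move=> g; rewrite linearZ /= cv scaler0.
Qed.

Lemma liftedD d f f' v v' : lifted d f v -> lifted d f' v' -> lifted d (f + f') (v + v').
Proof.
move=> [gv cv sv <-] [gv' cv' sv' <-]; split; [exact: subalg_genD| |exact: spanD|by rewrite linearD].
by move=> g; rewrite linearD /= cv cv' addr0.
Qed.

Lemma liftedM d d' f f' v v' : lifted d f v -> lifted d' f' v' -> lifted (d + d') (f * f') (v * v').
Proof.
move=> [gv cv sv <-] [gv' cv' sv' <-].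
split; [exact: subalg_genM|exact: centralM| |exact: hc_symbolM sv sv'].
apply: (spanM _ sv sv') => w w' [pw lw] [pw' lw'].
by rewrite parity_cat pw pw' size_cat ltnS leq_add.
Qed.

(** Only the symbol in a given degree is controlled, so each homogeneous component is lifted by
    itself; for a product, all pairs of components with degrees adding up to d are used. *)
Lemma lifted_evalq e d : exists v,
  lifted d (pihomog mdeg d (evalq (@mpolyC N K) (fun k => qpoly K N k.*2.+1) e)) v.
Proof.
elim: e d => [c|r|a IHa b IHb|a IHa b IHb] d /=.
- have c0 : c%:MP_[N] \is 0.-homog by rewrite -[c]mulr1 mpolyCM mul_mpolyC rpredZ // dhomog1.
  case: d => [|d]; last by exists 0; rewrite (pihomog_ne0 _ c0) //; exact: lifted0.
  exists (c *: 1); rewrite (pihomog_dE c0) -[c in c%:MP]mulr1 mpolyCM mul_mpolyC.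
  exact/liftedZ/lifted1.
- have h := qpoly_homog K N r.*2.+1; case: (eqVneq d r.*2.+1) => [->|ne].
    by exists (D r); rewrite (pihomog_dE h); have [sD cD hD] := D_spec r; split=> //;
      apply: subalg_gen_in; exists r.
  by exists 0; rewrite (pihomog_ne0 _ h) 1?eq_sym //; exact: lifted0.
- have [u hu] := IHa d; have [v hv] := IHb d; exists (u + v); rewrite linearD.
  exact: liftedD.
(* A product needs lifts of both factors in all degrees up to d, chosen here as functions of the
   degree. *)
have [u hu] := choice IHa; have [v hv] := choice IHb.
exists (\sum_(k < d.+1) u k * v (d - k)%N); rewrite pihomogM.
apply: (big_ind2 (lifted d)) => [|f x f' x'|k _]; [exact: lifted0|exact: liftedD|].
by rewrite -{1}(subnKC (ltnSE (ltn_ord k))); apply: liftedM.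
Qed.

Lemma central_generated d u : span X (fun w => parity w = false /\ (size w < d)%N) u ->
  central false u -> gen u.
Proof.
elim: d u => [|d IH] u su cu.
  have -> : u = 0 by elim: su => // c w x [].
  by have [] := lifted0 0.
have hom : hc_symbol d u \is d.-homog by exact: hc_symbol_homog su.
have [e he] := supersymmetric_gen_odd (restrict_supersymmetric (symbol_invariant su cu)).
have [v [gv cv sv hv]] := lifted_evalq e d.
rewrite -(subrK v u); apply: subalg_genD => //; apply: IH; last first.
  by move=> g; rewrite linearB /= cu cv subrr.
apply: central_lower; first exact: spanB.
  by move=> g; rewrite linearB /= cu cv subrr.
by rewrite linearB /= hv -he -[restrict _]/(hc_symbol d u) (pihomog_dE hom) subrr.
Qed.

End Center.

(** * Capelli elements *)

Section Qminus.
Variables (K : numFieldType) (N : nat).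
Implicit Types (Q : {mpoly K[N]}) (v : 'I_N -> K).

Lemma falling_morph (A B : nzRingType) (f : {rmorphism A -> B}) u r :
  f (falling u r) = falling (f u) r.
Proof. by rewrite rmorph_prod; apply: eq_bigr => k _; rewrite rmorphB /= rmorph_nat. Qed.

(** The identity of fractions is multiplied by the product V of all denominators so that it can be
    evaluated; V does not vanish at points with distinct coordinates. *)
Lemma is_Qminus_meval r Q v : injective v -> is_Qminus r Q ->
  Q.@[v] = \sum_i qweight v i * falling (v i) r.
Proof.
move=> vI; rewrite /is_Qminus /Qminus_frac => hQ.
pose num i : {mpoly K[N]} := \prod_(j < N | j != i) ('X_i + 'X_j).
pose den i : {mpoly K[N]} := \prod_(j < N | j != i) ('X_i - 'X_j).
have vX (i : 'I_N) : ('X_i : {mpoly K[N]}).@[v] = v i by rewrite mevalXU.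
have den_v i : (den i).@[v] = \prod_(j < N | j != i) (v i - v j).
  by rewrite rmorph_prod; apply: eq_bigr => j _; rewrite /= mevalB !vX.
have num_v i : (num i).@[v] = \prod_(j < N | j != i) (v i + v j).
  by rewrite rmorph_prod; apply: eq_bigr => j _; rewrite /= mevalD !vX.
have den_v0 i : (den i).@[v] != 0.
  rewrite den_v; apply/prodf_neq0 => j ji; rewrite subr_eq0 (inj_eq vI).
  by rewrite eq_sym.
have den0 i : den i != 0 by apply: contraNneq (den_v0 i) => ->; rewrite meval0.
pose V := \prod_i den i; have VE i : V = den i * \prod_(j | j != i) den j by rewrite /V (bigD1 i).
have eqP : Q * V = 2 * \sum_i falling 'X_i r * num i * \prod_(j | j != i) den j.
  apply/eqP; rewrite -tofrac_eq; apply/eqP; rewrite rmorphM /= hQ -mulrA mulr_suml rmorphM rmorph_nat.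
  congr (_ * _); rewrite rmorph_sum; apply: eq_bigr => i _.
  rewrite (VE i) prodf_div !rmorphM /= -!rmorph_prod -/(num i) -/(den i) /=.
  rewrite -!mulrA; congr (_ * (_ * _)).
  by rewrite mulKf // tofrac_eq0.
have V0 : V.@[v] != 0 by rewrite rmorph_prod; apply/prodf_neq0 => i _; exact: den_v0.
apply: (mulIf V0); rewrite -mevalM eqP mevalM rmorph_nat mulr_suml rmorph_sum mulr_sumr.
apply: eq_bigr => i _; rewrite /= !mevalM (falling_morph (meval v)) /= vX.
rewrite (VE i) mevalM /qweight prodf_div -num_v -den_v.
by field; exact: den_v0.
Qed.

(** Q along the line t |-> t v; its coefficients are the values at v of the homogeneous components
    of Q. *)
Definition radial v Q : {poly K} := mpoly.mmap polyC (fun i => v i *: 'X) Q.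

Lemma horner_radial v Q t : (radial v Q).[t] = Q.@[fun i => v i * t].
Proof.
by rewrite horner_mmap; apply: meval_eq => i; rewrite hornerZ hornerX.
Qed.

Lemma coef_radial v Q k : (radial v Q)`_k = (pihomog mdeg k Q).@[v].
Proof.
rewrite pihomogE [in RHS]big_mkcond /= raddf_sum /radial /mpoly.mmap coef_sum.
apply: eq_bigr => m _; rewrite coefCM.
have -> : mmap1 (fun i => v i *: 'X) m = (\prod_i v i ^+ m i) *: 'X^(mdeg m).
  rewrite /mmap1 mdegE expr_sum -scaler_prod; apply: eq_bigr => i _.
  by rewrite exprZn.
rewrite coefZ coefXn eq_sym; case: eqP => _; rewrite ?mulr0 ?raddf0 //=.
by rewrite mulr1 mevalZ mevalX.
Qed.

Lemma coef_falling c r : [/\ (falling (c *: 'X : {poly K}) r)`_r = c ^+ r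
  & forall k, (r < k)%N -> (falling (c *: 'X : {poly K}) r)`_k = 0].
Proof.
elim: r => [|r [IHr IHk]]; rewrite /falling ?big_ord0 ?big_ord_recr /=.
  by rewrite expr0 coefC eqxx; split=> // -[] // k _; rewrite coefC.
rewrite -/(falling _ r) mulrBr -scalerAr; split=> [|[|k] rk] //.
  by rewrite coefB coefZ coefMX /= IHr -polyC_natr coefMC IHk // mul0r subr0 exprS.
by rewrite coefB coefZ coefMX /= -polyC_natr coefMC !IHk ?mulr0 ?mul0r ?subr0 // ltnW.
Qed.

(** The weights do not change when v is scaled, so along the line through v both sides are
    polynomials in t that agree at positive integers. *)
Lemma is_Qminus_coef r Q v k : injective v -> is_Qminus r Q ->
  (pihomog mdeg k Q).@[v] = \sum_i qweight v i * (falling (v i *: 'X) r)`_k.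
Proof.
move=> vI hQ; rewrite -coef_radial.
suff -> : radial v Q = \sum_i qweight v i *: falling (v i *: 'X) r.
  by rewrite coef_sum; apply: eq_bigr => i _; rewrite coefZ.
apply/eqP; rewrite -subr_eq0; apply/eqP/poly_nat_eq0 => n; set t := n.+1%:R.
have t0 : t != 0 :> K by rewrite pnatr_eq0.
have tvI : injective (fun i => v i * t) by move=> i j /(mulIf t0) /vI.
rewrite hornerD hornerN horner_radial (is_Qminus_meval tvI hQ) horner_sum.
apply/eqP; rewrite subr_eq0; apply/eqP/eq_bigr => i _; rewrite hornerZ.
have -> : (falling (v i *: 'X) r).[t] = falling (v i * t) r.
  apply: etrans (falling_morph (horner_eval t) _ _) _.
  by rewrite /= /horner_eval hornerZ hornerX.
congr (_ * _).
rewrite /qweight; congr (_ * _); apply: eq_bigr => j ji.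
by rewrite -mulrDl -mulrBl -mulf_div divff // mulr1.
Qed.

(** The falling power is monic of degree r + 1, so the top component is the weighted sum of the
    v_i^(r+1), which is q_(r+1) by [qcoef_sum]. *)
Lemma is_Qminus_top r Q : is_Qminus r.+1 Q ->
  (msize Q <= r.+2)%N /\ pihomog mdeg r.+1 Q = qpoly K N r.+1.
Proof.
move=> hQ; have top k : (r.+1 < k)%N -> pihomog mdeg k Q = 0.
  move=> rk; apply: mpoly_injective_eq => v vI; rewrite (is_Qminus_coef _ vI hQ) meval0.
  by rewrite big1 // => i _; have [_ ->] := coef_falling (v i) r.+1; rewrite ?mulr0.
split; last first.
  apply: mpoly_injective_eq => v vI; rewrite (is_Qminus_coef _ vI hQ) meval_qpoly qcoef_sum //.
  by apply: eq_bigr => i _; have [-> _] := coef_falling (v i) r.+1.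
rewrite leqNgt; apply/negP => lt.
have Q0 : Q != 0 by apply: contraTneq lt => ->; rewrite msize0.
have := mlead_supp Q0; rewrite mcoeff_msupp.
have := congr1 (mcoeff (mlead Q)) (top (mdeg (mlead Q)) _).
by rewrite mcoeff_pihomog eqxx mcoeff0 => ->; rewrite ?eqxx // -ltnS mlead_deg.
Qed.
End Qminus.

Lemma supercommute (K : numFieldType) (A : algType K) (b p : bool) (x z : A) :
  z * x = (-1) ^+ (p && b) * (x * z) -> x * z - ksign K b p *: (z * x) = 0.
Proof.
rewrite sign_scale /ksign andbC => ->; rewrite scalerA -expr2.
by rewrite sqrr_sign scale1r subrr.
Qed.

Section EvenSupercommute.
Variables (K : pzRingType) (A : algType K).
Implicit Types x y u : A.

(** The sign (-1)^0 is kept because the condition in [supercentral false] reduces to this form. *)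
Definition commute_even x u : Prop := x * u = (-1) ^+ 0 * (u * x).

Lemma commute_evenP x u : commute_even x u <-> x * u = u * x.
Proof. by rewrite /commute_even expr0 mul1r. Qed.

Lemma commute_even1 u : commute_even 1 u.
Proof. by apply/commute_evenP; rewrite mul1r mulr1. Qed.

Lemma commute_evenD x y u : commute_even x u -> commute_even y u -> commute_even (x + y) u.
Proof. by move=> /commute_evenP ex /commute_evenP ey; apply/commute_evenP; rewrite mulrDl mulrDr ex ey. Qed.

Lemma commute_evenZ a x u : commute_even x u -> commute_even (a *: x) u.
Proof. by move=> /commute_evenP ex; apply/commute_evenP; rewrite -scalerAl -scalerAr ex. Qed.

Lemma commute_evenM x y u : commute_even x u -> commute_even y u -> commute_even (x * y) u.
Proof.
move=> /commute_evenP ex /commute_evenP ey; apply/commute_evenP.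
by rewrite -mulrA ey mulrA ex mulrA.
Qed.

Lemma supercommute0 n u : 0 * u = (-1) ^+ n * (u * 0).
Proof. by rewrite mul0r !mulr0. Qed.

End EvenSupercommute.

(** * Application to U(q_N) *)

Section Main.
Variables (K : numFieldType) (N : nat).
Local Notation U := (U_q K N).
Local Notation UF := (@UF K N).
Local Notation q_hom := (@q_hom K N).
Local Notation q_br := (@q_br K N).

Lemma U_gen_span (P : qletter N -> Prop) (x : qN K N) :
  (forall g, P g \/ qcoord x g = 0) -> span UF (fun w => exists2 g, w = [:: g] & P g) (U_gen x).
Proof.
move=> Px; rewrite U_gen_sum; apply: span_sum => g _.
have [Pg|->] := Px g; last by rewrite scale0r; exact: span0.
by apply: spanZ; apply: spanW (span_letter UF g) => w ->; exists g.
Qed.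

Lemma uea_hom_span q (u : U) : @uea_hom K (qN K N) q_hom q_br q u ->
  exists d, span UF (fun w => parity w = q /\ (size w < d)%N) u.
Proof.
elim=> {q u} [p x hx|p||p u v _ [d su] _ [e sv]|p a u _ [d su]|p q u v _ [d su] _ [e sv]].
- exists 2; have sx : span UF (fun w => exists2 g, w = [:: g] & g.2 = p) (U_gen x).
    by apply: U_gen_span => g; have [|/(qcoord_hom hx)] := eqVneq g.2 p; [left|right].
  by apply: spanW sx => _ [g -> gp]; rewrite /= addbF.
- by exists 0%N; exact: span0.
- by exists 1%N; apply: (@span_word _ _ _ _ _ [::]).
- exists (maxn d e); apply: spanD; [apply: spanW su|apply: spanW sv] => w [-> lt]; split=> //;
    by rewrite leq_max lt ?orbT.
- by exists d; exact: spanZ.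
exists (d + e)%N; apply: (spanM _ su sv) => w w' [<- lw] [<- lw']; rewrite parity_cat size_cat.
by split=> //; rewrite -addnS leq_add // ltnW.
Qed.

Lemma uea_span (u : U) : exists d, span UF (fun w => True /\ (size w < d)%N) u.
Proof.
elim/uea_ind_gen: u => [|u v [d su] [e sv]|a u [d su]|x u [d su]].
- by exists 1%N; apply: (@span_word _ _ _ _ _ [::]).
- exists (maxn d e); apply: spanD; [apply: spanW su|apply: spanW sv] => w [_ lt]; split=> //;
    by rewrite leq_max lt ?orbT.
- by exists d; exact: spanZ.
have sx : span UF (fun w => exists2 g, w = [:: g] & True) (U_gen x) by apply: U_gen_span; left.
by exists d.+1; apply: (spanM _ sx su) => _ w [g -> _] [_ lt].
Qed.

(** The relation r treats n_- and n_+ at once. *)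
Lemma triangular_coord (r : rel 'I_N) (M : 'M[K]_(N + N)) g :
  M \in (\sum_(a < N) \sum_(b < N | r a b)
     (<[gl_F K (pos a) (pos b)]> + <[gl_F K (pos a) (neg (pos b))]>))%VS ->
  ~~ r g.1.1 g.1.2 -> M (unsplit (pos g.1.1)) (unsplit (col_idx g)) = 0.
Proof.
move=> /memv_sumP[f fP ->] rg; rewrite summxE big1 // => a _.
have /memv_sumP[h hP ->] := fP a isT; rewrite summxE big1 // => b rab.
have /memv_addP[_ /vlineP[c ->] [_ /vlineP[c' ->] ->]] := hP b rab.
rewrite mxE [X in X + _]mxE [X in _ + X]mxE -[gl_F K _ (pos b)]/(mxF K ((a, b), false)).
rewrite -[gl_F K _ (neg _)]/(mxF K ((a, b), true)) !mxF_pos.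
case: g rg => [[i j] s] /= rg; rewrite !col_idx_inj !xpair_eqE.
have [ia|_] := eqVneq i a; last by rewrite !mulr0 addr0.
have [jb|_] := eqVneq j b; last by rewrite !mulr0 addr0.
by case/negP: rg; rewrite ia jb.
Qed.

Lemma n_minus_coord (x : qN K N) g : vsval x \in n_minus K N -> block g != 0%N -> qcoord x g = 0.
Proof.
move=> xn gb; apply: (triangular_coord (r := fun a b : 'I_N => (b < a)%N) xn).
by apply: contra gb; rewrite /block => ->.
Qed.

Lemma n_plus_coord (x : qN K N) g : vsval x \in n_plus K N -> block g != 2 -> qcoord x g = 0.
Proof.
move=> xn gb; apply: (triangular_coord (r := fun a b : 'I_N => (a < b)%N) xn).
apply: contra gb => lt; rewrite /block ltnNge ltnW //= -(inj_eq val_inj) /=.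
by rewrite (ltn_eqF lt).
Qed.

Lemma span_bound (P : seq (qletter N) -> Prop) (I : eqType) (s : seq I) (F : I -> U) :
  (forall p, p \in s -> exists e, span UF (fun w => P w /\ (size w < e)%N) (F p)) ->
  exists e, span UF (fun w => P w /\ (size w < e)%N) (\sum_(p <- s) F p).
Proof.
elim: s => [|p s IH] h; first by exists 0%N; rewrite big_nil; exact: span0.
have [d sd] := h p (mem_head _ _); have [|e se] := IH.
  by move=> q qs; apply: h; rewrite inE qs orbT.
exists (maxn d e); rewrite big_cons; apply: spanD; [apply: spanW sd|apply: spanW se] => w [Pw lt];
  by split=> //; rewrite leq_max lt ?orbT.
Qed.

Lemma HC_kernel_span (u : U) : HC_kernel u ->
  exists e, span UF (fun w => kernel_word w /\ (size w < e)%N) u.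
Proof.
move=> [s [t [sn tn ->]]].
have [p ps|d sd] := @span_bound (@kernel_word N) _ s (fun p => U_gen p.1 * p.2).
  have [e se] := uea_span p.2; exists e.+1; apply: (kernel_consl (@UF_br K N)) se.
  by apply: U_gen_span => g; have [|/(n_minus_coord (sn p ps))] := eqVneq (block g) 0%N; [left|right].
have [p pt|e se] := @span_bound (@kernel_word N) _ t (fun p => p.2 * U_gen p.1).
  have [e se] := uea_span p.2; exists e.+1; apply: (kernel_consr (@UF_br K N)) se.
  by apply: U_gen_span => g; have [|/(n_plus_coord (tn p pt))] := eqVneq (block g) 2; [left|right].
exists (maxn d e); apply: spanD; [apply: spanW sd|apply: spanW se] => w [Pw lt];
  by split=> //; rewrite leq_max lt ?orbT.
Qed.

Lemma supercentral_central p (z : U) : @supercentral K (qN K N) q_hom q_br p z -> central UF p z.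
Proof.
move=> [_ cz] g; apply: supercommute; exact: cz (UF_hom K g).
Qed.

Lemma supercenter_even (z : U) : Z_q z -> @supercentral K (qN K N) q_hom q_br false z.
Proof.
move=> [z0 [z1 [c0 c1 ez]]]; have [d s1] := uea_hom_span (proj1 c1).
have z10 : z1 = 0 by exact: (central_odd (@UF_br K N) (@pbw1 K N) (@pbw_UF K N)) s1 (supercentral_central c1).
have ez0 : z = z0 by apply: etrans ez (etrans (congr1 _ z10) (addr0 z0)).
by move: c0; rewrite -ez0.
Qed.

Lemma even_supercenter (z : U) : @supercentral K (qN K N) q_hom q_br false z -> Z_q z.
Proof.
move=> cz; exists z, 0; split; [exact: cz| |exact: esym (addr0 z)].
by split=> [|q u _]; [exact: uea_hom0|exact: supercommute0].
Qed.

Lemma generated_supercenter (S : U -> Prop) (z : U) :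
  (forall x, S x -> Z_q x) -> subalg_gen S z -> Z_q z.
Proof.
move=> cS gz; apply: even_supercenter.
elim: gz => {z} [x Sx||x y _ [hx cx] _ [hy cy]|a x _ [hx cx]|x y _ [hx cx] _ [hy cy]].
- exact: supercenter_even (cS x Sx).
- by split=> [|q u _]; [exact: uea_hom1|exact: commute_even1].
- split=> [|q u hu]; first exact: uea_homD.
  exact: commute_evenD (cx q u hu) (cy q u hu).
- split=> [|q u hu]; first exact: uea_homZ.
  exact: commute_evenZ (cx q u hu).
split=> [|q u hu]; first exact: (uea_homM hx hy).
exact: commute_evenM (cx q u hu) (cy q u hu).
Qed.

Lemma capelli_spec (D : nat -> U) k : is_capelli D ->
  [/\ span UF (fun w => parity w = false /\ (size w < k.*2.+1.+1)%N) (D k.*2.+1),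
      central UF false (D k.*2.+1)
    & hc_symbol (@pbw K N) k.*2.+1 (D k.*2.+1) = qpoly K N k.*2.+1].
Proof.
move=> [_ cap]; have [//|/supercenter_even cD [Q hQ hc]] := cap k.*2.+1.
have [d sD] := uea_hom_span (proj1 cD); have cU := supercentral_central cD.
have [Qr top] := is_Qminus_top hQ.
have [sD' hD] := capelli_symbol (@UF_br K N) (@pbw1 K N) (@pbw_UF K N) sD cU (HC_kernel_span hc) Qr.
by split=> //; apply: etrans hD top.
Qed.

Lemma supercenter_capelli (D : nat -> U) : is_capelli D ->
  forall z, Z_q z <-> subalg_gen (fun x => exists k, x = D k.*2.+1) z.
Proof.
move=> capD z; split=> [/supercenter_even cz|].
  have [d sz] := uea_hom_span (proj1 cz).
  exact: (central_generated (@UF_br K N) (@pbw1 K N) (@pbw_UF K N) (fun k => capelli_spec k capD))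
    sz (supercentral_central cz).
apply: generated_supercenter => _ [k ->]; have [_ cap] := capD.
by have [] := cap k.*2.+1 isT.
Qed.

End Main.

Theorem theorem4p4 (R : realType) (N : nat) (N_ge1 : (1 <= N)%N)
    (D : nat -> U_q R[i] N) (D_capelli : is_capelli D) :
  forall z : U_q R[i] N,
    Z_q z <-> subalg_gen (fun x => exists k : nat, x = D k.*2.+1) z.
Proof. exact: (@supercenter_capelli R[i] N D D_capelli). Qed.
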